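(* Let $T$ be the tiling of $\mathbb H^2$ by regular right-angled pentagons, with hyperbolic metric $d_{\mathbb H}$. The dual tiling $T^*$, with five quadrilaterals at every vertex, can be identified with a CAT(0) square complex $\widetilde X$, with combinatorial metric $d_{\widetilde X}$. Then the identity map $\operatorname{id}:(\widetilde X,d_{\widetilde X})\to(\mathbb H^2,d_{\mathbb H})$ is a $\lambda$-quasiisometry, where $$\lambda=\frac{\operatorname{arccosh}(2K^2+2K+1)}{\operatorname{arccosh}(K+1)}\approx1.5627\qquad\text{for}\qquad K=\cos\left(\tfrac{2\pi}5\right).$$ Furthermore, this value of $\lambda$ is optimal (the identity map is not a $\lambda'$-quasiisometry for any $\lambda'<\lambda$).
   Context: $T$ is the standard edge-to-edge tiling with four pentagons at each vertex. The dual tiling $T^*$ has a vertex at the center of each pentagon of $T$, an edge (geodesic segment) joining the centers of each pair of pentagons that share a side, and a quadrilateral around each vertex of $T$. The combinatorial metric $d_{\widetilde X}$ between vertices is the least number of edges of $T^*$ in an edge path joining them. A $\lambda$-quasiisometry is a coarsely surjective function $f:\widetilde X\to\Upsilon$ for which there exist positive constants $\lambda_1,\lambda_2,\epsilon$ with $\lambda_1\lambda_2=\lambda$ such that for all $x,y\in\widetilde X$, $\frac1{\lambda_1}d_{\widetilde X}(x,y)-\epsilon\le d_\Upsilon(f(x),f(y))\le\lambda_2d_{\widetilde X}(x,y)+\epsilon$. *)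

(* Defs.v *)
From Stdlib Require Import Reals List Relations ClassicalEpsilon.
Import ListNotations.
Local Open Scope R_scope.

Record vec : Type := Vec { vx : R; vy : R; vt : R }.

Definition vadd (u v : vec) : vec := Vec (vx u + vx v) (vy u + vy v) (vt u + vt v).
Definition vscale (a : R) (v : vec) : vec := Vec (a * vx v) (a * vy v) (a * vt v).
Definition vzero : vec := Vec 0 0 0.

Definition mink (u v : vec) : R := vx u * vx v + vy u * vy v - vt u * vt v.

Definition det3 (u v w : vec) : R :=
  vx u * (vy v * vt w - vt v * vy w)
  - vy u * (vx v * vt w - vt v * vx w)
  + vt u * (vx v * vy w - vy v * vx w).

(* The hyperboloid model: the upper sheet of <p, p> = -1 in R^{2,1}. *)
Record H2 : Type := MkH2 {
  coords :> vec;
  coords_sheet : mink coords coords = -1;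
  coords_upper : 0 < vt coords
}.

(* The principal branch, for arguments [1 <= x]. *)
Definition arccosh (x : R) : R := ln (x + sqrt (x ^ 2 - 1)).

Definition dH (p q : H2) : R := arccosh (- mink p q).

(* Geodesics are the intersections of the sheet with linear planes, so the
   segment [p, q] is cut out by the cone spanned by p and q. *)
Definition segment (p q : H2) : H2 -> Prop :=
  fun x => exists a b : R,
    0 <= a /\ 0 <= b /\ coords x = vadd (vscale a p) (vscale b q).

(* The component of p orthogonal to q: a tangent vector at q, pointing along
   the geodesic from q to p. *)
Definition direction (q p : H2) : vec := vadd p (vscale (mink p q) q).

Definition angle (p q r : H2) : R :=
  let u := direction q p in
  let w := direction q r in
  acos (mink u w / (sqrt (mink u u) * sqrt (mink w w))).

(* The cyclic list of vertices of a pentagon is a 5-periodic sequence. *)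

Definition hull (v : nat -> H2) : H2 -> Prop :=
  fun x => exists a : nat -> R,
    (forall i, 0 <= a i) /\
    coords x = fold_right vadd vzero
                 (map (fun i => vscale (a i) (v i)) (seq 0 5)).

(* Each vertex other than v i and v (i+1) lies strictly to the left of the
   line through v i and v (i+1), directed from v i to v (i+1). *)
Definition convex_counterclockwise (v : nat -> H2) : Prop :=
  forall i k : nat, (2 <= k <= 4)%nat -> 0 < det3 (v i) (v (S i)) (v (k + i)%nat).

Definition regular_right_angled (v : nat -> H2) : Prop :=
  (forall i, v (i + 5)%nat = v i) /\
  convex_counterclockwise v /\
  (forall i j, dH (v i) (v (S i)) = dH (v j) (v (S j))) /\
  (forall i, angle (v i) (v (S i)) (v (S (S i))) = PI / 2).

Definition pentagon (v : nat -> H2) (P : H2 -> Prop) : Prop :=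
  regular_right_angled v /\ P = hull v.

Definition is_vertex (P : H2 -> Prop) (p : H2) : Prop :=
  exists v i, pentagon v P /\ p = v i.

Definition is_side (P s : H2 -> Prop) : Prop :=
  exists v i, pentagon v P /\ s = segment (v i) (v (S i)).

Definition is_center (P : H2 -> Prop) (c : H2) : Prop :=
  exists v, pentagon v P /\ forall i j, dH c (v i) = dH c (v j).

Definition has_card {A : Type} (S : A -> Prop) (n : nat) : Prop :=
  exists l : list A, NoDup l /\ length l = n /\ forall x, In x l <-> S x.

Definition edge_to_edge (P Q : H2 -> Prop) : Prop :=
  (forall x, ~ (P x /\ Q x)) \/
  (exists p, is_vertex P p /\ is_vertex Q p /\ forall x, P x /\ Q x <-> x = p) \/
  (exists s, is_side P s /\ is_side Q s /\ forall x, P x /\ Q x <-> s x).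

Record pentagon_tiling (T : (H2 -> Prop) -> Prop) : Prop := {
  tiles_regular : forall P, T P -> exists v, pentagon v P;
  tiles_cover : forall x, exists P, T P /\ P x;
  tiles_edge_to_edge : forall P Q, T P -> T Q -> P <> Q -> edge_to_edge P Q;
  four_at_vertex : forall P p, T P -> is_vertex P p ->
    has_card (fun Q => T Q /\ is_vertex Q p) 4
}.

(* [boundary f a b c d]: the corners of the square f are a, b, c, d, in this
   cyclic order (from some starting corner, in some direction). *)
Record square_complex : Type := SquareComplex {
  vertex : Type;
  adjacent : vertex -> vertex -> Prop;
  face : Type;
  boundary : face -> vertex -> vertex -> vertex -> vertex -> Prop
}.

Arguments adjacent {_} _ _.
Arguments boundary {_} _ _ _ _ _.

Definition dihedral_orbit {A : Type} (a b c d : A) : list (A * A * A * A) :=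
  [ (a, b, c, d); (b, c, d, a); (c, d, a, b); (d, a, b, c);
    (d, c, b, a); (c, b, a, d); (b, a, d, c); (a, d, c, b) ].

Definition is_square_complex (X : square_complex) : Prop :=
  (forall a b : vertex X, adjacent a b -> adjacent b a) /\
  (forall a : vertex X, ~ adjacent a a) /\
  (forall f : face X, exists a b c d : vertex X,
     NoDup [a; b; c; d] /\
     adjacent a b /\ adjacent b c /\ adjacent c d /\ adjacent d a /\
     forall a' b' c' d', boundary f a' b' c' d' <->
       In (a', b', c', d') (dihedral_orbit a b c d)).

Definition corner {X : square_complex} (f : face X) (a : vertex X) : Prop :=
  exists b c d, boundary f a b c d.

(* The square f joins the neighbours u and w in the link of v. *)
Definition link_arc {X : square_complex} (f : face X) (v u w : vertex X) : Prop :=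
  exists x, boundary f u v w x.

(* A link is a graph, so it is a flag simplicial complex when it has no loop,
   no double arc and no triangle. *)
Definition flag_links (X : square_complex) : Prop :=
  (forall (v u : vertex X) f, ~ link_arc f v u u) /\
  (forall (v u w : vertex X) f g, link_arc f v u w -> link_arc g v u w -> f = g) /\
  (forall (v u w x : vertex X) f g h,
     ~ (link_arc f v u w /\ link_arc g v w x /\ link_arc h v x u)).

Fixpoint edge_path {X : square_complex} (x : vertex X) (l : list (vertex X))
    (y : vertex X) : Prop :=
  match l with
  | [] => x = y
  | z :: l' => adjacent x z /\ edge_path z l' y
  end.

Inductive elementary_homotopy {X : square_complex} :
    list (vertex X) -> list (vertex X) -> Prop :=
| backtrack l1 l2 a b :
    adjacent a b ->
    elementary_homotopy (l1 ++ [a; b; a] ++ l2) (l1 ++ [a] ++ l2)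
| across_square l1 l2 f a b c d :
    boundary f a b c d ->
    elementary_homotopy (l1 ++ [a; b; c] ++ l2) (l1 ++ [a; d; c] ++ l2).

Definition connected (X : square_complex) : Prop :=
  forall x y : vertex X, exists l, edge_path x l y.

Definition simply_connected (X : square_complex) : Prop :=
  connected X /\
  forall (x : vertex X) l, edge_path x l x ->
    clos_refl_sym_trans _ elementary_homotopy (x :: l) [x].

(* CAT(0) in the sense customary for cube complexes: nonpositively curved
   (Gromov's link condition) and simply connected. *)
Definition CAT0_square_complex (X : square_complex) : Prop :=
  is_square_complex X /\ flag_links X /\ simply_connected X.

(* The least number of edges in an edge path; the choice of a value when there
   is no path is irrelevant for connected complexes. *)
Definition combinatorial_distance {X : square_complex} (x y : vertex X) : nat :=
  epsilon (inhabits 0%nat) (fun n =>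
    (exists l, edge_path x l y /\ length l = n) /\
    (forall l, edge_path x l y -> (n <= length l)%nat)).

Definition dX {X : square_complex} (x y : vertex X) : R :=
  INR (combinatorial_distance x y).

Definition dual_vertex (T : (H2 -> Prop) -> Prop) : Type :=
  { c : H2 | exists P, T P /\ is_center P c }.

Definition dual_face (T : (H2 -> Prop) -> Prop) : Type :=
  { p : H2 | exists P, T P /\ is_vertex P p }.

Definition dual_adjacent (T : (H2 -> Prop) -> Prop)
    (c c' : dual_vertex T) : Prop :=
  exists P P', T P /\ T P' /\ P <> P' /\
    is_center P (proj1_sig c) /\ is_center P' (proj1_sig c') /\
    exists s, is_side P s /\ is_side P' s.

Definition center_around (T : (H2 -> Prop) -> Prop)
    (p : dual_face T) (c : dual_vertex T) : Prop :=
  exists P, T P /\ is_vertex P (proj1_sig p) /\ is_center P (proj1_sig c).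

Definition dual_boundary (T : (H2 -> Prop) -> Prop) (p : dual_face T)
    (a b c d : dual_vertex T) : Prop :=
  NoDup [a; b; c; d] /\
  (forall x, In x [a; b; c; d] <-> center_around T p x) /\
  dual_adjacent T a b /\ dual_adjacent T b c /\
  dual_adjacent T c d /\ dual_adjacent T d a.

Definition dual_tiling (T : (H2 -> Prop) -> Prop) : square_complex :=
  SquareComplex (dual_vertex T) (dual_adjacent T) (dual_face T) (dual_boundary T).

Definition identity_map (T : (H2 -> Prop) -> Prop) (x : vertex (dual_tiling T)) : H2 :=
  proj1_sig x.

Definition quasiisometry {X Y : Type} (distX : X -> X -> R) (distY : Y -> Y -> R)
    (lambda : R) (f : X -> Y) : Prop :=
  (exists C, forall y, exists x, distY (f x) y <= C) /\
  exists lambda1 lambda2 eps : R,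
    0 < lambda1 /\ 0 < lambda2 /\ 0 < eps /\ lambda1 * lambda2 = lambda /\
    forall x y : X,
      / lambda1 * distX x y - eps <= distY (f x) (f y) /\
      distY (f x) (f y) <= lambda2 * distX x y + eps.

(* Main.v *)
(* The lines spanned by the sides of the pentagons are disjoint from the interiors of the
   tiles, and an edge of the dual tiling crosses exactly one of them, so the combinatorial
   distance counts separating lines.  To see this from the local axioms alone: the four tiles
   at a vertex occupy the four quadrants there, so the mirror image of a tile in any of its
   sides is a tile, every tile is reached from every other by such reflections, and the tiling
   is symmetric under all of them.  If a line met the interior of a tile, the mirror image of
   the tile would overlap it, hence coincide with it, and the line would pass through its
   center.  This is excluded by parity: the pairing of a center with a side normal is
   [sqrt 5] times an element [a + b phi] of Z[phi] with [a] odd and [b] even.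

   The distance from a fixed center is a Morse function on the dual complex.  Two sides of a
   tile along which it decreases are adjacent, since the outer half planes of non-adjacent
   sides are disjoint; so a highest vertex of a loop can be pushed across a square.

   For the upper bound, replace an edge path by the midpoints of the sides it crosses: two
   midpoints in one tile are at distance at most [arccosh (2K^2+2K+1)].  For the lower bound,
   follow the geodesic through the tiles and compare with a potential on the sides, namely a
   Busemann function of the geodesic through midpoints of consecutive adjacent sides; which of
   the two such geodesics is used depends on which neighbouring lines are crossed earlier and
   later.  Each tile traversed then contributes at least [arccosh (K+1)].  The zigzags through
   midpoints of adjacent and of non-adjacent sides show that both rates are attained. *)
Require Import Defs.
From Stdlib Require Import Reals List Lia Lra Psatz Wf_nat ZArith Relations.
From Stdlib Require Import Classical ClassicalEpsilon ProofIrrelevance.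
From Stdlib Require Import FunctionalExtensionality PropExtensionality.
Import ListNotations.
Local Open Scope R_scope.

(** * The hyperboloid *)

(** Tiles are bare sets of points: the axioms name neither a first corner nor an orientation. The
    proof works with frames, that is, five unit normals in Minkowski space obeying a linear
    recursion, with pairings 1, 0 and -phi. A set determines its normals up to relabelling, hence
    also their sum; minus that sum points to the center. Questions about tiles thus become
    evaluations of this vector on normals, and reflections change them by exact amounts. The main
    source of inequalities is that a Gram determinant of three vectors in signature (2, 1) is never
    positive.

    The obstacle in the lower bound is that a linear functional gaining exactly the slow rate
    belongs to a single zigzag, while a geodesic may turn either way in the next tile. The
    potentials therefore live on the sides. Their slope is read off from the endpoints of the
    geodesic and the two neighbouring lines only, so the two tiles sharing a side agree on it, and
    the estimates of consecutive tiles multiply. *)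

Lemma vec_ext (u v : vec) : vx u = vx v -> vy u = vy v -> vt u = vt v -> u = v.
Proof. destruct u, v; simpl; intros; subst; reflexivity. Qed.

Lemma H2_ext (p q : H2) : coords p = coords q -> p = q.
Proof.
  destruct p as [p h1 h2], q as [q h3 h4]; simpl; intros E; subst q.
  f_equal; apply proof_irrelevance.
Qed.

Lemma square_nonpos (x : R) : x * x <= 0 -> x = 0.
Proof. intros H. apply Rsqr_0_uniq. unfold Rsqr. nra. Qed.

Lemma mink_sym (u v : vec) : mink u v = mink v u.
Proof. unfold mink; ring. Qed.

Lemma mink_add_l (u v w : vec) : mink (vadd u v) w = mink u w + mink v w.
Proof. unfold mink; simpl; ring. Qed.

Lemma mink_add_r (u v w : vec) : mink w (vadd u v) = mink w u + mink w v.
Proof. unfold mink; simpl; ring. Qed.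

Lemma mink_scale_l (a : R) (u w : vec) : mink (vscale a u) w = a * mink u w.
Proof. unfold mink; simpl; ring. Qed.

Lemma mink_scale_r (a : R) (u w : vec) : mink w (vscale a u) = a * mink w u.
Proof. unfold mink; simpl; ring. Qed.

Lemma mink_zero_l (w : vec) : mink vzero w = 0.
Proof. unfold mink; simpl; ring. Qed.

Lemma mink_zero_r (w : vec) : mink w vzero = 0.
Proof. unfold mink; simpl; ring. Qed.

Global Hint Rewrite mink_add_l mink_add_r mink_scale_l mink_scale_r
  mink_zero_l mink_zero_r : mink.

Ltac vec_ring := intros; apply vec_ext; simpl; ring.

Lemma vscale_vscale (a b : R) (u : vec) : vscale a (vscale b u) = vscale (a * b) u.
Proof. vec_ring. Qed.

Lemma vscale_1 (u : vec) : vscale 1 u = u.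
Proof. vec_ring. Qed.

Lemma vscale_inj (a : R) (u v : vec) : a <> 0 -> vscale a u = vscale a v -> u = v.
Proof.
  intros Ha E. rewrite <- (vscale_1 u), <- (vscale_1 v).
  replace 1 with (/ a * a) by (field; exact Ha).
  rewrite <- !vscale_vscale, E. reflexivity.
Qed.

(** Multiplicativity of determinants; the sign is the determinant -1 of the Minkowski form. *)
Lemma det3_gram (u v w a b c : vec) :
  det3 u v w * det3 a b c =
  - (mink u a * (mink v b * mink w c - mink v c * mink w b)
     - mink u b * (mink v a * mink w c - mink v c * mink w a)
     + mink u c * (mink v a * mink w b - mink v b * mink w a)).
Proof. unfold det3, mink; ring. Qed.

(** Cramer's rule: the factors in parentheses in the proof are cofactors of the rows [u], [v],
    [w]. *)
Lemma nondegenerate (u v w x y : vec) :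
  det3 u v w <> 0 ->
  mink x u = mink y u -> mink x v = mink y v -> mink x w = mink y w -> x = y.
Proof.
  intros Hd H1 H2 H3.
  apply vec_ext; apply (Rmult_eq_reg_l (det3 u v w)); trivial.
  - replace (det3 u v w * vx x) with
      (mink x u * (vy v * vt w - vt v * vy w) - mink x v * (vy u * vt w - vt u * vy w)
       + mink x w * (vy u * vt v - vt u * vy v)) by (unfold det3, mink; ring).
    rewrite H1, H2, H3; unfold det3, mink; ring.
  - replace (det3 u v w * vy x) with
      (- mink x u * (vx v * vt w - vt v * vx w) + mink x v * (vx u * vt w - vt u * vx w)
       - mink x w * (vx u * vt v - vt u * vx v)) by (unfold det3, mink; ring).
    rewrite H1, H2, H3; unfold det3, mink; ring.
  - replace (det3 u v w * vt x) with
      (- mink x u * (vx v * vy w - vy v * vx w) + mink x v * (vx u * vy w - vy u * vx w)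
       - mink x w * (vx u * vy v - vy u * vx v)) by (unfold det3, mink; ring).
    rewrite H1, H2, H3; unfold det3, mink; ring.
Qed.

(** This determinant is minus a square. Depending on the norms inserted, it becomes the triangle
    inequality, the Lipschitz bound for Busemann functions, or the comparison of a line with the
    inscribed circle of a tile. *)
Lemma gram3_nonpos (u v w : vec) :
  mink u u * (mink v v * mink w w - mink v w * mink v w)
  - mink u v * (mink u v * mink w w - mink v w * mink u w)
  + mink u w * (mink u v * mink v w - mink v v * mink u w) <= 0.
Proof.
  pose proof (det3_gram u v w u v w) as H.
  rewrite (mink_sym w v), (mink_sym v u), (mink_sym w u) in H.
  pose proof (Rle_0_sqr (det3 u v w)) as H'. unfold Rsqr in H'. lra.
Qed.

(** Cauchy-Schwarz on the space components, beaten by the product of the time components. *)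
Lemma future_pairing (u w : vec) :
  mink u u < 0 -> 0 < vt u -> mink w w <= 0 -> 0 < vt w -> mink u w < 0.
Proof.
  destruct u as [a b c], w as [x y z]; unfold mink; simpl; intros Hu Hc Hw Hz.
  assert (H : (a * x + b * y) * (a * x + b * y) < (c * z) * (c * z)).
  { assert (H1 : (a * x + b * y) * (a * x + b * y) <= (a*a+b*b) * (x*x+y*y))
      by (pose proof (Rle_0_sqr (a*y-b*x)) as Q; unfold Rsqr in Q; nra).
    assert (H2 : (a*a+b*b) * (x*x+y*y) <= (a*a+b*b) * (z*z)) by (apply Rmult_le_compat_l; nra).
    assert (H3 : (a*a+b*b) * (z*z) < (c*c) * (z*z)) by (apply Rmult_lt_compat_r; nra).
    lra. }
  assert (0 < c * z) by nra.
  destruct (Rlt_le_dec (a * x + b * y) (c * z)); [lra|]. nra.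
Qed.

Lemma future_of_pairing (u w : vec) :
  mink u u < 0 -> 0 < vt u -> mink w w <= 0 -> mink u w < 0 -> 0 < vt w.
Proof.
  intros Hu Hc Hw Huw.
  destruct (Rlt_le_dec 0 (vt w)) as [|[Hn|H0]]; trivial; exfalso.
  - assert (H : mink u (vscale (-1) w) < 0).
    { apply future_pairing; simpl; trivial; [|lra].
      autorewrite with mink; lra. }
    autorewrite with mink in H; lra.
  - destruct w as [x y z]; unfold mink in *; simpl in *; subst z.
    assert (x = 0) by (apply square_nonpos; nra).
    assert (y = 0) by (apply square_nonpos; nra). subst. lra.
Qed.

(** Reversed Cauchy-Schwarz inequality for causal vectors. *)
Lemma future_gram (u w : vec) :
  mink u u < 0 -> 0 < vt u -> mink w w <= 0 -> 0 < vt w ->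
  mink u u * mink w w <= mink u w * mink u w.
Proof.
  intros Hu Hc Hw Hz.
  
  destruct u as [a b c], w as [x y z]; unfold mink in *; simpl in *.
  assert (H1 : (a * x + b * y) * (a * x + b * y) <= (a*a+b*b) * (x*x+y*y))
    by (pose proof (Rle_0_sqr (a*y-b*x)) as Q; unfold Rsqr in Q; nra).
  set (P := a*a+b*b) in *. set (Q := x*x+y*y) in *. set (I := a*x+b*y) in *.
  assert (HP : 0 <= P) by (unfold P; nra). assert (HQ : 0 <= Q) by (unfold Q; nra).
  set (m := sqrt (P * Q)).
  assert (Hm : m * m = P * Q) by (apply sqrt_sqrt; nra).
  assert (0 <= m) by apply sqrt_pos.
  assert (0 < c * z) by nra.
  assert (I <= m) by nra.
  
  assert (m <= c * z) by nra.
  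
  (* Arithmetic-geometric mean inequality for [P*(z*z)] and [Q*(c*c)], whose product is the square
     of [c*z*m]. *)
  assert (2*(c*z)*m <= P*(z*z)+Q*(c*c)).
  { assert (0 <= P*(z*z)) by nra. assert (0 <= Q*(c*c)) by nra.
    assert (4*(c*z)*(c*z)*(m*m) <= (P*(z*z)+Q*(c*c))*(P*(z*z)+Q*(c*c))).
    { rewrite Hm. pose proof (Rle_0_sqr (P*(z*z) - Q*(c*c))) as E. unfold Rsqr in E. nra. }
    nra. }
  nra.
Qed.

Lemma H2_timelike (p : H2) : mink p p < 0.
Proof. rewrite (coords_sheet p); lra. Qed.

Lemma H2_pairing (p q : H2) : mink p q <= -1.
Proof.
  assert (H : mink p q < 0)
    by (apply future_pairing; [apply H2_timelike|apply coords_upper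
        |apply Rlt_le, H2_timelike|apply coords_upper]).
  pose proof (future_gram p q (H2_timelike p) (coords_upper p)
     (Rlt_le _ _ (H2_timelike q)) (coords_upper q)) as G.
  rewrite !coords_sheet in G. nra.
Qed.

Lemma H2_pairing_eq (p q : H2) : mink p q = -1 -> p = q.
Proof.
  intros E. apply H2_ext.
  
  
  destruct p as [[a b c] ? ?], q as [[x y z] ? ?]; unfold mink in *; simpl in *.
  
  assert (H : (a*x+b*y)*(a*x+b*y) <= (a*a+b*b)*(x*x+y*y))
    by (pose proof (Rle_0_sqr (a*y-b*x)) as Q; unfold Rsqr in Q; nra).
  replace (a*x+b*y) with (c*z-1) in H by lra.
  replace (a*a+b*b) with (c*c-1) in H by lra.
  replace (x*x+y*y) with (z*z-1) in H by lra.
  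
  (* Cauchy-Schwarz now reads (c z - 1)^2 <= (c^2 - 1)(z^2 - 1), which is (c - z)^2 <= 0. *)
  assert (c = z) by (apply Rminus_diag_uniq, square_nonpos; nra). subst z.
  pose proof (Rle_0_sqr (a-x)) as Sa. pose proof (Rle_0_sqr (b-y)) as Sb. unfold Rsqr in Sa, Sb.
  assert (a = x) by (apply Rminus_diag_uniq, square_nonpos; lra).
  assert (b = y) by (apply Rminus_diag_uniq, square_nonpos; lra). subst; reflexivity.
Qed.

Lemma normalize (w : vec) :
  mink w w < 0 -> 0 < vt w -> exists (p : H2) (k : R), 0 < k /\ coords p = vscale k w.
Proof.
  intros Hw Ht.
  assert (Hs : 0 < sqrt (- mink w w)) by (apply sqrt_lt_R0; lra).
  assert (E : mink (vscale (/ sqrt (- mink w w)) w) (vscale (/ sqrt (- mink w w)) w) = -1).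
  { autorewrite with mink.
    assert (Q : sqrt (- mink w w) * sqrt (- mink w w) = - mink w w) by (apply sqrt_sqrt; lra).
    replace (mink w w) with (- (sqrt (- mink w w) * sqrt (- mink w w))) at 3 by lra.
    field; lra. }
  assert (U : 0 < vt (vscale (/ sqrt (- mink w w)) w))
    by (simpl; apply Rmult_lt_0_compat; [apply Rinv_0_lt_compat|]; trivial).
  exists (MkH2 _ E U), (/ sqrt (- mink w w)). split; [apply Rinv_0_lt_compat; trivial|reflexivity].
Qed.

(** * Exponentials of distances and the triangle inequality *)

Definition expd (x : R) : R := x + sqrt (x ^ 2 - 1).

Lemma expd_ge (x : R) : 1 <= x -> x <= expd x.
Proof. intros; unfold expd; pose proof (sqrt_pos (x^2-1)); lra. Qed.

Lemma expd_arccosh (x : R) : 1 <= x -> exp (arccosh x) = expd x.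
Proof. intros H; apply exp_ln. pose proof (expd_ge x H); unfold expd in *; lra. Qed.

Lemma expd_incr (x y : R) : 1 <= x -> x <= y -> expd x <= expd y.
Proof.
  intros Hx Hxy; unfold expd. apply Rplus_le_compat; trivial.
  apply sqrt_le_1_alt. nra.
Qed.

Lemma arccosh_le (x y : R) : 1 <= x -> x <= y -> arccosh x <= arccosh y.
Proof.
  intros Hx Hxy. pose proof (expd_incr x y Hx Hxy) as H. pose proof (expd_ge x Hx).
  unfold arccosh; fold (expd x) (expd y).
  destruct H as [H|H]; [left; apply ln_increasing; lra|rewrite H; right; reflexivity].
Qed.

Lemma arccosh_nonneg (x : R) : 1 <= x -> 0 <= arccosh x.
Proof.
  intros Hx. rewrite <- ln_1. unfold arccosh; fold (expd x).
  pose proof (expd_ge x Hx) as E.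
  destruct (Req_dec 1 (expd x)) as [Q|Q]; [rewrite <- Q; right; reflexivity|].
  left; apply ln_increasing; lra.
Qed.

Lemma expd_inv (x : R) : 1 <= x -> x = (expd x + / expd x) / 2.
Proof.
  intros Hx. pose proof (expd_ge x Hx) as H.
  assert (Q : sqrt (x^2-1) * sqrt (x^2-1) = x^2-1) by (apply sqrt_sqrt; nra).
  apply (Rmult_eq_reg_r (2 * expd x)); [|lra]. field_simplify; [|lra].
  unfold expd. nra.
Qed.

Lemma arccosh_inj (x y : R) : 1 <= x -> 1 <= y -> arccosh x = arccosh y -> x = y.
Proof.
  intros Hx Hy E. rewrite (expd_inv x Hx), (expd_inv y Hy).
  rewrite <- !expd_arccosh, E by trivial. reflexivity.
Qed.

Lemma dH_sym (p q : H2) : dH p q = dH q p.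
Proof. unfold dH; rewrite mink_sym; reflexivity. Qed.

Lemma dH_nonneg (p q : H2) : 0 <= dH p q.
Proof. apply arccosh_nonneg; pose proof (H2_pairing p q); lra. Qed.

Lemma dH_inj (p q p' q' : H2) : dH p q = dH p' q' -> mink p q = mink p' q'.
Proof.
  intros E; apply arccosh_inj in E; [lra|..];
  match goal with |- 1 <= - mink (coords ?a) (coords ?b) => pose proof (H2_pairing a b); lra end.
Qed.

(** The addition formula in exponential form: for x = cosh s and y = cosh t the argument on the
    right is cosh (s + t). *)
Lemma expd_mult (x y : R) : 1 <= x -> 1 <= y ->
  expd x * expd y = expd (x * y + sqrt (x^2-1) * sqrt (y^2-1)).
Proof.
  intros Hx Hy. unfold expd.
  set (a := sqrt (x^2-1)). set (b := sqrt (y^2-1)).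
  assert (Ha : a * a = x^2-1) by (apply sqrt_sqrt; nra).
  assert (Hb : b * b = y^2-1) by (apply sqrt_sqrt; nra).
  assert (0 <= a) by apply sqrt_pos. assert (0 <= b) by apply sqrt_pos.
  replace ((x*y+a*b)^2-1) with ((x*b+a*y)*(x*b+a*y)).
  - rewrite sqrt_square; [ring|]. assert (0 <= x * b) by nra. assert (0 <= a * y) by nra. lra.
  - assert (E : a*a*(b*b) = (x^2-1)*(y^2-1)) by (rewrite Ha, Hb; reflexivity).
    replace ((x*b+a*y)*(x*b+a*y)) with (x^2*(b*b) + y^2*(a*a) + 2*(x*y)*(a*b)) by ring.
    replace ((x*y+a*b)^2) with (x^2*y^2 + a*a*(b*b) + 2*(x*y)*(a*b)) by ring.
    rewrite E, Ha, Hb; ring.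
Qed.

(** For the hyperbolic cosines x, y, z of the three distances, the Gram inequality says (z - x y)^2
    <= (x^2 - 1)(y^2 - 1), so z is at most cosh of the sum of the other two distances. *)
Lemma dH_triangle (p q r : H2) : dH p r <= dH p q + dH q r.
Proof.
  pose proof (H2_pairing p q) as H1. pose proof (H2_pairing q r) as H2.
  pose proof (H2_pairing p r) as H3.
  pose proof (gram3_nonpos p q r) as G. rewrite !coords_sheet in G.
  unfold dH. set (x := - mink p q) in *. set (y := - mink q r) in *. set (z := - mink p r) in *.
  replace (mink p q) with (-x) in * by (unfold x; ring).
  replace (mink q r) with (-y) in * by (unfold y; ring).
  replace (mink p r) with (-z) in * by (unfold z; ring).
  
  set (a := sqrt (x^2-1)). set (b := sqrt (y^2-1)).
  assert (Ha : a * a = x^2-1) by (apply sqrt_sqrt; nra).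
  assert (Hb : b * b = y^2-1) by (apply sqrt_sqrt; nra).
  assert (0 <= a) by apply sqrt_pos. assert (0 <= b) by apply sqrt_pos.
  assert (Hz : z <= x*y + a*b).
  { assert (E : (z-x*y)*(z-x*y) <= (a*b)*(a*b)).
    { replace ((a*b)*(a*b)) with (a*a*(b*b)) by ring. rewrite Ha, Hb. nra. }
    assert (0 <= a * b) by nra.
    destruct (Rle_lt_dec (z - x*y) (a*b)); [lra|nra]. }
  
  
  assert (Hs : arccosh x + arccosh y = arccosh (x*y+a*b)).
  { apply exp_inv. rewrite exp_plus, !expd_arccosh by lra. apply expd_mult; lra. }
  rewrite Hs. apply arccosh_le; lra.
Qed.

Lemma dH_segment (p q r : H2) : segment p r q -> dH p q + dH q r <= dH p r.
Proof.
  intros (a & b & Ha & Hb & E).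
  pose proof (H2_pairing p q) as H1. pose proof (H2_pairing q r) as H2.
  pose proof (H2_pairing p r) as H3.
  pose proof (coords_sheet q) as Q. rewrite E in Q. autorewrite with mink in Q.
  rewrite (mink_sym r p), !coords_sheet in Q.
  assert (E1 : mink p q = - a + b * mink p r)
    by (rewrite E; autorewrite with mink; rewrite coords_sheet; ring).
  assert (E2 : mink q r = a * mink p r - b)
    by (rewrite E; autorewrite with mink; rewrite coords_sheet; ring).
  unfold dH. set (z := - mink p r) in *. replace (mink p r) with (-z) in * by (unfold z; ring).
  
  set (x := - mink p q) in *. set (y := - mink q r) in *.
  assert (Hx : x = a + b * z) by (unfold x; rewrite E1; ring).
  assert (Hy : y = a * z + b) by (unfold y; rewrite E2; ring).
  assert (1 <= x) by (unfold x; lra). assert (1 <= y) by (unfold y; lra).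
  
  assert (Hs : arccosh x + arccosh y = arccosh z).
  { apply exp_inv. rewrite exp_plus, !expd_arccosh by lra. rewrite expd_mult by lra. f_equal.
    (* The coefficients of [q] are ratios of hyperbolic sines: [b] for the distance from [p] to [q],
       [a] for that from [q] to [r], each over the whole length. *)
    assert (sqrt (x^2-1) = b * sqrt (z^2-1)).
    { replace (x^2-1) with (b^2*(z^2-1)) by (rewrite Hx; nra).
      rewrite sqrt_mult by nra. rewrite sqrt_pow2; trivial. }
    assert (sqrt (y^2-1) = a * sqrt (z^2-1)).
    { replace (y^2-1) with (a^2*(z^2-1)) by (rewrite Hy; nra).
      rewrite sqrt_mult by nra. rewrite sqrt_pow2; trivial. }
    rewrite H4, H5.
    replace (b * sqrt (z^2-1) * (a * sqrt (z^2-1))) with (a*b*(sqrt (z^2-1) * sqrt (z^2-1))) by ring.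
    rewrite sqrt_sqrt by nra. rewrite Hx, Hy. nra. }
  lra.
Qed.

(* Busemann functions are 1-Lipschitz; for null [e] the quotient is their exponential. *)
Lemma busemann_lipschitz (p q : H2) (e : vec) :
  mink e e <= 0 -> mink q e < 0 -> - mink p e <= exp (dH p q) * - mink q e.
Proof.
  intros He Hq. pose proof (H2_pairing p q) as H1.
  pose proof (gram3_nonpos p q e) as G. rewrite !coords_sheet in G.
  unfold dH. rewrite expd_arccosh by lra. unfold expd.
  set (x := - mink p q) in *. replace (mink p q) with (-x) in * by (unfold x; ring).
  set (A := - mink p e) in *. replace (mink p e) with (-A) in * by (unfold A; ring).
  set (B := - mink q e) in *. replace (mink q e) with (-B) in * by (unfold B; ring).
  
  set (a := sqrt (x^2-1)). assert (Ha : a * a = x^2-1) by (apply sqrt_sqrt; nra).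
  assert (0 <= a) by apply sqrt_pos.
  assert (E : (A-x*B)*(A-x*B) <= (a*B)*(a*B)).
  { replace ((a*B)*(a*B)) with (a*a*(B*B)) by ring. rewrite Ha.
    nra. }
  assert (0 <= a * B) by nra.
  destruct (Rle_lt_dec (A - x*B) (a*B)); [lra|nra].
Qed.

(** * Pentagons given by their normals *)

Definition phi : R := (1 + sqrt 5) / 2.

Lemma phi2 : phi * phi = phi + 1.
Proof.
  unfold phi. assert (H : sqrt 5 * sqrt 5 = 5) by (apply sqrt_sqrt; lra). nra.
Qed.

Lemma phi_bounds : 1.618033 < phi < 1.618034.
Proof.
  pose proof phi2 as H. assert (0 < phi) by (unfold phi; pose proof (sqrt_pos 5); lra).
  split; nra.
Qed.

Ltac phi_facts := pose proof phi2 as Hphi2; pose proof phi_bounds as Hphib.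

Definition vsub (u v : vec) : vec := vadd u (vscale (-1) v).

Definition csum (N : nat -> vec) : vec :=
  vscale (-1) (vadd (N 0%nat) (vadd (N 1%nat) (vadd (N 2%nat) (vadd (N 3%nat) (N 4%nat))))).

(* [N] lists the inward unit normals of the sides of a regular right-angled
   pentagon, in either cyclic order; [-phi] is minus the hyperbolic cosine of the
   distance between the lines of two non-adjacent sides. The vector [csum N] points to the center. *)
Record frame (N : nat -> vec) : Prop := {
  fr_rec : forall i, N (3 + i)%nat = vadd (vscale phi (vsub (N (2 + i)%nat) (N (1 + i)%nat))) (N i);
  fr_unit : forall i, mink (N i) (N i) = 1;
  fr_orth : forall i, mink (N i) (N (1 + i)%nat) = 0;
  fr_ultra : forall i, mink (N i) (N (2 + i)%nat) = - phi;
  fr_future : 0 < vt (csum N)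
}.

(** The recursion carries the Gram matrix of three consecutive normals to the next three, so the
    pairings need checking only at the start. *)
Lemma frame_intro (N : nat -> vec) :
  (forall i, N (3 + i)%nat = vadd (vscale phi (vsub (N (2 + i)%nat) (N (1 + i)%nat))) (N i)) ->
  mink (N 0%nat) (N 0%nat) = 1 -> mink (N 1%nat) (N 1%nat) = 1 -> mink (N 2%nat) (N 2%nat) = 1 ->
  mink (N 0%nat) (N 1%nat) = 0 -> mink (N 1%nat) (N 2%nat) = 0 -> mink (N 0%nat) (N 2%nat) = - phi ->
  0 < vt (csum N) -> frame N.
Proof.
  intros Hr H00 H11 H22 H01 H12 H02 Hf.
  assert (H : forall i, mink (N i) (N i) = 1 /\ mink (N (1+i)%nat) (N (1+i)%nat) = 1 /\
     mink (N (2+i)%nat) (N (2+i)%nat) = 1 /\ mink (N i) (N (1+i)%nat) = 0 /\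
     mink (N (1+i)%nat) (N (2+i)%nat) = 0 /\ mink (N i) (N (2+i)%nat) = - phi).
  { induction i as [|i (A&B&C&D&E&F)]; [repeat split; assumption|].
    change (1 + S i)%nat with (2 + i)%nat. change (2 + S i)%nat with (3 + i)%nat.
    change (S i) with (1 + i)%nat.
    
    repeat split; trivial; rewrite ?(Hr i); unfold vsub; autorewrite with mink;
      rewrite ?(mink_sym (N (2+i)%nat) (N (1+i)%nat)), ?(mink_sym (N (2+i)%nat) (N i)),
       ?(mink_sym (N (1+i)%nat) (N i)), ?A, ?B, ?C, ?D, ?E, ?F; nra. }
  split; trivial; intros i; apply (H i).
Qed.

Definition shift (k : nat) (N : nat -> vec) : nat -> vec := fun i => N (i + k)%nat.

Section Frame.
Variable N : nat -> vec.
Hypothesis F : frame N.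

Lemma fr_d3 i : mink (N i) (N (3 + i)%nat) = - phi.
Proof.
  rewrite (fr_rec N F). unfold vsub; autorewrite with mink.
  rewrite (fr_orth N F), (fr_ultra N F), (fr_unit N F). phi_facts. nra.
Qed.

Lemma fr_d4 i : mink (N i) (N (4 + i)%nat) = 0.
Proof.
  change (4 + i)%nat with (3 + (1 + i))%nat. rewrite (fr_rec N F (1 + i)). unfold vsub; autorewrite with mink.
  change (2 + (1+i))%nat with (3 + i)%nat. change (1 + (1+i))%nat with (2 + i)%nat.
  rewrite fr_d3, (fr_orth N F), (fr_ultra N F). ring.
Qed.

(** The characteristic polynomial of the recursion is (X - 1)(X^2 - (phi - 1) X + 1); since phi - 1
    = 2 cos (2 pi / 5), its roots are fifth roots of unity. *)
Lemma fr_periodic i : N (5 + i)%nat = N i.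
Proof.
  change (5 + i)%nat with (3 + (2 + i))%nat. rewrite (fr_rec N F (2 + i)).
  change (2 + (2 + i))%nat with (3 + (1 + i))%nat. rewrite (fr_rec N F (1 + i)).
  change (2 + (1 + i))%nat with (3 + i)%nat. change (1 + (2 + i))%nat with (3 + i)%nat.
  rewrite (fr_rec N F i). change (1 + (1 + i))%nat with (2 + i)%nat.
  pose proof phi2 as P. unfold vsub.
  apply vec_ext; simpl; ring [P].
Qed.

Lemma fr_mod i j : (i mod 5 = j mod 5)%nat -> N i = N j.
Proof.
  assert (H : forall q i, N (q * 5 + i)%nat = N i).
  { induction q as [|q IH]; intros k; trivial.
    change (S q * 5 + k)%nat with (5 + (q * 5 + k))%nat. rewrite fr_periodic; apply IH. }
  intros E. rewrite (Nat.div_mod_eq i 5), (Nat.div_mod_eq j 5), E, !(Nat.mul_comm 5), !H. reflexivity.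
Qed.

Lemma csum_shift k : csum (shift k N) = csum N.
Proof.
  unfold shift. induction k as [|k IH]; [reflexivity|].
  rewrite <- IH. unfold csum.
  replace (4 + S k)%nat with (5 + k)%nat by lia. rewrite fr_periodic.
  simpl. vec_ring.
Qed.

Lemma frame_shift k : frame (shift k N).
Proof.
  split; intros; unfold shift; rewrite <- ?Nat.add_assoc.
  - apply (fr_rec N F).
  - apply (fr_unit N F).
  - apply (fr_orth N F).
  - apply (fr_ultra N F).
  - change (0 < vt (csum (shift k N))). rewrite csum_shift. apply (fr_future N F).
Qed.

Lemma fr_products :
  mink (N 0%nat) (N 0%nat) = 1 /\ mink (N 0%nat) (N 1%nat) = 0 /\ mink (N 0%nat) (N 2%nat) = - phi /\
  mink (N 0%nat) (N 3%nat) = - phi /\ mink (N 0%nat) (N 4%nat) = 0 /\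
  mink (N 1%nat) (N 1%nat) = 1 /\ mink (N 1%nat) (N 2%nat) = 0 /\ mink (N 1%nat) (N 3%nat) = - phi /\
  mink (N 1%nat) (N 4%nat) = - phi /\
  mink (N 2%nat) (N 2%nat) = 1 /\ mink (N 2%nat) (N 3%nat) = 0 /\ mink (N 2%nat) (N 4%nat) = - phi /\
  mink (N 3%nat) (N 3%nat) = 1 /\ mink (N 3%nat) (N 4%nat) = 0 /\ mink (N 4%nat) (N 4%nat) = 1.
Proof.
  repeat split; first [apply (fr_unit N F)|apply (fr_orth N F)|apply (fr_ultra N F)|apply fr_d3|apply fr_d4].
Qed.

Lemma csum_normal0 : mink (csum N) (N 0%nat) = 2 * phi - 1.
Proof.
  unfold csum; autorewrite with mink.
  rewrite (mink_sym (N 1%nat)), (mink_sym (N 2%nat)), (mink_sym (N 3%nat)), (mink_sym (N 4%nat)).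
  destruct fr_products as (A00&A01&A02&A03&A04&_).
  rewrite A00, A01, A02, A03, A04. ring.
Qed.

End Frame.

Lemma csum_normal (N : nat -> vec) : frame N -> forall i, mink (csum N) (N i) = 2 * phi - 1.
Proof.
  intros F i. rewrite <- (csum_shift N F i). change (N i) with (shift i N 0%nat).
  apply csum_normal0, frame_shift, F.
Qed.

Lemma csum_csum (N : nat -> vec) : frame N -> mink (csum N) (csum N) = - (5 * (2 * phi - 1)).
Proof.
  intros F. unfold csum at 2. autorewrite with mink. rewrite !(csum_normal N F). ring.
Qed.

Lemma csum_timelike (N : nat -> vec) : frame N -> mink (csum N) (csum N) < 0.
Proof. intros F. rewrite (csum_csum N F). phi_facts. lra. Qed.

Lemma frame_det (N : nat -> vec) : frame N -> det3 (N 0%nat) (N 1%nat) (N 2%nat) <> 0.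
Proof.
  intros F E. pose proof (det3_gram (N 0%nat) (N 1%nat) (N 2%nat) (N 0%nat) (N 1%nat) (N 2%nat)) as G.
  rewrite E in G. rewrite (mink_sym (N 1%nat) (N 0%nat)), (mink_sym (N 2%nat) (N 0%nat)), (mink_sym (N 2%nat) (N 1%nat)) in G.
  destruct (fr_products N F) as (A00&A01&A02&A03&A04&A11&A12&A13&A14&A22&_).
  rewrite A00, A01, A02, A11, A12, A22 in G.
  phi_facts. nra.
Qed.

Lemma frame_ext (N : nat -> vec) (x y : vec) : frame N ->
  mink x (N 0%nat) = mink y (N 0%nat) -> mink x (N 1%nat) = mink y (N 1%nat) ->
  mink x (N 2%nat) = mink y (N 2%nat) -> x = y.
Proof. intros F. apply nondegenerate, frame_det, F. Qed.

Lemma pair_rec (N : nat -> vec) (x : vec) : frame N -> forall i,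
  mink x (N (3 + i)%nat) = phi * (mink x (N (2 + i)%nat) - mink x (N (1 + i)%nat)) + mink x (N i).
Proof. intros F i. rewrite (fr_rec N F i). unfold vsub; autorewrite with mink. ring. Qed.

Lemma shift_cases (N : nat -> vec) : frame N -> forall i j,
  exists d, (d < 5)%nat /\ N j = N (d + i)%nat.
Proof.
  (* Modulo 5, [4 * i] is minus [i]; subtraction of natural numbers would truncate. *)
  intros F i j. exists ((j + 4 * i) mod 5)%nat. split; [apply Nat.mod_upper_bound; lia|].
  apply (fr_mod N F). rewrite Nat.Div0.add_mod_idemp_l.
  replace (j + 4 * i + i)%nat with (j + i * 5)%nat by lia. symmetry; apply Nat.Div0.mod_add.
Qed.

Lemma frame_all (N : nat -> vec) (P : vec -> Prop) : frame N ->
  P (N 0%nat) -> P (N 1%nat) -> P (N 2%nat) -> P (N 3%nat) -> P (N 4%nat) -> forall i, P (N i).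
Proof.
  intros F H0 H1 H2 H3 H4 i. destruct (shift_cases N F 0 i) as (d & Hd & ->).
  rewrite Nat.add_0_r.
  do 5 (destruct d as [|d]; [assumption|]). lia.
Qed.

(** Since 4 is -1 modulo 5, this is the opposite cyclic order, starting from the same side. *)
Definition rev_frame (N : nat -> vec) : nat -> vec := fun i => N (4 * i)%nat.

Lemma frame_rev (N : nat -> vec) : frame N -> frame (rev_frame N).
Proof.
  intros F. unfold rev_frame.
  assert (H1 : forall i, N (4 * (1 + i))%nat = N (4 + 4 * i)%nat) by (intros; f_equal; lia).
  assert (H2 : forall i, N (4 * (2 + i))%nat = N (3 + 4 * i)%nat).
  { intros; replace (4 * (2 + i))%nat with (5 + (3 + 4 * i))%nat by lia. apply fr_periodic, F. }
  assert (H3 : forall i, N (4 * (3 + i))%nat = N (2 + 4 * i)%nat).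
  { intros; replace (4 * (3 + i))%nat with (5 + (5 + (2 + 4 * i)))%nat by lia.
    rewrite !(fr_periodic N F); reflexivity. }
  split.
  - intros i. rewrite H1, H2, H3. set (j := (4 * i)%nat).
    change (4 + j)%nat with (3 + (1 + j))%nat. rewrite (fr_rec N F (1 + j)).
    change (2 + (1 + j))%nat with (3 + j)%nat. rewrite (fr_rec N F j).
    change (1 + (1 + j))%nat with (2 + j)%nat. unfold vsub.
    pose proof phi2 as P. apply vec_ext; simpl; ring [P].
  - intros i. apply (fr_unit N F).
  - intros i. rewrite H1. apply (fr_d4 N F).
  - intros i. rewrite H2. apply (fr_d3 N F).
  - pose proof (fr_future N F) as H. unfold csum in *.
    replace (N (4 * 2)%nat) with (N 3%nat) by (apply (fr_mod N F); reflexivity).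
    replace (N (4 * 3)%nat) with (N 2%nat) by (apply (fr_mod N F); reflexivity).
    replace (N (4 * 4)%nat) with (N 1%nat) by (apply (fr_mod N F); reflexivity).
    simpl in *. lra.
Qed.

(** * Reflections in lines *)

Definition refl_vec (n x : vec) : vec := vadd x (vscale (- 2 * mink x n) n).

Lemma refl_mink (n x y : vec) : mink n n = 1 -> mink (refl_vec n x) (refl_vec n y) = mink x y.
Proof.
  intros H. unfold refl_vec; autorewrite with mink. rewrite H, (mink_sym n y). ring.
Qed.

Lemma refl_mink_l (n x y : vec) : mink (refl_vec n x) y = mink x y - 2 * mink x n * mink n y.
Proof. unfold refl_vec; autorewrite with mink. ring. Qed.

Lemma refl_swap (n x y : vec) : mink (refl_vec n x) y = mink x (refl_vec n y).
Proof. unfold refl_vec; autorewrite with mink. rewrite (mink_sym n y). ring. Qed.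

Lemma refl_refl (n x : vec) : mink n n = 1 -> refl_vec n (refl_vec n x) = x.
Proof.
  intros H. unfold refl_vec. autorewrite with mink. rewrite H. vec_ring.
Qed.

Lemma refl_add (n x y : vec) : refl_vec n (vadd x y) = vadd (refl_vec n x) (refl_vec n y).
Proof. unfold refl_vec; autorewrite with mink. vec_ring. Qed.

Lemma refl_scale (n x : vec) (a : R) : refl_vec n (vscale a x) = vscale a (refl_vec n x).
Proof. unfold refl_vec; autorewrite with mink. vec_ring. Qed.

Lemma refl_fix (n x : vec) : mink x n = 0 -> refl_vec n x = x.
Proof. intros H; unfold refl_vec; rewrite H. vec_ring. Qed.

Definition refl_frame (n : vec) (N : nat -> vec) : nat -> vec := fun j => refl_vec n (N j).

Lemma csum_refl (n : vec) (N : nat -> vec) : csum (refl_frame n N) = refl_vec n (csum N).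
Proof. unfold csum, refl_frame. rewrite refl_scale, !refl_add. reflexivity. Qed.

Lemma refl_future (n x : vec) : mink n n = 1 -> mink x x < 0 -> 0 < vt x -> 0 < vt (refl_vec n x).
Proof.
  intros Hn Hx Hv. apply (future_of_pairing x); trivial.
  - rewrite refl_mink by trivial. lra.
  - rewrite mink_sym, refl_mink_l, (mink_sym n x).
    nra.
Qed.

Lemma frame_refl (n : vec) (N : nat -> vec) : mink n n = 1 -> frame N -> frame (refl_frame n N).
Proof.
  intros Hn F. unfold refl_frame. split; intros; rewrite ?refl_mink by trivial.
  - rewrite (fr_rec N F i). unfold vsub. rewrite refl_add, refl_scale, refl_add, refl_scale. reflexivity.
  - apply (fr_unit N F).
  - apply (fr_orth N F).
  - apply (fr_ultra N F).
  - fold (refl_frame n N). rewrite csum_refl.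
    apply refl_future; [trivial|apply csum_timelike, F|apply (fr_future N F)].
Qed.

(** The corner of sides [i] and [1 + i]. By symmetry it is a combination of these two normals and
    that of the opposite side [3 + i]; orthogonality fixes the coefficient phi - 1, the combination
    has norm -phi, and the minus sign makes it future. *)
Definition vert (N : nat -> vec) (i : nat) : vec :=
  vscale (- / sqrt phi) (vadd (N i) (vadd (N (1 + i)%nat) (vscale (phi - 1) (N (3 + i)%nat)))).

Lemma sqrt_phi : 0 < sqrt phi /\ sqrt phi * sqrt phi = phi.
Proof. phi_facts. split; [apply sqrt_lt_R0|apply sqrt_sqrt]; lra. Qed.

Section Vertices.
Variable N : nat -> vec.
Hypothesis F : frame N.

Lemma vert0_normal :
  mink (vert N 0) (N 0%nat) = 0 /\ mink (vert N 0) (N 1%nat) = 0 /\ mink (vert N 0) (N 2%nat) = sqrt phi /\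
  mink (vert N 0) (N 3%nat) = phi * sqrt phi /\ mink (vert N 0) (N 4%nat) = sqrt phi.
Proof.
  destruct (fr_products N F) as (A00&A01&A02&A03&A04&A11&A12&A13&A14&A22&A23&A24&A33&A34&A44).
  destruct sqrt_phi as [Hs Hq]. phi_facts.
  unfold vert; simpl (_ + _)%nat; autorewrite with mink.
  rewrite (mink_sym (N 1%nat) (N 0%nat)), (mink_sym (N 3%nat) (N 0%nat)), (mink_sym (N 3%nat) (N 1%nat)), (mink_sym (N 3%nat) (N 2%nat)).
  rewrite A00,A01,A02,A03,A04,A11,A12,A13,A14,A23,A33,A34.
  repeat split; apply (Rmult_eq_reg_l (sqrt phi)); try lra; field_simplify; try lra; nra.
Qed.

Lemma vert0_vert0 : mink (vert N 0) (vert N 0) = -1.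
Proof.
  destruct vert0_normal as (V0&V1&V2&V3&V4). destruct sqrt_phi as [Hs Hq]. phi_facts.
  unfold vert at 2; simpl (_ + _)%nat; autorewrite with mink. rewrite V0, V1, V3.
  apply (Rmult_eq_reg_l (sqrt phi)); try lra; field_simplify; try lra; nra.
Qed.

End Vertices.

Lemma vert_shift (N : nat -> vec) (k i : nat) : vert (shift k N) i = vert N (i + k)%nat.
Proof. unfold vert, shift. rewrite !Nat.add_assoc. reflexivity. Qed.

Lemma vert_normal (N : nat -> vec) (i : nat) : frame N ->
  mink (vert N i) (N i) = 0 /\ mink (vert N i) (N (1 + i)%nat) = 0 /\ mink (vert N i) (N (2 + i)%nat) = sqrt phi /\
  mink (vert N i) (N (3 + i)%nat) = phi * sqrt phi /\ mink (vert N i) (N (4 + i)%nat) = sqrt phi.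
Proof.
  intros F. pose proof (vert0_normal (shift i N) (frame_shift N F i)) as H.
  rewrite vert_shift in H. exact H.
Qed.

Lemma vert_sheet (N : nat -> vec) (i : nat) : frame N -> mink (vert N i) (vert N i) = -1.
Proof.
  intros F. pose proof (vert0_vert0 (shift i N) (frame_shift N F i)) as H.
  rewrite vert_shift in H. exact H.
Qed.

Lemma vert_next (N : nat -> vec) (i : nat) : frame N ->
  mink (vert N i) (vert N (1 + i)) = - phi /\ mink (vert N i) (vert N (2 + i)) = - (phi + 1) /\
  mink (vert N i) (vert N (3 + i)) = - (phi + 1) /\ mink (vert N i) (vert N (4 + i)) = - phi.
Proof.
  intros F. destruct (vert_normal N i F) as (V0&V1&V2&V3&V4).
  destruct sqrt_phi as [Hs Hq]. 
  unfold vert at 2 4 6 8. autorewrite with mink.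
  replace (3 + (2 + i))%nat with (5 + i)%nat by lia. replace (3 + (3 + i))%nat with (5 + (1 + i))%nat by lia.
  replace (3 + (4 + i))%nat with (5 + (2 + i))%nat by lia.
  replace (1 + (4 + i))%nat with (5 + i)%nat by lia.
  replace (1 + (3 + i))%nat with (4 + i)%nat by lia. replace (1 + (2 + i))%nat with (3 + i)%nat by lia.
  replace (1 + (1 + i))%nat with (2 + i)%nat by lia. replace (3 + (1 + i))%nat with (4 + i)%nat by lia.
  rewrite !(fr_periodic N F), V0, V1, V2, V3, V4.
  repeat split; apply (Rmult_eq_reg_l (sqrt phi)); try lra; field_simplify; try lra; nra.
Qed.

Lemma vert_csum (N : nat -> vec) (i : nat) : frame N -> mink (vert N i) (csum N) = - (sqrt phi * (2 + phi)).
Proof.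
  intros F. rewrite <- (csum_shift N F i).
  pose proof (vert0_normal (shift i N) (frame_shift N F i)) as (V0&V1&V2&V3&V4).
  rewrite vert_shift in *. simpl (0 + i)%nat in *.
  unfold csum; autorewrite with mink. rewrite V0,V1,V2,V3,V4. ring.
Qed.

Lemma vert_future (N : nat -> vec) (i : nat) : frame N -> 0 < vt (vert N i).
Proof.
  intros F. apply (future_of_pairing (csum N)).
  - apply csum_timelike, F.
  - apply (fr_future N F).
  - rewrite vert_sheet by trivial. lra.
  - rewrite mink_sym, vert_csum by trivial. destruct sqrt_phi. nra.
Qed.

Definition vertH (N : nat -> vec) (F : frame N) (i : nat) : H2 :=
  MkH2 (vert N i) (vert_sheet N i F) (vert_future N i F).

Definition ctr_scale : R := / sqrt (5 * (2 * phi - 1)).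

Lemma ctr_scale_spec : 0 < ctr_scale /\ ctr_scale * ctr_scale * (5 * (2 * phi - 1)) = 1.
Proof.
  phi_facts. assert (0 < sqrt (5 * (2 * phi - 1))) by (apply sqrt_lt_R0; lra).
  assert (Q : sqrt (5 * (2 * phi - 1)) * sqrt (5 * (2 * phi - 1)) = 5 * (2 * phi - 1)) by (apply sqrt_sqrt; lra).
  unfold ctr_scale; split; [apply Rinv_0_lt_compat; trivial|].
  rewrite <- Q at 3. field. lra.
Qed.

Definition is_ctr (N : nat -> vec) (c : H2) : Prop := coords c = vscale ctr_scale (csum N).

Lemma ctr_exists (N : nat -> vec) : frame N -> exists c, is_ctr N c.
Proof.
  intros F. destruct ctr_scale_spec as [Hs Hq].
  assert (E : mink (vscale ctr_scale (csum N)) (vscale ctr_scale (csum N)) = -1).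
  { autorewrite with mink. rewrite csum_csum by trivial. lra. }
  assert (U : 0 < vt (vscale ctr_scale (csum N))).
  { simpl. apply Rmult_lt_0_compat; [trivial|apply (fr_future N F)]. }
  exists (MkH2 _ E U). reflexivity.
Qed.

Definition cell (N : nat -> vec) : H2 -> Prop := fun x => forall i, 0 <= mink x (N i).

Lemma cell_shift (N : nat -> vec) (k : nat) (x : H2) : frame N -> cell (shift k N) x <-> cell N x.
Proof.
  intros F; split; intros H i.
  - specialize (H (i + 4 * k)%nat). unfold shift in H.
    rewrite (fr_mod N F _ i) in H; trivial.
    replace (i + 4 * k + k)%nat with (i + k * 5)%nat by lia. apply Nat.Div0.mod_add.
  - apply H.
Qed.

Lemma cell_rev (N : nat -> vec) (x : H2) : frame N -> cell (rev_frame N) x <-> cell N x.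
Proof.
  intros F; split; intros H i.
  - specialize (H (4 * i)%nat). unfold rev_frame in H.
    rewrite (fr_mod N F _ i) in H; trivial.
    replace (4 * (4 * i))%nat with (i + (3 * i) * 5)%nat by lia. apply Nat.Div0.mod_add.
  - apply H.
Qed.

(** * Regular right-angled pentagons *)

Lemma set_ext (A B : H2 -> Prop) : (forall x, A x <-> B x) -> A = B.
Proof.
  intros H; apply functional_extensionality; intros x; apply propositional_extensionality, H.
Qed.

Lemma vert_normal_nonneg (N : nat -> vec) (i j : nat) : frame N -> 0 <= mink (vert N i) (N j).
Proof.
  intros F. destruct (shift_cases N F i j) as (d & Hd & ->).
  destruct (vert_normal N i F) as (V0&V1&V2&V3&V4). destruct sqrt_phi as [Hs _]. phi_facts.
  do 5 (destruct d as [|d]; [simpl (_ + i)%nat in *; rewrite ?V0, ?V1, ?V2, ?V3, ?V4; nra|]). lia.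
Qed.

Lemma vert_periodic (N : nat -> vec) (i : nat) : frame N -> vert N (5 + i) = vert N i.
Proof.
  intros F. unfold vert. replace (1 + (5 + i))%nat with (5 + (1 + i))%nat by lia.
  replace (3 + (5 + i))%nat with (5 + (3 + i))%nat by lia. rewrite !(fr_periodic N F). reflexivity.
Qed.

Lemma vert_mod (N : nat -> vec) (i j : nat) : frame N -> (i mod 5 = j mod 5)%nat -> vert N i = vert N j.
Proof.
  intros F. assert (H : forall q i, vert N (q * 5 + i)%nat = vert N i).
  { induction q as [|q IH]; intros k; trivial.
    change (S q * 5 + k)%nat with (5 + (q * 5 + k))%nat. rewrite vert_periodic by trivial; apply IH. }
  intros E. rewrite (Nat.div_mod_eq i 5), (Nat.div_mod_eq j 5), E, !(Nat.mul_comm 5), !H. reflexivity.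
Qed.

Lemma vert_cases (N : nat -> vec) : frame N -> forall i j, exists d, (d < 5)%nat /\ vert N j = vert N (d + i).
Proof.
  intros F i j. exists ((j + 4 * i) mod 5)%nat. split; [apply Nat.mod_upper_bound; lia|].
  apply (vert_mod N); trivial. rewrite Nat.Div0.add_mod_idemp_l.
  replace (j + 4 * i + i)%nat with (j + i * 5)%nat by lia. symmetry; apply Nat.Div0.mod_add.
Qed.

Definition vsum (a : nat -> R) (w : nat -> vec) : vec :=
  vadd (vscale (a 0%nat) (w 0%nat)) (vadd (vscale (a 1%nat) (w 1%nat))
   (vadd (vscale (a 2%nat) (w 2%nat)) (vadd (vscale (a 3%nat) (w 3%nat)) (vscale (a 4%nat) (w 4%nat))))).

Definition five (a b c d e : R) (i : nat) : R :=
  match i with O => a | S O => b | S (S O) => c | S (S (S O)) => d | _ => e end.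

Lemma five_nonneg (a b c d e : R) :
  0 <= a -> 0 <= b -> 0 <= c -> 0 <= d -> 0 <= e -> forall i, 0 <= five a b c d e i.
Proof. intros Ha Hb Hc Hd He [|[|[|[|i]]]]; assumption. Qed.

(* The fan of triangles from the vertex [vert N 0]. *)
Lemma cone_of_normals (N : nat -> vec) (x : vec) : frame N ->
  (forall i, 0 <= mink x (N i)) ->
  exists a, (forall i, 0 <= a i) /\ x = vsum a (vert N).
Proof.
  intros F H.
  destruct (vert_normal N 0 F) as (A0&A1&A2&A3&A4).
  destruct (vert_normal N 1 F) as (B1&B2&B3&B4&B0).
  destruct (vert_normal N 2 F) as (C2&C3&C4&C0&C1).
  destruct (vert_normal N 3 F) as (D3&D4&D0&D1&D2).
  destruct (vert_normal N 4 F) as (E4&E0&E1&E2&E3).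
  pose proof (fr_periodic N F 0) as P0. pose proof (fr_periodic N F 1) as P1.
  pose proof (fr_periodic N F 2) as P2. pose proof (fr_periodic N F 3) as P3.
  simpl (_ + _)%nat in *. rewrite P0 in *. rewrite P1 in *. rewrite P2 in *. rewrite P3 in *.
  pose proof (pair_rec N x F 0) as X3. pose proof (pair_rec N x F 1) as X4. simpl (_ + _)%nat in *.
  pose proof (H 0%nat) as H0. pose proof (H 1%nat) as H1. pose proof (H 2%nat) as H2.
  pose proof (H 3%nat) as H3. pose proof (H 4%nat) as H4.
  destruct sqrt_phi as [Hs Hq]. phi_facts.
  set (t := sqrt phi) in *.
  assert (It : 0 < / t) by (apply Rinv_0_lt_compat; trivial).
  assert (Ip : 0 < / phi) by (apply Rinv_0_lt_compat; lra).
  (* The diagonals from corner 0 to corners 2 and 3 lie where the pairing with [N 0] is phi times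
     that with [N 1], and conversely. They cut the pentagon into the triangles 012, 034 and 023,
     treated in this order. *)
  destruct (Rle_lt_dec (phi * mink x (N 1%nat)) (mink x (N 0%nat))) as [L|L];
    [|destruct (Rle_lt_dec (phi * mink x (N 0%nat)) (mink x (N 1%nat))) as [L'|L']].
  - exists (five (mink x (N 2%nat) / t) ((mink x (N 0%nat) - phi * mink x (N 1%nat)) / t)
                (mink x (N 1%nat) / t) 0 0).
    split.
    + apply five_nonneg; unfold Rdiv; try lra; apply Rmult_le_pos; lra.
    + apply (frame_ext N); trivial; unfold vsum, five; autorewrite with mink;
      rewrite ?A0,?A1,?A2,?B0,?B1,?B2,?C0,?C1,?C2; field; lra.
  - exists (five (mink x (N 4%nat) / t) 0 0 (mink x (N 0%nat) / t)
                ((mink x (N 1%nat) - phi * mink x (N 0%nat)) / t)).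
    split.
    + apply five_nonneg; unfold Rdiv; try lra; apply Rmult_le_pos; lra.
    + apply (frame_ext N); trivial; unfold vsum, five; autorewrite with mink;
      rewrite ?A0,?A1,?A2,?D0,?D1,?D2,?E0,?E1,?E2, ?X4, ?X3;
      field_simplify_eq; try lra; ring [Hphi2].
  - exists (five (mink x (N 3%nat) / t / phi) 0 ((phi * mink x (N 0%nat) - mink x (N 1%nat)) / t / phi)
                ((phi * mink x (N 1%nat) - mink x (N 0%nat)) / t / phi) 0).
    split.
    + apply five_nonneg; unfold Rdiv; try lra; repeat apply Rmult_le_pos; lra.
    + apply (frame_ext N); trivial; unfold vsum, five; autorewrite with mink;
      rewrite ?A0,?A1,?A2,?C0,?C1,?C2,?D0,?D1,?D2, ?X4, ?X3;
      field_simplify_eq; try lra; ring [Hphi2].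
Qed.

(** The offset by one makes [N i] the normal of the side from [v i] to [v (1 + i)]. *)
Definition presents (N : nat -> vec) (v : nat -> H2) : Prop :=
  frame N /\ (forall i, coords (v (1 + i)%nat) = vert N i) /\ (forall i, v (i + 5)%nat = v i).

Lemma hull_cell (N : nat -> vec) (v : nat -> H2) : presents N v -> hull v = cell N.
Proof.
  intros (F & Hv & Hp). apply set_ext; intros x.
  assert (V0 : coords (v 0%nat) = vert N 4) by (rewrite <- (Hp 0%nat); apply (Hv 4%nat)).
  pose proof (Hv 0%nat) as V1. pose proof (Hv 1%nat) as V2. pose proof (Hv 2%nat) as V3.
  pose proof (Hv 3%nat) as V4. simpl (_ + _)%nat in *.
  split.
  - intros (a & Ha & E) j. rewrite E. simpl. rewrite V0, V1, V2, V3, V4.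
    autorewrite with mink. repeat apply Rplus_le_le_0_compat; try lra;
    apply Rmult_le_pos; trivial; apply vert_normal_nonneg, F.
  - intros H. destruct (cone_of_normals N x F H) as (a & Ha & E).
    exists (fun i => match i with O => a 4%nat | S k => a k end). split.
    + intros [|k]; apply Ha.
    + simpl. rewrite V0, V1, V2, V3, V4, E. unfold vsum. vec_ring.
Qed.

(** [acos] is PI below -1 and 0 above 1, so no argument outside the interval can give PI / 2. *)
Lemma acos_half_pi (x : R) : acos x = PI / 2 -> x = 0.
Proof.
  pose proof PI_RGT_0 as HP. intros E.
  unfold acos in E. destruct (Rle_dec x (-1)) as [|n1]; [lra|].
  destruct (Rle_dec 1 x) as [|n2]; [lra|].
  assert (E' : acos x = PI / 2) by (unfold acos; destruct (Rle_dec x (-1)); [lra|]; destruct (Rle_dec 1 x); [lra|exact E]).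
  rewrite <- (cos_acos x), E' by lra. apply cos_PI2.
Qed.

Section Regular.
Variable v : nat -> H2.
Hypothesis R : regular_right_angled v.

Lemma regular_side : exists D, 1 < D /\ forall i, mink (v i) (v (1 + i)%nat) = - D.
Proof.
  destruct R as (Hp & Hc & Hs & Ha).
  exists (- mink (v 0%nat) (v 1%nat)). split.
  - pose proof (H2_pairing (v 0%nat) (v 1%nat)) as H.
    destruct (Req_dec (mink (v 0%nat) (v 1%nat)) (-1)) as [E|]; [|lra].
    apply H2_pairing_eq in E. pose proof (Hc 0%nat 2%nat ltac:(lia)) as C.
    rewrite <- E in C. unfold det3 in C. exfalso; lra.
  - intros i. change (1 + i)%nat with (S i). rewrite (dH_inj _ _ _ _ (Hs i 0%nat)). ring.
Qed.

(** If D is the hyperbolic cosine of a side, the right angles give D^2 for the diagonals.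
    Five-periodicity makes the pairing of [v 0] and [v 3] a diagonal too, and the Gram determinants
    of two consecutive triples then overdetermine D. *)
Lemma regular_gram : forall i,
  mink (v i) (v (1 + i)%nat) = - phi /\ mink (v i) (v (2 + i)%nat) = - (phi + 1).
Proof.
  destruct regular_side as (D & HD & H1). destruct R as (Hp & Hc & Hs & Ha).
  assert (H2 : forall i, mink (v i) (v (2 + i)%nat) = - (D * D)).
  { intros i. pose proof (acos_half_pi _ (Ha i)) as E. cbv zeta in E.
    set (u := direction (v (S i)) (v i)) in *. set (w := direction (v (S i)) (v (S (S i)))) in *.
    pose proof (H1 i) as E1. pose proof (H1 (1 + i)%nat) as E2. simpl (_ + _)%nat in *.
    assert (U : mink u u = D * D - 1).
    { unfold u, direction; autorewrite with mink. rewrite (mink_sym (v (S i)) (v i)), E1, !coords_sheet. ring. }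
    assert (W : mink w w = D * D - 1).
    { unfold w, direction; autorewrite with mink.
      rewrite (mink_sym (v (S (S i))) (v (S i))), E2, !coords_sheet. ring. }
    assert (Hd : 0 < sqrt (D * D - 1)) by (apply sqrt_lt_R0; nra).
    assert (Z : mink u w = 0).
    { rewrite U, W in E. apply (f_equal (fun z => z * (sqrt (D*D-1) * sqrt (D*D-1)))) in E.
      unfold Rdiv in E. rewrite Rmult_assoc, Rinv_l in E by nra. lra. }
    unfold u, w, direction in Z; autorewrite with mink in Z.
    rewrite (mink_sym (v (S (S i))) (v (S i))), E1, E2, !coords_sheet in Z. lra. }
  assert (E : D = phi).
  { pose proof (det3_gram (v 0%nat) (v 1%nat) (v 2%nat) (v 0%nat) (v 1%nat) (v 2%nat)) as G1.
    pose proof (det3_gram (v 0%nat) (v 1%nat) (v 2%nat) (v 1%nat) (v 2%nat) (v 3%nat)) as G2.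
    pose proof (det3_gram (v 1%nat) (v 2%nat) (v 3%nat) (v 1%nat) (v 2%nat) (v 3%nat)) as G3.
    pose proof (Hc 0%nat 2%nat ltac:(lia)) as C0. pose proof (Hc 1%nat 2%nat ltac:(lia)) as C1.
    pose proof (H1 0%nat) as A01. pose proof (H1 1%nat) as A12. pose proof (H1 2%nat) as A23.
    pose proof (H2 0%nat) as A02. pose proof (H2 1%nat) as A13. pose proof (H2 3%nat) as A30.
    pose proof (Hp 0%nat) as P. simpl (_ + _)%nat in *. rewrite P in A30.
    rewrite (mink_sym (v 3%nat) (v 0%nat)) in A30.
    assert (A10 := A01). assert (A21 := A12). assert (A32 := A23). assert (A20 := A02). assert (A31 := A13).
    rewrite mink_sym in A10, A21, A32, A20, A31.
    rewrite A01, A10, A12, A21, A02, A20, !coords_sheet in G1.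
    rewrite A01, A12, A23, A02, A13, A30, !coords_sheet in G2.
    rewrite A12, A21, A23, A32, A13, A31, !coords_sheet in G3.
    set (d := det3 (v 0%nat) (v 1%nat) (v 2%nat)) in *. set (e := det3 (v 1%nat) (v 2%nat) (v 3%nat)) in *.
    (* The two determinants have equal squares, and convexity makes both positive. *)
    assert (d = e).
    { assert (d * d = e * e) by lra. assert ((d - e) * (d + e) = 0) by lra.
      apply Rmult_integral in H0 as [|]; lra. }
    rewrite <- H in G2.
    assert (Z : (D * D - 1) * ((D - 1) * (D * D - D - 1)) = 0) by nra.
    assert (D * D - D - 1 = 0).
    { apply Rmult_integral in Z as [Z|Z]; [nra|]. apply Rmult_integral in Z as [Z|Z]; nra. }
    phi_facts. nra. }
  intros i. rewrite <- E, H1, H2. split; [reflexivity|]. rewrite E. rewrite phi2; ring.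
Qed.

Lemma regular_rec : forall i, coords (v (3 + i)%nat) =
  vadd (vscale phi (vsub (v (2 + i)%nat) (v (1 + i)%nat))) (v i).
Proof.
  intros i. pose proof regular_gram as G. destruct R as (Hp & Hc & _).
  apply (nondegenerate (v i) (v (1 + i)%nat) (v (2 + i)%nat)).
  { pose proof (Hc i 2%nat ltac:(lia)). simpl (_ + _)%nat in *. lra. }
  all: unfold vsub; autorewrite with mink; rewrite ?coords_sheet.
  - destruct (G (3 + i)%nat) as [_ E]. replace (2 + (3 + i))%nat with (i + 5)%nat in E by lia.
    rewrite Hp in E. rewrite E, (mink_sym (v (2 + i)%nat)), (mink_sym (v (1 + i)%nat)).
    rewrite (proj1 (G i)), (proj2 (G i)). nra.
  - rewrite (mink_sym (v (3 + i)%nat)), (mink_sym (v (2 + i)%nat)).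
    pose proof (proj2 (G (1 + i)%nat)) as E1. pose proof (proj1 (G (1 + i)%nat)) as E2.
    pose proof (proj1 (G i)) as E3. simpl (_ + _)%nat in *. rewrite E1, E2, E3. phi_facts. nra.
  - rewrite (mink_sym (v (3 + i)%nat)).
    pose proof (proj1 (G (2 + i)%nat)) as E1. pose proof (proj1 (G (1 + i)%nat)) as E2.
    pose proof (proj2 (G i)) as E3. simpl (_ + _)%nat in *. rewrite E1, E2, E3. phi_facts. nra.
Qed.

(** The vector [v (3 + i)] minus [v i] minus [v (1 + i)] is orthogonal to [v i] and [v (1 + i)],
    pairs positively with [v (3 + i)], and has norm 2 phi + 1 = phi^3; [g] normalizes it. *)
Lemma regular_frame : exists N, presents N v.
Proof.
  pose proof regular_gram as G. pose proof regular_rec as Rec.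
  assert (Hp := proj1 R).
  destruct sqrt_phi as [Hs Hq]. phi_facts.
  set (g := / (phi * sqrt phi)).
  assert (Hg : 0 < g) by (apply Rinv_0_lt_compat; nra).
  assert (Hg2 : g * g * (2 * phi + 1) = 1).
  { unfold g. replace (2 * phi + 1) with (phi * phi * (sqrt phi * sqrt phi)) by (rewrite Hq; nra).
    field. split; lra. }
  set (N := fun i => vscale g (vsub (v (3 + i)%nat) (vadd (v i) (v (1 + i)%nat)))).
  assert (G1 : forall i, mink (v i) (v (1 + i)%nat) = - phi) by apply G.
  assert (G2 : forall i, mink (v i) (v (2 + i)%nat) = - (phi + 1)) by apply G.
  assert (NE : forall i, N i = vscale g (vsub (vscale phi (vsub (v (2 + i)%nat) (v (1 + i)%nat))) (v (1+i)%nat))).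
  { intros i. unfold N. rewrite Rec. unfold vsub. vec_ring. }
  assert (NR : forall i, N (3 + i)%nat = vadd (vscale phi (vsub (N (2 + i)%nat) (N (1 + i)%nat))) (N i)).
  { intros i. unfold N.
    replace (3 + (3 + i))%nat with (3 + (2 + (1 + i)))%nat by lia.
    rewrite (Rec (2 + (1 + i)))%nat.
    replace (3 + (2 + i))%nat with (3 + (1 + (1 + i)))%nat by lia.
    replace (2 + (2 + (1 + i)))%nat with (3 + (1 + (1 + i)))%nat by lia.
    replace (1 + (2 + (1 + i)))%nat with (3 + (1 + i))%nat by lia.
    replace (2 + (1 + i))%nat with (3 + i)%nat by lia.
    replace (1 + (3 + i))%nat with (3 + (1 + i))%nat by lia.
    replace (1 + (2 + i))%nat with (3 + i)%nat by lia.
    rewrite (Rec (1 + (1 + i)))%nat, (Rec (1 + i)%nat).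
    replace (2 + (1 + (1 + i)))%nat with (3 + (1 + i))%nat by lia.
    replace (1 + (1 + (1 + i)))%nat with (3 + i)%nat by lia.
    replace (2 + (1 + i))%nat with (3 + i)%nat by lia.
    replace (1 + (1 + i))%nat with (2 + i)%nat by lia.
    rewrite (Rec (1 + i)%nat).
    replace (2 + (1 + i))%nat with (3 + i)%nat by lia.
    replace (1 + (1 + i))%nat with (2 + i)%nat by lia.
    rewrite (Rec i). unfold vsub. apply vec_ext; simpl; ring [Hphi2]. }
  exists N.
  assert (FN : frame N).
  { apply frame_intro; trivial; rewrite ?NE; unfold vsub; autorewrite with mink;
     try (
     pose proof (G1 1%nat) as A12; pose proof (G1 2%nat) as A23; pose proof (G2 1%nat) as A13;
     pose proof (G1 3%nat) as A34; pose proof (G2 2%nat) as A24;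
     assert (A14 : mink (v 1%nat) (v 4%nat) = - (phi + 1)) by
       (rewrite mink_sym; pose proof (G2 4%nat) as Z; cbn [Nat.add] in Z; rewrite (Hp 1%nat : v 6%nat = _) in Z; exact Z);
     cbn [Nat.add] in *;
     rewrite ?(mink_sym (v 2%nat) (v 1%nat)), ?(mink_sym (v 3%nat) (v 1%nat)), ?(mink_sym (v 3%nat) (v 2%nat)),
        ?(mink_sym (v 4%nat) (v 2%nat)), ?(mink_sym (v 4%nat) (v 3%nat)), ?A12, ?A23, ?A13, ?A34, ?A24, ?A14; repeat rewrite coords_sheet).
    1-3: rewrite <- Hg2; ring [Hphi2].
    1-2: ring [Hphi2].
    1: transitivity (- phi * (g * g * (2 * phi + 1))); [ring [Hphi2]|rewrite Hg2; ring].
    assert (E : csum N = vscale g (vadd (v 0%nat) (vadd (v 1%nat) (vadd (v 2%nat) (vadd (v 3%nat) (v 4%nat)))))).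
    { unfold csum, N; simpl (_ + _)%nat. rewrite (Hp 0%nat : v 5%nat = _), (Hp 1%nat : v 6%nat = _), (Hp 2%nat : v 7%nat = _).
      unfold vsub. vec_ring. }
    rewrite E. simpl. pose proof (coords_upper (v 0%nat)). pose proof (coords_upper (v 1%nat)).
    pose proof (coords_upper (v 2%nat)). pose proof (coords_upper (v 3%nat)). pose proof (coords_upper (v 4%nat)). nra. }
  split; [exact FN|split; [|exact Hp]].
  intros i. unfold vert.
  assert (E : vadd (N i) (vadd (N (1 + i)%nat) (vscale (phi - 1) (N (3 + i)%nat))) =
     vscale (- g * (phi * phi)) (v (1 + i)%nat)).
  { rewrite NR, !NE.
    replace (2 + (2 + i))%nat with (3 + (1 + i))%nat by lia.
    replace (1 + (2 + i))%nat with (3 + i)%nat by lia.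
    replace (2 + (1 + i))%nat with (3 + i)%nat by lia.
    replace (1 + (1 + i))%nat with (2 + i)%nat by lia.
    rewrite (Rec (1 + i)%nat).
    replace (2 + (1 + i))%nat with (3 + i)%nat by lia.
    replace (1 + (1 + i))%nat with (2 + i)%nat by lia.
    rewrite (Rec i). unfold vsub. apply vec_ext; simpl; ring [Hphi2]. }
  rewrite E, vscale_vscale.
  replace (- / sqrt phi * (- g * (phi * phi))) with 1; [symmetry; apply vscale_1|].
  unfold g. replace (phi * phi) with (phi * (sqrt phi * sqrt phi)) by (rewrite Hq; reflexivity).
  field. split; lra.
Qed.

End Regular.

Lemma square_one (t : R) : 0 <= t -> t * t = 1 -> t = 1.
Proof. intros H E. apply (Rmult_eq_reg_r (t + 1)); lra. Qed.

Definition vdet (N : nat -> vec) (i k : nat) : R := det3 (vert N i) (vert N (1 + i)) (vert N (k + i)).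

Lemma vert_gram (N : nat -> vec) (i : nat) : frame N ->
  let w k := vert N (k + i) in
  mink (w 0%nat) (w 0%nat) = -1 /\ mink (w 0%nat) (w 1%nat) = - phi /\ mink (w 0%nat) (w 2%nat) = - (phi + 1) /\
  mink (w 0%nat) (w 3%nat) = - (phi + 1) /\ mink (w 0%nat) (w 4%nat) = - phi /\
  mink (w 1%nat) (w 1%nat) = -1 /\ mink (w 1%nat) (w 2%nat) = - phi /\ mink (w 1%nat) (w 3%nat) = - (phi + 1) /\
  mink (w 1%nat) (w 4%nat) = - (phi + 1) /\ mink (w 2%nat) (w 2%nat) = -1 /\
  mink (w 2%nat) (w 3%nat) = - phi /\ mink (w 2%nat) (w 4%nat) = - (phi + 1).
Proof.
  intros F w. unfold w.
  destruct (vert_next N i F) as (A1&A2&A3&A4).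
  destruct (vert_next N (1 + i) F) as (B1&B2&B3&B4).
  destruct (vert_next N (2 + i) F) as (C1&C2&C3&C4).
  repeat split; first [apply (vert_sheet N _ F) | assumption].
Qed.

(** Products of two such determinants are Gram determinants, hence explicit numbers in phi. All
    being positive, the sign of a single triple decides the orientation of the whole pentagon. *)
Lemma vdet_signs (N : nat -> vec) (i : nat) : frame N ->
  0 < vdet N i 2 * vdet N i 2 /\ 0 < vdet N i 2 * vdet N i 3 /\ 0 < vdet N i 2 * vdet N i 4 /\
  0 < vdet N i 2 * vdet N (1 + i) 2.
Proof.
  intros F. destruct (vert_gram N i F) as (A00&A01&A02&A03&A04&A11&A12&A13&A14&A22&A23&A24).
  cbn [Nat.add] in *.
  assert (A10 := A01). assert (A20 := A02). assert (A21 := A12). rewrite mink_sym in A10, A20, A21.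
  phi_facts.
  unfold vdet; cbn [Nat.add]; repeat split; rewrite det3_gram;
   rewrite ?A00,?A01,?A02,?A03,?A04,?A10,?A11,?A12,?A13,?A14,?A20,?A21,?A22,?A23,?A24; nra.
Qed.

Definition corners_of (N : nat -> vec) (F : frame N) (i : nat) : H2 := vertH N F (4 + i).

Lemma corners_presents (N : nat -> vec) (F : frame N) : presents N (corners_of N F).
Proof.
  split; [exact F|split].
  - intros i. unfold corners_of, vertH; cbn [coords].
    replace (4 + (1 + i))%nat with (5 + i)%nat by lia. apply vert_periodic, F.
  - intros i. apply H2_ext. unfold corners_of, vertH; cbn [coords].
    replace (4 + (i + 5))%nat with (5 + (4 + i))%nat by lia. apply vert_periodic, F.
Qed.

Lemma corners_regular (N : nat -> vec) (F : frame N) :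
  0 < vdet N 0 2 -> regular_right_angled (corners_of N F).
Proof.
  intros H0.
  assert (H : forall i, 0 < vdet N i 2).
  { induction i as [|i IH]; trivial. destruct (vdet_signs N i F) as (_&_&_&Q).
    change (S i) with (1 + i)%nat. nra. }
  pose proof (vert_next N) as G. phi_facts.
  split; [apply (corners_presents N F)|split; [|split]].
  - intros i k Hk. unfold corners_of; cbn [coords vertH].
    change (4 + S i)%nat with (1 + (4 + i))%nat. replace (4 + (k + i))%nat with (k + (4 + i))%nat by lia.
    change (0 < vdet N (4 + i) k).
    destruct (vdet_signs N (4 + i) F) as (Q2&Q3&Q4&_). pose proof (H (4 + i)%nat).
    assert (k = 2 \/ k = 3 \/ k = 4)%nat as [-> | [-> | ->]] by lia; nra.
  - intros i j. unfold dH, corners_of; cbn [coords vertH].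
    change (4 + S i)%nat with (1 + (4 + i))%nat. change (4 + S j)%nat with (1 + (4 + j))%nat.
    rewrite (proj1 (G (4 + i)%nat F)), (proj1 (G (4 + j)%nat F)). reflexivity.
  - intros i. unfold angle. cbv zeta.
    match goal with |- acos (?x / _) = _ => replace x with 0 end.
    + unfold Rdiv. rewrite Rmult_0_l. apply acos_0.
    + unfold direction, corners_of; cbn [coords vertH]. autorewrite with mink.
      change (4 + S i)%nat with (1 + (4 + i))%nat. change (4 + S (S i))%nat with (2 + (4 + i))%nat.
      set (j := (4 + i)%nat). pose proof (G j F) as (A1&A2&_). pose proof (G (1 + j)%nat F) as (B1&_).
      change (1 + (1 + j))%nat with (2 + j)%nat in B1.
      rewrite (mink_sym (vert N (2 + j))), A1, A2, B1, vert_sheet by exact F. nra.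
Qed.

Lemma vert_rev (N : nat -> vec) (i : nat) : frame N -> vert (rev_frame N) i = vert N (4 + 4 * i).
Proof.
  intros F. unfold vert, rev_frame.
  replace (4 * (1 + i))%nat with (4 + 4 * i)%nat by lia.
  replace (4 * (3 + i))%nat with (5 + (5 + (2 + 4 * i)))%nat by lia.
  replace (1 + (4 + 4 * i))%nat with (5 + 4 * i)%nat by lia.
  replace (3 + (4 + 4 * i))%nat with (5 + (2 + 4 * i))%nat by lia.
  rewrite !(fr_periodic N F). vec_ring.
Qed.

(** A frame has no preferred orientation but [convex_counterclockwise] does: if the corners run
    clockwise, the reversed frame of the same cell is used. *)
Lemma cell_pentagon (N : nat -> vec) : frame N ->
  exists v M, pentagon v (cell N) /\ presents M v /\ cell M = cell N.
Proof.
  intros F. destruct (Rlt_le_dec 0 (vdet N 0 2)) as [H|H].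
  - exists (corners_of N F), N. split; [|split; [apply corners_presents|reflexivity]].
    split; [apply corners_regular, H|]. symmetry; apply hull_cell, corners_presents.
  - pose proof (frame_rev N F) as F'.
    assert (E : cell (rev_frame N) = cell N) by (apply set_ext; intros x; apply cell_rev, F).
    exists (corners_of _ F'), (rev_frame N). split; [|split; [apply corners_presents|exact E]].
    split; [|rewrite <- E; symmetry; apply hull_cell, corners_presents].
    apply corners_regular. unfold vdet; cbn [Nat.add].
    rewrite !(vert_rev N) by exact F.
    rewrite (vert_mod N (4 + 4 * 0) 4), (vert_mod N (4 + 4 * 1) 3), (vert_mod N (4 + 4 * 2) 2) by (trivial; reflexivity).
    replace (det3 (vert N 4) (vert N 3) (vert N 2)) with (- vdet N 2 2) by (unfold vdet, det3; cbn [Nat.add]; ring).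
    destruct (vdet_signs N 0 F) as (Q0&_&_&Q1). destruct (vdet_signs N 1 F) as (_&_&_&Q2).
    cbn [Nat.add] in *.
    assert (vdet N 1 2 < 0) by nra. nra.
Qed.

(** * Recovering corners, sides and center from the set of points *)

Lemma vert_independent (N : nat -> vec) : frame N -> det3 (vert N 0) (vert N 1) (vert N 2) <> 0.
Proof.
  intros F E. destruct (vdet_signs N 0 F) as (Q&_). unfold vdet in Q. cbn [Nat.add] in Q. nra.
Qed.

Lemma pentagon_frame (v : nat -> H2) (P : H2 -> Prop) : pentagon v P ->
  exists N, presents N v /\ P = cell N.
Proof.
  intros [R ->]. destruct (regular_frame v R) as [N HN]. exists N. split; [exact HN|].
  apply hull_cell, HN.
Qed.

Lemma presents_vert (N : nat -> vec) (v : nat -> H2) (i : nat) :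
  presents N v -> coords (v i) = vert N (4 + i).
Proof. intros (F & Hv & Hp). rewrite <- Hp, <- Hv. do 2 f_equal. lia. Qed.

Lemma vert_unique (N : nat -> vec) (i : nat) (p : vec) : frame N ->
  mink p p = -1 -> 0 < vt p -> mink p (N i) = 0 -> mink p (N (1 + i)%nat) = 0 -> p = vert N i.
Proof.
  intros F Hp Hf H0 H1. destruct (vert_normal N i F) as (V0&V1&V2&_).
  destruct sqrt_phi as [Hs Hq].
  assert (E : p = vscale (mink p (N (2 + i)%nat) / sqrt phi) (vert N i)).
  { apply (frame_ext (shift i N)); [apply frame_shift, F|..]; unfold shift; cbn [Nat.add] in *;
    rewrite mink_scale_l, ?V0, ?V1, ?V2, ?H0, ?H1; field; lra. }
  set (t := mink p (N (2 + i)%nat) / sqrt phi) in *.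
  rewrite E in Hp, Hf. autorewrite with mink in Hp. rewrite (vert_sheet N i F) in Hp.
  change (0 < t * vt (vert N i)) in Hf. pose proof (vert_future N i F).
  assert (0 < t) by nra. assert (H3 : t = 1) by (apply square_one; lra).
  rewrite E, H3. apply vscale_1.
Qed.

Lemma vert_in_cell (N : nat -> vec) (F : frame N) (i : nat) : cell N (vertH N F i).
Proof. intros j. apply vert_normal_nonneg, F. Qed.

(** Corners are extreme. Write a corner of [M] as a nonnegative combination of corners of [N]; its
    two normals vanish on it and are nonnegative on every summand, so a summand with positive
    coefficient lies on both lines and is that corner. *)
Lemma cell_vertices (N M : nat -> vec) : frame N -> frame M -> cell N = cell M ->
  forall i, exists j, vert M i = vert N j.
Proof.
  intros F G E i.
  assert (C : cell N (vertH M G i)) by (rewrite E; apply vert_in_cell).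
  destruct (cone_of_normals N _ F C) as (a & Ha & X). cbn [coords vertH] in X.
  assert (Hz : forall j, 0 <= mink (vert N j) (M i) /\ 0 <= mink (vert N j) (M (1 + i)%nat)).
  { intros j. assert (C' : cell M (vertH N F j)) by (rewrite <- E; apply vert_in_cell).
    split; apply C'. }
  assert (U : forall j, 0 < a j -> a j * (mink (vert N j) (M i) + mink (vert N j) (M (1 + i)%nat)) <= 0 ->
    exists j, vert M i = vert N j).
  { intros j Hj H. exists j. symmetry. destruct (Hz j).
    apply vert_unique; [exact G|apply vert_sheet, F|apply vert_future, F|nra|nra]. }
  destruct (vert_normal M i G) as (V0&V1&_).
  assert (S : mink (vert M i) (M i) + mink (vert M i) (M (1 + i)%nat) = 0) by (rewrite V0, V1; ring).
  rewrite X in S. unfold vsum in S; autorewrite with mink in S.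
  pose proof (Ha 0%nat) as A0. pose proof (Ha 1%nat) as A1. pose proof (Ha 2%nat) as A2.
  pose proof (Ha 3%nat) as A3. pose proof (Ha 4%nat) as A4.
  pose proof (fun j => Rmult_le_pos _ _ (Ha j) (proj1 (Hz j))) as Q1.
  pose proof (fun j => Rmult_le_pos _ _ (Ha j) (proj2 (Hz j))) as Q2.
  pose proof (Q1 0%nat). pose proof (Q1 1%nat). pose proof (Q1 2%nat). pose proof (Q1 3%nat). pose proof (Q1 4%nat).
  pose proof (Q2 0%nat). pose proof (Q2 1%nat). pose proof (Q2 2%nat). pose proof (Q2 3%nat). pose proof (Q2 4%nat).
  destruct A0 as [A0|A0]; [apply (U 0%nat A0); lra|].
  destruct A1 as [A1|A1]; [apply (U 1%nat A1); lra|].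
  destruct A2 as [A2|A2]; [apply (U 2%nat A2); lra|].
  destruct A3 as [A3|A3]; [apply (U 3%nat A3); lra|].
  destruct A4 as [A4|A4]; [apply (U 4%nat A4); lra|].
  exfalso. pose proof (vert_future M i G) as Hf. rewrite X in Hf. unfold vsum in Hf.
  simpl in Hf. rewrite <- A0, <- A1, <- A2, <- A3, <- A4 in Hf. lra.
Qed.

Lemma normal_unique (M : nat -> vec) (i : nat) (n : vec) : frame M -> mink n n = 1 ->
  mink (vert M i) n = 0 -> mink (vert M (1 + i)) n = 0 -> (exists j, 0 < mink (vert M j) n) ->
  (forall j, 0 <= mink (vert M j) n) -> n = M (1 + i)%nat.
Proof.
  intros F Hn H0 H1 _ Hp. phi_facts. destruct sqrt_phi as [Hs Hq].
  pose proof (pair_rec M n F i) as X3. pose proof (pair_rec M n F (1 + i)) as X4.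
  
  rewrite mink_sym in H0, H1. unfold vert in H0, H1. autorewrite with mink in H0, H1.
  cbn [Nat.add] in *.
  set (y0 := mink n (M i)) in *. set (y1 := mink n (M (S i))) in *. set (y2 := mink n (M (S (S i)))) in *.
  set (y3 := mink n (M (S (S (S i))))) in *. set (y4 := mink n (M (S (S (S (S i)))))) in *.
  assert (Is : / sqrt phi <> 0) by (apply Rinv_neq_0_compat; lra).
  assert (Z0 : y0 + (y1 + (phi - 1) * y3) = 0) by (apply (Rmult_eq_reg_l (- / sqrt phi)); lra).
  assert (Z1 : y1 + (y2 + (phi - 1) * y4) = 0) by (apply (Rmult_eq_reg_l (- / sqrt phi)); lra).
  assert (E2 : y2 + phi * y0 = 0)
    by (transitivity (y0 + (y1 + (phi - 1) * y3)); [rewrite X3; ring [Hphi2]|exact Z0]).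
  assert (E0 : y0 + phi * y2 = 0)
    by (transitivity (y1 + (y2 + (phi - 1) * y4)); [rewrite X4, X3; ring [Hphi2]|exact Z1]).
  assert (Y0 : y0 = 0).
  { apply (Rmult_eq_reg_l phi); [|lra].
    transitivity (phi * (y2 + phi * y0) - (y0 + phi * y2)); [ring [Hphi2]|rewrite E0, E2; ring]. }
  assert (Y2 : y2 = 0) by (rewrite Y0 in E2; lra).
  assert (E : n = vscale y1 (M (S i))).
  { apply (frame_ext (shift i M)); [apply frame_shift, F|..]; unfold shift; cbn [Nat.add];
    rewrite mink_scale_l; fold y0 y1 y2.
    - rewrite mink_sym, (fr_orth M F i : mink _ (M (S i)) = 0), Y0. ring.
    - rewrite (fr_unit M F). ring.
    - rewrite (fr_orth M F (S i) : mink _ (M (S (S i))) = 0), Y2. ring. }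
  rewrite E in Hn. autorewrite with mink in Hn. rewrite (fr_unit M F) in Hn.
  specialize (Hp (2 + i)%nat). rewrite E in Hp. autorewrite with mink in Hp.
  destruct (vert_normal M (2 + i) F) as (_&_&_&_&V).
  replace (4 + (2 + i))%nat with (5 + (1 + i))%nat in V by lia. rewrite (fr_periodic M F) in V.
  cbn [Nat.add] in *. rewrite V in Hp.
  assert (Y1 : y1 = 1) by (apply square_one; nra). rewrite E, Y1. apply vscale_1.
Qed.

(** The ends of a side of [M] are corners of [N]. Their pairing is -phi, whereas a diagonal has
    -(phi + 1), so they also bound a side of [N], and [normal_unique] identifies the normals. *)
Lemma cell_normals (N M : nat -> vec) : frame N -> frame M -> cell N = cell M ->
  forall i, exists j, M i = N j.
Proof.
  intros F G E.
  assert (S : forall i, exists j, M (1 + i)%nat = N j).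
  { intros i. destruct (cell_vertices N M F G E i) as (j & Ej).
    destruct (cell_vertices N M F G E (1 + i)) as (j' & Ej').
    destruct (vert_cases N F j j') as (d & Hd & Ed). rewrite Ed in Ej'.
    pose proof (proj1 (vert_next M i G)) as P. rewrite Ej, Ej' in P.
    destruct (vert_next N j F) as (A1&A2&A3&A4). phi_facts.
    assert (Hc : forall k l, 0 <= mink (vert M l) (N k)).
    { intros k l. assert (C : cell N (vertH M G l)) by (rewrite E; apply vert_in_cell). apply C. }
    assert (d = 1 \/ d = 4)%nat as [-> | ->].
    { destruct d as [|[|[|[|[|d]]]]]; try lia; exfalso.
      - simpl in P. rewrite vert_sheet in P by exact F. lra.
      - rewrite A2 in P; lra.
      - rewrite A3 in P; lra. }
    - exists (1 + j)%nat. symmetry. destruct (vert_normal N j F) as (V0&V1&V2&_).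
      destruct (vert_normal N (1 + j) F) as (W0&_).
      apply normal_unique; trivial.
      + apply (fr_unit N F).
      + rewrite Ej; exact V1.
      + rewrite Ej'; exact W0.
      + destruct (cell_vertices M N G F (eq_sym E) (4 + j)) as (l & El). exists l. rewrite <- El.
        destruct (vert_normal N (4 + j) F) as (_&_&V&_).
        replace (2 + (4 + j))%nat with (5 + (1 + j))%nat in V by lia.
        rewrite (fr_periodic N F) in V. rewrite V. apply sqrt_phi.
    - exists j. symmetry. destruct (vert_normal N j F) as (V0&V1&V2&_).
      destruct (vert_normal N (4 + j) F) as (W0&W1&_).
      replace (1 + (4 + j))%nat with (5 + j)%nat in W1 by lia. rewrite (fr_periodic N F) in W1.
      apply normal_unique; trivial.
      + apply (fr_unit N F).
      + rewrite Ej; exact V0.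
      + rewrite Ej'; exact W1.
      + destruct (cell_vertices M N G F (eq_sym E) (1 + j)) as (l & El). exists l. rewrite <- El.
        destruct (vert_normal N (1 + j) F) as (_&_&_&_&V).
        replace (4 + (1 + j))%nat with (5 + j)%nat in V by lia.
        rewrite (fr_periodic N F) in V. rewrite V. apply sqrt_phi. }
  intros i. destruct (S (4 + i)%nat) as (j & Ej). exists j. rewrite <- Ej.
  symmetry. replace (1 + (4 + i))%nat with (5 + i)%nat by lia. apply (fr_periodic M G).
Qed.

Lemma cell_csum (N M : nat -> vec) : frame N -> frame M -> cell N = cell M -> csum N = csum M.
Proof.
  intros F G E. pose proof (cell_normals N M F G E) as H.
  apply (frame_ext M); trivial; rewrite (csum_normal M G);
  match goal with |- context [M ?k] => destruct (H k) as (j & ->) end; apply (csum_normal N F).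
Qed.

Lemma is_vertex_cell (N : nat -> vec) (p : H2) : frame N ->
  is_vertex (cell N) p <-> exists i, coords p = vert N i.
Proof.
  intros F. split.
  - intros (v & i & Hv & ->). destruct (pentagon_frame _ _ Hv) as (M & HM & E).
    rewrite (presents_vert M v i HM). apply cell_vertices; [exact F|apply HM|exact E].
  - intros (i & Hi). destruct (cell_pentagon N F) as (v & M & Hv & HM & E).
    destruct (cell_vertices M N (proj1 HM) F E i) as (j & Ej).
    exists v, (1 + j)%nat. split; [exact Hv|]. apply H2_ext.
    destruct HM as (_ & Hm & _). rewrite Hm, Hi. exact Ej.
Qed.

Definition side (N : nat -> vec) (i : nat) : H2 -> Prop := fun x => cell N x /\ mink x (N i) = 0.

Lemma segment_side (N : nat -> vec) (p q : H2) (i : nat) : frame N ->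
  coords p = vert N (4 + i) -> coords q = vert N i -> segment p q = side N i.
Proof.
  intros F Hp Hq.
  destruct (vert_normal N i F) as (V0&V1&V2&V3&V4).
  destruct (vert_normal N (4 + i) F) as (W4&W0&W1&W2&W3).
  replace (1 + (4 + i))%nat with (5 + i)%nat in * by lia.
  replace (2 + (4 + i))%nat with (5 + (1 + i))%nat in * by lia.
  rewrite (fr_periodic N F) in W0, W1.
  destruct sqrt_phi as [Hs _].
  apply set_ext; intros x; split.
  - intros (a & b & Ha & Hb & E). split.
    + intros j. rewrite E, Hp, Hq. autorewrite with mink.
      apply Rplus_le_le_0_compat; apply Rmult_le_pos; trivial; apply vert_normal_nonneg, F.
    + rewrite E, Hp, Hq. autorewrite with mink. rewrite V0, W0. ring.
  - intros [C Z]. exists (mink x (N (1 + i)%nat) / sqrt phi), (mink x (N (4 + i)%nat) / sqrt phi).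
    pose proof (Rinv_0_lt_compat _ Hs).
    split; [apply Rmult_le_pos; [apply C|lra]|split; [apply Rmult_le_pos; [apply C|lra]|]].
    rewrite Hp, Hq.
    apply (frame_ext (shift (4 + i) N)); [apply frame_shift, F|..]; unfold shift;
      autorewrite with mink.
    + change (0 + (4 + i))%nat with (4 + i)%nat. rewrite V4, W4. field; lra.
    + replace (1 + (4 + i))%nat with (5 + i)%nat by lia. rewrite (fr_periodic N F i), Z, V0, W0. ring.
    + replace (2 + (4 + i))%nat with (5 + (1 + i))%nat by lia. rewrite (fr_periodic N F (1 + i)), V1, W1. field; lra.
Qed.

Lemma is_side_cell (N : nat -> vec) (s : H2 -> Prop) : frame N ->
  is_side (cell N) s <-> exists i, s = side N i.
Proof.
  intros F. split.
  - intros (v & i & Hv & ->). destruct (pentagon_frame _ _ Hv) as (M & HM & E).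
    rewrite (segment_side M _ _ i (proj1 HM)).
    + destruct (cell_normals N M F (proj1 HM) E i) as (j & Ej). exists j.
      apply set_ext; intros x; unfold side. rewrite E, Ej. reflexivity.
    + apply presents_vert, HM.
    + apply (presents_vert M v (1 + i)) in HM as H'. simpl in H'. rewrite H'.
      replace (4 + S i)%nat with (5 + i)%nat by lia. apply vert_periodic, HM.
  - intros (i & ->). destruct (cell_pentagon N F) as (v & M & Hv & HM & E).
    destruct (cell_normals M N (proj1 HM) F E i) as (j & Ej).
    exists v, j. split; [exact Hv|]. rewrite (segment_side M _ _ j (proj1 HM)).
    + apply set_ext; intros x; unfold side. rewrite E, Ej. reflexivity.
    + apply presents_vert, HM.
    + apply (presents_vert M v (1 + j)) in HM as H'. simpl in H'. rewrite H'.
      replace (4 + S j)%nat with (5 + j)%nat by lia. apply vert_periodic, HM.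
Qed.

Lemma is_center_cell (N : nat -> vec) (c : H2) : frame N -> is_center (cell N) c <-> is_ctr N c.
Proof.
  intros F. destruct ctr_scale_spec as [Hc Hc2]. destruct sqrt_phi as [Hs Hq]. phi_facts. split.
  - intros (v & Hv & Hd). destruct (pentagon_frame _ _ Hv) as (M & HM & E).
    pose proof (proj1 HM) as G. unfold is_ctr. rewrite (cell_csum N M F G E).
    assert (Hw : forall i, mink c (vert M i) = mink c (vert M 0)).
    { intros i. destruct HM as (_ & Hm & _). rewrite <- (Hm i), <- (Hm 0%nat).
      apply (dH_inj c _ c _), Hd. }
    set (k := - mink c (vert M 0) / (sqrt phi * (2 + phi))).
    assert (Ec : coords c = vscale k (csum M)).
    { apply (nondegenerate (vert M 0) (vert M 1) (vert M 2)); [apply vert_independent, G|..];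
      rewrite mink_scale_l, (mink_sym (csum M)), vert_csum, ?(Hw 1%nat), ?(Hw 2%nat) by exact G;
      unfold k; field; split; lra. }
    rewrite Ec. f_equal.
    pose proof (coords_sheet c) as Sh. pose proof (coords_upper c) as Up. rewrite Ec in Sh, Up.
    autorewrite with mink in Sh. rewrite csum_csum in Sh by exact G. simpl vt in Up.
    pose proof (fr_future M G) as Fu. simpl in Up, Fu.
    assert (0 < k) by nra.
    assert ((k - ctr_scale) * ((k + ctr_scale) * (5 * (2 * phi - 1))) = 0) by nra.
    apply Rmult_integral in H0 as [|]; nra.
  - intros Hc'. destruct (cell_pentagon N F) as (v & M & Hv & HM & E).
    exists v. split; [exact Hv|]. intros i j. unfold dH, is_ctr in *.
    rewrite Hc', (cell_csum N M F (proj1 HM) (eq_sym E)), !mink_scale_l, !(mink_sym (csum M)).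
    rewrite !(presents_vert M v _ HM), !vert_csum by apply HM. reflexivity.
Qed.

Definition tile (T : (H2 -> Prop) -> Prop) (N : nat -> vec) : Prop := frame N /\ T (cell N).

Section Tiling.
Variable T : (H2 -> Prop) -> Prop.
Hypothesis HT : pentagon_tiling T.

Lemma tile_of (P : H2 -> Prop) : T P -> exists N, tile T N /\ P = cell N.
Proof.
  intros H. destruct (tiles_regular T HT P H) as (v & Hv).
  destruct (pentagon_frame _ _ Hv) as (N & HN & E). exists N.
  split; [split; [apply HN|rewrite <- E; exact H]|exact E].
Qed.

Lemma tile_shift (N : nat -> vec) (k : nat) : tile T N -> tile T (shift k N).
Proof.
  intros [F H]. split; [apply frame_shift, F|].
  replace (cell (shift k N)) with (cell N); trivial.
  apply set_ext; intros x; symmetry; apply cell_shift, F.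
Qed.

Lemma tile_rev (N : nat -> vec) : tile T N -> tile T (rev_frame N).
Proof.
  intros [F H]. split; [apply frame_rev, F|].
  replace (cell (rev_frame N)) with (cell N); trivial.
  apply set_ext; intros x; symmetry; apply cell_rev, F.
Qed.

(** Each alternative of [edge_to_edge] for distinct tiles leaves only boundary points in common.
    Most identifications of tiles below produce a common interior point and apply this. *)
Lemma tile_overlap (N M : nat -> vec) (x : H2) : tile T N -> tile T M ->
  (forall i, 0 < mink x (N i)) -> (forall i, 0 < mink x (M i)) -> cell N = cell M.
Proof.
  intros [F HN] [G HM] Hx Hy. apply NNPP; intros E.
  assert (Cx : cell N x) by (intros i; apply Rlt_le, Hx).
  assert (Cy : cell M x) by (intros i; apply Rlt_le, Hy).
  destruct (tiles_edge_to_edge T HT _ _ HN HM E) as [H|[(p & Hp & _ & H)|(s & Hs & _ & H)]].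
  - exact (H x (conj Cx Cy)).
  - assert (x = p) by (apply H; split; trivial). subst p.
    apply is_vertex_cell in Hp as (i & Hi); trivial. pose proof (Hx i) as P.
    rewrite Hi, (proj1 (vert_normal N i F)) in P. lra.
  - apply is_side_cell in Hs as (i & ->); trivial.
    assert (S : side N i x) by (apply H; split; trivial).
    pose proof (Hx i). destruct S as [_ S]. lra.
Qed.

End Tiling.

(** * Neighbours of a tile *)

Definition coef_sum (a : nat -> R) : R := a 0%nat + (a 1%nat + (a 2%nat + (a 3%nat + a 4%nat))).

(** Points of the sheet pair to at most -1, so each of them pairs with [x] to at most minus the
    coefficient sum; sum once more over the coefficients. *)
Lemma cone_bound (w : nat -> H2) (a : nat -> R) (x : vec) : (forall i, 0 <= a i) ->
  x = vsum a w -> mink x x <= - (coef_sum a * coef_sum a).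
Proof.
  intros Ha E.
  assert (H : forall i, mink x (w i) <= - coef_sum a).
  { intros i. rewrite E. unfold vsum, coef_sum; autorewrite with mink.
    assert (Q : forall k, a k * mink (w k) (w i) <= - a k)
      by (intros k; pose proof (Ha k); pose proof (H2_pairing (w k) (w i)); nra).
    pose proof (Q 0%nat). pose proof (Q 1%nat). pose proof (Q 2%nat). pose proof (Q 3%nat). pose proof (Q 4%nat). lra. }
  assert (P : forall k, a k * mink x (w k) <= - (a k * coef_sum a))
    by (intros k; pose proof (Ha k); pose proof (H k); nra).
  rewrite E at 2. unfold vsum; autorewrite with mink.
  pose proof (P 0%nat). pose proof (P 1%nat). pose proof (P 2%nat). pose proof (P 3%nat). pose proof (P 4%nat).
  unfold coef_sum in *. lra.
Qed.

(** The open cone over a tile is timelike, so interior points may be given by vectors of any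
    length. *)
Lemma interior_point (N : nat -> vec) (x : vec) : frame N -> (forall i, 0 < mink x (N i)) ->
  exists (p : H2) (k : R), 0 < k /\ coords p = vscale k x.
Proof.
  intros F H.
  destruct (cone_of_normals N x F (fun i => Rlt_le _ _ (H i))) as (a & Ha & E).
  pose proof (cone_bound (vertH N F) a x Ha E) as B.
  assert (S : 0 < coef_sum a).
  { unfold coef_sum. pose proof (Ha 0%nat). pose proof (Ha 1%nat). pose proof (Ha 2%nat).
    pose proof (Ha 3%nat). pose proof (Ha 4%nat).
    destruct (Rlt_le_dec 0 (a 0%nat + (a 1%nat + (a 2%nat + (a 3%nat + a 4%nat))))) as [|L]; trivial.
    exfalso. pose proof (H 0%nat) as P. rewrite E in P. unfold vsum in P.
    replace (a 0%nat) with 0 in P by lra. replace (a 1%nat) with 0 in P by lra.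
    replace (a 2%nat) with 0 in P by lra. replace (a 3%nat) with 0 in P by lra.
    replace (a 4%nat) with 0 in P by lra. autorewrite with mink in P. lra. }
  apply normalize; [nra|].
  apply (future_of_pairing (csum N)); [apply csum_timelike, F|apply (fr_future N F)|nra|].
  rewrite mink_sym, E. unfold vsum; autorewrite with mink. rewrite !(vert_csum N) by exact F.
  destruct sqrt_phi. phi_facts. unfold coef_sum in S.
  assert (0 < sqrt phi * (2 + phi)) by nra. nra.
Qed.

Lemma small_factor (l : list R) : exists e, 0 < e /\ forall c, In c l -> - 1 < e * c.
Proof.
  induction l as [|c l (e & He & H)]; [exists 1; split; [lra|intros c []]|].
  (* Dividing shrinks [e], which keeps the earlier bounds, and makes its product with the absolute
     value of [c] less than 1. *)
  exists (e / (1 + e * Rabs c)). pose proof (Rabs_pos c).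
  assert (0 < 1 + e * Rabs c) by nra. split; [apply Rdiv_lt_0_compat; lra|].
  assert (Q : e / (1 + e * Rabs c) <= e).
  { apply (Rmult_le_reg_r (1 + e * Rabs c)); trivial. unfold Rdiv. rewrite Rmult_assoc, Rinv_l by lra. nra. }
  assert (P : 0 < e / (1 + e * Rabs c)) by (apply Rdiv_lt_0_compat; lra).
  intros d [->|Hd].
  - assert (e / (1 + e * Rabs d) * Rabs d < 1).
    { apply (Rmult_lt_reg_r (1 + e * Rabs d)); trivial. unfold Rdiv.
      replace (e * / (1 + e * Rabs d) * Rabs d * (1 + e * Rabs d)) with (e * Rabs d) by (field; lra). lra. }
    assert (- Rabs d <= d) by (unfold Rabs; destruct Rcase_abs; lra). nra.
  - specialize (H d Hd). destruct (Rle_lt_dec 0 d); nra.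
Qed.

(** [N 0] and [N 1] are an orthonormal basis of the tangent plane at their corner. *)
Lemma corner_plane (N : nat -> vec) (u : vec) : frame N -> mink u (vert N 0) = 0 ->
  u = vadd (vscale (mink u (N 0%nat)) (N 0%nat)) (vscale (mink u (N 1%nat)) (N 1%nat)).
Proof.
  intros F H. phi_facts. destruct sqrt_phi as [Hs Hq].
  pose proof (pair_rec N u F 0) as X3. cbn [Nat.add] in *.
  unfold vert in H; cbn [Nat.add] in H; autorewrite with mink in H.
  assert (Is : / sqrt phi <> 0) by (apply Rinv_neq_0_compat; lra).
  assert (Z : mink u (N 0%nat) + (mink u (N 1%nat) + (phi - 1) * mink u (N 3%nat)) = 0)
    by (apply (Rmult_eq_reg_l (- / sqrt phi)); lra).
  assert (E2 : mink u (N 2%nat) + phi * mink u (N 0%nat) = 0)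
    by (rewrite <- Z, X3; ring [Hphi2]).
  destruct (fr_products N F) as (A00&A01&A02&A03&A04&A11&A12&_).
  apply (frame_ext N); trivial; autorewrite with mink; rewrite ?(mink_sym (N 1%nat) (N 0%nat)), ?A00, ?A01, ?A02, ?A11, ?A12; lra.
Qed.

Lemma corner_mink (N : nat -> vec) (u w : vec) : frame N -> mink u (vert N 0) = 0 ->
  mink u w = mink u (N 0%nat) * mink w (N 0%nat) + mink u (N 1%nat) * mink w (N 1%nat).
Proof.
  intros F H. rewrite (corner_plane N u F H) at 1. autorewrite with mink.
  rewrite (mink_sym w), (mink_sym w). ring.
Qed.

(** The direction from corner 0 into the tile, of squared length 2. It ignores the order of the two
    sides, so it serves to compare unlabelled tiles at a corner. *)
Definition bisector (N : nat -> vec) : vec := vadd (N 0%nat) (N 1%nat).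

Lemma bisector_facts (N : nat -> vec) : frame N ->
  mink (bisector N) (N 0%nat) = 1 /\ mink (bisector N) (N 1%nat) = 1 /\
  mink (bisector N) (bisector N) = 2 /\ mink (bisector N) (vert N 0) = 0.
Proof.
  intros F. destruct (fr_products N F) as (A00&A01&A02&A03&A04&A11&A12&_).
  destruct (vert_normal N 0 F) as (V0&V1&_). cbn [Nat.add] in V1.
  unfold bisector; autorewrite with mink.
  rewrite (mink_sym (N 1%nat) (N 0%nat)), (mink_sym (N 0%nat) (vert N 0)), (mink_sym (N 1%nat) (vert N 0)), A00, A01, A11, V0, V1.
  repeat split; ring.
Qed.

(** In the basis [N 0], [N 1] the bisector is (1, 1); a vector (s, t) with s^2 + t^2 = 2 and s + t >
    0 has both coordinates above -1. Hence two bisectors at an acute angle add up to a direction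
    pointing into both tiles. *)
Lemma bisector_positive (N : nat -> vec) (u : vec) : frame N -> mink u (vert N 0) = 0 ->
  mink u u = 2 -> 0 < mink (bisector N) u -> - 1 < mink u (N 0%nat) /\ - 1 < mink u (N 1%nat).
Proof.
  intros F H Hu Hb. rewrite (corner_mink N u u F H) in Hu.
  assert (E : mink (bisector N) u = mink u (N 0%nat) + mink u (N 1%nat))
    by (unfold bisector; autorewrite with mink; rewrite !(mink_sym u); reflexivity).
  rewrite E in Hb. split; nra.
Qed.

Lemma frame_eq (N M : nat -> vec) : frame N -> frame M ->
  N 0%nat = M 0%nat -> N 1%nat = M 1%nat -> N 2%nat = M 2%nat -> forall i, N i = M i.
Proof.
  intros F G H0 H1 H2.
  assert (H : forall i, N i = M i /\ N (1 + i)%nat = M (1 + i)%nat /\ N (2 + i)%nat = M (2 + i)%nat).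
  { induction i as [|i (A & B & C)]; [repeat split; assumption|].
    change (1 + S i)%nat with (2 + i)%nat. change (2 + S i)%nat with (3 + i)%nat. change (S i) with (1 + i)%nat.
    repeat split; trivial. rewrite (fr_rec N F), (fr_rec M G), A, B, C. reflexivity. }
  intros i; apply H.
Qed.

Lemma vert_refl (n : vec) (N : nat -> vec) (i : nat) : vert (refl_frame n N) i = refl_vec n (vert N i).
Proof. unfold vert, refl_frame. rewrite refl_scale, !refl_add, refl_scale. reflexivity. Qed.

Lemma frame_of_corner (N M : nat -> vec) : frame N -> frame M -> vert N 0 = vert M 0 ->
  N 0%nat = M 0%nat -> N 1%nat = M 1%nat -> forall i, N i = M i.
Proof.
  intros F G Hv H0 H1. apply frame_eq; trivial.
  destruct sqrt_phi as [Hs Hq]. phi_facts.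
  unfold vert in Hv; cbn [Nat.add] in Hv.
  apply vscale_inj in Hv; [|apply Ropp_neq_0_compat, Rinv_neq_0_compat; lra].
  pose proof (fr_rec N F 0) as RN. pose proof (fr_rec M G 0) as RM. cbn [Nat.add] in *.
  rewrite RN, RM, H0, H1 in Hv. unfold vsub in Hv.
  apply (f_equal (fun u => vsub u (vadd (M 0%nat) (vadd (M 1%nat) (vscale (phi - 1) (vadd (vscale phi (vscale (-1) (M 1%nat))) (M 0%nat))))))) in Hv.
  match type of Hv with ?l = ?r =>
   assert (L : l = vscale (phi * (phi - 1)) (N 2%nat)) by (unfold vsub; vec_ring);
   assert (R : r = vscale (phi * (phi - 1)) (M 2%nat)) by (unfold vsub; vec_ring) end.
  rewrite L, R in Hv. apply vscale_inj in Hv; [trivial|nra].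
Qed.

(** Three further vectors of the length of (1, 1), pairwise and with it at least a right angle
    apart, must be its quarter turns. The substitution turns the plane by 45 degrees, putting (1, 1)
    at (1, 0) and the vector sought at (0, 1). *)
Lemma quarter_turn (x1 y1 x2 y2 x3 y3 : R) :
  x1*x1+y1*y1 = 2 -> x2*x2+y2*y2 = 2 -> x3*x3+y3*y3 = 2 ->
  x1 + y1 <= 0 -> x2 + y2 <= 0 -> x3 + y3 <= 0 ->
  x1*x2+y1*y2 <= 0 -> x1*x3+y1*y3 <= 0 -> x2*x3+y2*y3 <= 0 ->
  (x1 = -1 /\ y1 = 1) \/ (x2 = -1 /\ y2 = 1) \/ (x3 = -1 /\ y3 = 1).
Proof.
  intros N1 N2 N3 P1 P2 P3 Q12 Q13 Q23.
  set (X1 := (x1+y1)/2). set (Y1 := (y1-x1)/2). set (X2 := (x2+y2)/2). set (Y2 := (y2-x2)/2).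
  set (X3 := (x3+y3)/2). set (Y3 := (y3-x3)/2).
  replace x1 with (X1-Y1) in * by (unfold X1, Y1; lra). replace y1 with (X1+Y1) in * by (unfold X1, Y1; lra).
  replace x2 with (X2-Y2) in * by (unfold X2, Y2; lra). replace y2 with (X2+Y2) in * by (unfold X2, Y2; lra).
  replace x3 with (X3-Y3) in * by (unfold X3, Y3; lra). replace y3 with (X3+Y3) in * by (unfold X3, Y3; lra).
  clearbody X1 Y1 X2 Y2 X3 Y3.
  assert (E1 : X1*X1+Y1*Y1 = 1) by lra. assert (E2 : X2*X2+Y2*Y2 = 1) by lra. assert (E3 : X3*X3+Y3*Y3 = 1) by lra.
  assert (M12 : X1*X2+Y1*Y2 <= 0) by lra. assert (M13 : X1*X3+Y1*Y3 <= 0) by lra. assert (M23 : X2*X3+Y2*Y3 <= 0) by lra.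
  assert (L1 : X1 <= 0) by lra. assert (L2 : X2 <= 0) by lra. assert (L3 : X3 <= 0) by lra.
  clear P1 P2 P3 Q12 Q13 Q23 N1 N2 N3.
  (* If one of the unit vectors is (-1, 0), the other two are (0, 1) and (0, -1). *)
  assert (K : forall a b c d, a*a+b*b = 1 -> c*c+d*d = 1 -> a <= 0 -> c <= 0 ->
     a*c+b*d <= 0 -> 0 <= a -> 0 <= c -> (a = 0 /\ b = 1) \/ (c = 0 /\ d = 1)).
  { intros a b c d Ea Ec La Lc Lac Ga Gc. assert (a = 0) by lra. assert (c = 0) by lra. subst.
    destruct (Rlt_le_dec 0 b).
    - left; split; trivial. apply square_one; lra.
    - right; split; trivial. apply square_one; [|lra].
      assert (- b = 1) by (apply square_one; lra). nra. }
  assert (J : forall a b c d, a*a+b*b = 1 -> a <= 0 -> b = 0 -> a*c+b*d <= 0 -> 0 <= c).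
  { intros a b c d Ea La Eb H. subst b. assert (-a = 1) by (apply square_one; lra). nra. }
  assert (Z : Y1 = 0 \/ Y2 = 0 \/ Y3 = 0).
  { destruct (Req_dec Y1 0); [tauto|]. destruct (Req_dec Y2 0); [tauto|]. destruct (Req_dec Y3 0); [tauto|].
    exfalso. assert (0 <= X1*X2) by nra. assert (0 <= X1*X3) by nra. assert (0 <= X2*X3) by nra.
    destruct (Rdichotomy _ _ H), (Rdichotomy _ _ H0), (Rdichotomy _ _ H1); nra. }
  destruct Z as [Z|[Z|Z]].
  - pose proof (J _ _ _ _ E1 L1 Z M12). pose proof (J _ _ _ _ E1 L1 Z M13).
    destruct (K X2 Y2 X3 Y3) as [[]|[]]; trivial; [right; left|right; right]; split; lra.
  - pose proof (J X2 Y2 X1 Y1 E2 L2 Z ltac:(lra)). pose proof (J _ _ _ _ E2 L2 Z M23).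
    destruct (K X1 Y1 X3 Y3) as [[]|[]]; trivial; [left|right; right]; split; lra.
  - pose proof (J X3 Y3 X1 Y1 E3 L3 Z ltac:(lra)). pose proof (J X3 Y3 X2 Y2 E3 L3 Z ltac:(lra)).
    destruct (K X1 Y1 X2 Y2) as [[]|[]]; trivial; [left|right; left]; split; lra.
Qed.

Section Tiling.
Variable T : (H2 -> Prop) -> Prop.
Hypothesis HT : pentagon_tiling T.

Lemma overlap_vec (N M : nat -> vec) (x : vec) : tile T N -> tile T M ->
  (forall i, 0 < mink x (N i)) -> (forall i, 0 < mink x (M i)) -> cell N = cell M.
Proof.
  intros HN HM Hx Hy. destruct (interior_point N x (proj1 HN) Hx) as (p & k & Hk & E).
  apply (tile_overlap T HT N M p HN HM); intros i; rewrite E, mink_scale_l;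
  apply Rmult_lt_0_compat; trivial.
Qed.

(** At an acute angle, a point slightly away from the corner in the direction of the sum of the
    bisectors would be interior to both tiles. *)
Lemma corner_disjoint (N M : nat -> vec) : tile T N -> tile T M -> vert N 0 = vert M 0 ->
  cell N <> cell M -> mink (bisector N) (bisector M) <= 0.
Proof.
  intros HN HM Hv Hne. destruct HN as [F TN]. destruct HM as [G TM].
  destruct (Rle_lt_dec (mink (bisector N) (bisector M)) 0) as [|Hp]; trivial.
  exfalso; apply Hne.
  destruct (bisector_facts N F) as (B0&B1&BB&BV). destruct (bisector_facts M G) as (C0&C1&CC&CV).
  destruct (bisector_positive N (bisector M) F) as [P0 P1]; [rewrite Hv; exact CV|exact CC|exact Hp|].
  destruct (bisector_positive M (bisector N) G) as [Q0 Q1]; [rewrite <- Hv; exact BV|exact BB|rewrite mink_sym; exact Hp|].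
  set (w := vadd (bisector N) (bisector M)).
  destruct (small_factor [mink w (N 2%nat); mink w (N 3%nat); mink w (N 4%nat);
     mink w (M 2%nat); mink w (M 3%nat); mink w (M 4%nat)]) as (e & He & Hl).
  destruct (vert_normal N 0 F) as (V0&V1&V2&V3&V4). destruct (vert_normal M 0 G) as (W0&W1&W2&W3&W4).
  cbn [Nat.add] in *. destruct sqrt_phi as [Hs Hq]. phi_facts.
  assert (Ht : 1 < sqrt phi) by nra.
  assert (Hw : 0 < e * mink w (N 0%nat) /\ 0 < e * mink w (N 1%nat) /\ 0 < e * mink w (M 0%nat) /\ 0 < e * mink w (M 1%nat)).
  { unfold w; autorewrite with mink. repeat split; apply Rmult_lt_0_compat; lra. }
  apply (overlap_vec N M (vadd (vert N 0) (vscale e w))); try (split; assumption).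
  - apply (frame_all N (fun n => 0 < mink (vadd (vert N 0) (vscale e w)) n) F); autorewrite with mink;
    rewrite ?V0, ?V1, ?V2, ?V3, ?V4; try lra;
    match goal with |- context [mink w ?n] => assert (-1 < e * mink w n) by (apply Hl; simpl; tauto) end; nra.
  - rewrite Hv. apply (frame_all M (fun n => 0 < mink (vadd (vert M 0) (vscale e w)) n) G); autorewrite with mink;
    rewrite ?W0, ?W1, ?W2, ?W3, ?W4; try lra;
    match goal with |- context [mink w ?n] => assert (-1 < e * mink w n) by (apply Hl; simpl; tauto) end; nra.
Qed.

Lemma tile_at_corner (Q : H2 -> Prop) (N : nat -> vec) (p : H2) : T Q -> is_vertex Q p ->
  coords p = vert N 0 -> exists M, tile T M /\ Q = cell M /\ vert N 0 = vert M 0.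
Proof.
  intros HQ Hp E. destruct (tile_of T HT Q HQ) as (M & HM & ->).
  apply is_vertex_cell in Hp as (i & Hi); [|apply HM].
  exists (shift i M). split; [apply tile_shift, HM|].
  split; [apply set_ext; intros x; symmetry; apply cell_shift, HM|].
  rewrite vert_shift, <- E. exact Hi.
Qed.

(** Two orthonormal vectors with sum (-1, 1) are (-1, 0) and (0, 1) in some order. In this order [M]
    is the reflected frame; in the other order the reversal of [shift 1 M] is. *)
Lemma refl_corner (N M : nat -> vec) : frame N -> tile T M -> vert N 0 = vert M 0 ->
  mink (bisector M) (N 0%nat) = -1 -> mink (bisector M) (N 1%nat) = 1 ->
  T (cell (refl_frame (N 0%nat) N)).
Proof.
  intros F HM Hv H0 H1.
  assert (Key : forall M, tile T M -> vert N 0 = vert M 0 -> M 0%nat = vscale (-1) (N 0%nat) -> M 1%nat = N 1%nat ->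
     T (cell (refl_frame (N 0%nat) N))).
  { clear M HM Hv H0 H1. intros M [G TM] Hv E0 E1.
    replace (cell (refl_frame (N 0%nat) N)) with (cell M); trivial.
    destruct (fr_products N F) as (A00&A01&_). destruct (vert_normal N 0 F) as (V0&_).
    assert (E : forall i, M i = refl_frame (N 0%nat) N i).
    { apply frame_of_corner; trivial.
      - apply frame_refl; trivial.
      - rewrite <- Hv, vert_refl. symmetry; apply refl_fix, V0.
      - rewrite E0. unfold refl_frame, refl_vec. rewrite A00. vec_ring.
      - rewrite E1. symmetry; apply refl_fix. rewrite mink_sym; exact A01. }
    apply set_ext; intros x; unfold cell; split; intros Hx i; [rewrite <- E|rewrite E]; apply Hx. }
  destruct HM as [G TM]. destruct (bisector_facts M G) as (B0&B1&_&_).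
  destruct (vert_normal M 0 G) as (V0&V1&_). cbn [Nat.add] in V1.
  assert (P0 : mink (M 0%nat) (vert N 0) = 0) by (rewrite Hv, mink_sym; exact V0).
  assert (P1 : mink (M 1%nat) (vert N 0) = 0) by (rewrite Hv, mink_sym; exact V1).
  pose proof (corner_mink N (M 0%nat) (M 0%nat) F P0) as U0.
  rewrite (fr_unit M G) in U0.
  unfold bisector in H0, H1; autorewrite with mink in H0, H1.
  pose proof (corner_mink N (M 0%nat) (M 1%nat) F P0) as U1.
  destruct (fr_products M G) as (C00&C01&_). rewrite C01 in U1.
  pose proof (corner_plane N (M 0%nat) F P0) as L0. pose proof (corner_plane N (M 1%nat) F P1) as L1.
  set (a := mink (M 0%nat) (N 0%nat)) in *. set (b := mink (M 0%nat) (N 1%nat)) in *.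
  set (c := mink (M 1%nat) (N 0%nat)) in *. set (d := mink (M 1%nat) (N 1%nat)) in *.
  assert (Ec : c = -1 - a) by lra. assert (Ed : d = 1 - b) by lra.
  assert (Eb : b = 1 + a) by (rewrite Ec, Ed in U1; lra).
  assert (Z : a * (a + 1) = 0) by (rewrite Eb in U0; lra).
  apply Rmult_integral in Z as [Z|Z].
  - apply (Key (rev_frame (shift 1 M))).
    + apply tile_rev, tile_shift. split; assumption.
    + rewrite vert_rev by (apply frame_shift, G). rewrite vert_shift, Hv. cbn [Nat.add Nat.mul].
      symmetry; apply (vert_periodic M 0 G).
    + unfold rev_frame, shift. cbn [Nat.add Nat.mul]. rewrite L1, Ec, Ed, Eb, Z. vec_ring.
    + unfold rev_frame, shift. cbn [Nat.add Nat.mul]. rewrite (fr_periodic M G 0 : M 5%nat = _), L0, Eb, Z. vec_ring.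
  - apply (Key M); try split; trivial.
    + rewrite L0, Eb. replace a with (-1) by lra. vec_ring.
    + rewrite L1, Ec, Ed, Eb. replace a with (-1) by lra. vec_ring.
Qed.

(** The three other tiles at corner 0 have bisectors as in [quarter_turn]; the one with coordinates
    (-1, 1) is the mirror image of the bisector of [N] in side 0. *)
Lemma tile_refl0 (N : nat -> vec) : tile T N -> tile T (refl_frame (N 0%nat) N).
Proof.
  intros HN. assert (F := proj1 HN). assert (TN := proj2 HN).
  split; [apply frame_refl; [apply (fr_unit N F)|exact F]|].
  set (p := vertH N F 0).
  assert (Vp : is_vertex (cell N) p) by (apply is_vertex_cell; [exact F|exists 0%nat; reflexivity]).
  destruct (four_at_vertex T HT _ p TN Vp) as (l & Hd & Hlen & Hl).
  assert (In0 : In (cell N) l) by (apply Hl; split; assumption).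
  apply in_split in In0 as (l1 & l2 & ->).
  assert (Hd' : NoDup (cell N :: (l1 ++ l2))).
  { destruct (NoDup_remove _ _ _ Hd). constructor; assumption. }
  assert (Hlen' : length (l1 ++ l2) = 3%nat) by (rewrite length_app in *; simpl in Hlen; lia).
  assert (Hl' : forall Q, In Q (l1 ++ l2) -> T Q /\ is_vertex Q p).
  { intros Q HQ. apply Hl. apply in_app_iff in HQ. apply in_app_iff. simpl; tauto. }
  destruct (l1 ++ l2) as [|Q1 [|Q2 [|Q3 [|]]]]; try discriminate.
  destruct (Hl' Q1 ltac:(simpl; tauto)) as [T1 W1]. destruct (Hl' Q2 ltac:(simpl; tauto)) as [T2 W2].
  destruct (Hl' Q3 ltac:(simpl; tauto)) as [T3 W3].
  destruct (tile_at_corner Q1 N p T1 W1 eq_refl) as (M1 & HM1 & -> & V1).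
  destruct (tile_at_corner Q2 N p T2 W2 eq_refl) as (M2 & HM2 & -> & V2).
  destruct (tile_at_corner Q3 N p T3 W3 eq_refl) as (M3 & HM3 & -> & V3).
  inversion_clear Hd' as [|? ? N0 D1]. inversion_clear D1 as [|? ? N1 D2]. inversion_clear D2 as [|? ? N2 D3].
  simpl in N0, N1, N2.
  assert (Co : forall M, tile T M -> vert N 0 = vert M 0 ->
     mink (bisector M) (N 0%nat) * mink (bisector M) (N 0%nat) + mink (bisector M) (N 1%nat) * mink (bisector M) (N 1%nat) = 2 /\
     (cell N <> cell M -> mink (bisector M) (N 0%nat) + mink (bisector M) (N 1%nat) <= 0)).
  { intros M HM HV. destruct (bisector_facts M (proj1 HM)) as (_&_&BB&BV). rewrite <- HV in BV. split.
    - rewrite <- BB. symmetry. apply (corner_mink N _ _ F BV).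
    - intros Hne. pose proof (corner_disjoint N M HN HM HV Hne) as Q.
      unfold bisector at 1 in Q; autorewrite with mink in Q.
      rewrite (mink_sym (N 0%nat)), (mink_sym (N 1%nat)) in Q. exact Q. }
  assert (Cp : forall M M', tile T M -> tile T M' -> vert N 0 = vert M 0 -> vert N 0 = vert M' 0 -> cell M <> cell M' ->
     mink (bisector M) (N 0%nat) * mink (bisector M') (N 0%nat) + mink (bisector M) (N 1%nat) * mink (bisector M') (N 1%nat) <= 0).
  { intros M M' HM HM' HV HV' Hne. destruct (bisector_facts M (proj1 HM)) as (_&_&_&BV). rewrite <- HV in BV.
    rewrite <- (corner_mink N _ _ F BV). apply corner_disjoint; trivial. congruence. }
  destruct (Co M1 HM1 V1) as [S1 L1]. destruct (Co M2 HM2 V2) as [S2 L2]. destruct (Co M3 HM3 V3) as [S3 L3].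
  destruct (quarter_turn _ _ _ _ _ _ S1 S2 S3 (L1 ltac:(intuition congruence)) (L2 ltac:(intuition congruence))
     (L3 ltac:(intuition congruence))
     (Cp M1 M2 HM1 HM2 V1 V2 ltac:(intuition congruence)) (Cp M1 M3 HM1 HM3 V1 V3 ltac:(intuition congruence))
     (Cp M2 M3 HM2 HM3 V2 V3 ltac:(intuition congruence))) as [[E E']|[[E E']|[E E']]].
  - apply (refl_corner N M1); trivial.
  - apply (refl_corner N M2); trivial.
  - apply (refl_corner N M3); trivial.
Qed.

Lemma tile_refl (N : nat -> vec) (i : nat) : tile T N -> tile T (refl_frame (N i) N).
Proof.
  intros HN. pose proof (tile_refl0 _ (tile_shift T N i HN)) as [_ H].
  assert (G : frame (refl_frame (N i) N)) by (apply frame_refl; [apply (fr_unit N (proj1 HN))|apply HN]).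
  split; [exact G|].
  replace (cell (refl_frame (N i) N)) with (cell (refl_frame (shift i N 0%nat) (shift i N))); trivial.
  apply set_ext; intros x. apply (cell_shift _ i x G).
Qed.

End Tiling.

(** * Lines of the tiling *)

(** The orthogonal complement of a timelike vector is positive definite. *)
Lemma timelike_orthogonal (u e : vec) : mink u u < 0 -> mink u e = 0 -> mink e e <= 0 -> e = vzero.
Proof.
  destruct u as [a b c], e as [x y z]; unfold mink, vzero; simpl; intros Hu H He.
  assert (H1 : (a * x + b * y) * (a * x + b * y) <= (a*a+b*b) * (x*x+y*y))
      by (pose proof (Rle_0_sqr (a*y-b*x)) as Q; unfold Rsqr in Q; nra).
  assert (H2 : (a*a+b*b) * (x*x+y*y) <= (a*a+b*b) * (z*z)) by (apply Rmult_le_compat_l; nra).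
  replace (a * x + b * y) with (c * z) in H1 by lra.
  assert (Z : z = 0).
  { apply square_nonpos. assert (0 <= z*z) by nra. assert ((c*c-a*a-b*b)*(z*z) <= 0) by lra. nra. }
  subst z. assert (x = 0) by (apply square_nonpos; nra). assert (y = 0) by (apply square_nonpos; nra).
  subst; reflexivity.
Qed.

Lemma csum_pairing (N M : nat -> vec) : frame N -> frame M -> mink (csum N) (csum M) < 0.
Proof.
  intros F G. apply future_pairing; [apply csum_timelike, F|apply (fr_future N F)
   |apply Rlt_le, csum_timelike, G|apply (fr_future M G)].
Qed.

Inductive reach (N : nat -> vec) : (nat -> vec) -> Prop :=
| reach_here : reach N N
| reach_step M i : reach N M -> reach N (refl_frame (M i) M).

Lemma reach_trans_step (N M : nat -> vec) (i : nat) : reach (refl_frame (N i) N) M -> reach N M.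
Proof. induction 1 as [|M j _ IH]; [apply reach_step, reach_here|apply reach_step, IH]. Qed.

Lemma reach_frame (N M : nat -> vec) : frame N -> reach N M -> frame M.
Proof.
  intros F. induction 1 as [|M i _ IH]; trivial. apply frame_refl; [apply (fr_unit M IH)|exact IH].
Qed.

(** Facts are known for the tile where a descent ends; this carries them back to the tile where it
    started. *)
Lemma reach_back (P : (nat -> vec) -> Prop) (N M : nat -> vec) : frame N ->
  (forall M i, frame M -> P (refl_frame (M i) M) -> P M) -> reach N M -> P M -> P N.
Proof.
  intros F H R. induction R as [|M i R IH]; trivial. intros HM. apply IH, (H M i); trivial.
  apply (reach_frame N); trivial.
Qed.

Definition s5 : R := 2 * phi - 1.

Lemma s5_spec : s5 * s5 = 5 /\ 2 < s5.
Proof. unfold s5. phi_facts. split; nra. Qed.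

Lemma csum_step (N : nat -> vec) (x : vec) (i : nat) : frame N ->
  mink x (csum (refl_frame (N i) N)) = mink x (csum N) - 2 * s5 * mink x (N i).
Proof.
  intros F. rewrite csum_refl. rewrite <- refl_swap, refl_mink_l, (mink_sym (N i)), (csum_normal N F i).
  unfold s5. ring.
Qed.

(* [a + b phi] with [a] odd and [b] even: such an element of Z[phi] has odd norm. *)
Definition odd_element (x : R) : Prop :=
  exists a b : Z, x = s5 * (IZR (2 * a + 1) + IZR (2 * b) * phi).

Lemma odd_element_neq0 (x : R) : odd_element x -> x <> 0.
Proof.
  intros (a & b & ->) E. destruct s5_spec as [_ Hs]. apply Rmult_integral in E as [E|E]; [lra|].
  (* The norm of p + q phi is p^2 + p q - q^2, an odd integer when p is odd and q even. *)
  set (p := (2 * a + 1)%Z) in *. set (q := (2 * b)%Z) in *.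
  assert (Z : IZR (p * p + p * q - q * q) = 0).
  { rewrite minus_IZR, plus_IZR, !mult_IZR. pose proof phi2 as Hphi2.
    transitivity ((IZR p + IZR q * phi) * (IZR p + IZR q - IZR q * phi)); [ring [Hphi2]|rewrite E; ring]. }
  apply eq_IZR in Z. unfold p, q in Z. lia.
Qed.

(** Up to sign, a reflection changes a pairing by 2, 0 or 2 phi times another one, which preserves
    both parities. *)
Lemma odd_back (x : vec) (M : nat -> vec) (i : nat) : frame M ->
  (forall j, odd_element (mink x (refl_frame (M i) M j))) -> forall j, odd_element (mink x (M j)).
Proof.
  intros F H j.
  assert (E : mink x (M j) = mink x (refl_frame (M i) M j) - 2 * mink (M j) (M i) * mink x (refl_frame (M i) M i)).
  { unfold refl_frame. rewrite <- !refl_swap, !refl_mink_l, (fr_unit M F), (mink_sym (M j)). ring. }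
  destruct (H j) as (a & b & Ea). destruct (H i) as (c & d & Ec). rewrite E, Ea, Ec.
  destruct (shift_cases M F i j) as (k & Hk & ->).
  assert (K : mink (M (k + i)%nat) (M i) = 1 \/ mink (M (k + i)%nat) (M i) = 0 \/ mink (M (k + i)%nat) (M i) = - phi).
  { rewrite mink_sym.
    destruct k as [|[|[|[|[|k]]]]]; try lia; [left; apply (fr_unit M F)|right; left; apply (fr_orth M F)
     |right; right; apply (fr_ultra M F)|right; right; apply (fr_d3 M F)|right; left; apply (fr_d4 M F)]. }
  pose proof phi2 as Hphi2. clear - K Hphi2.
  destruct K as [-> | [-> | ->]].
  - exists (a - (2 * c + 1))%Z, (b - 2 * d)%Z.
    rewrite !plus_IZR, !mult_IZR, !minus_IZR, !plus_IZR, !mult_IZR. ring.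
  - exists a, b. ring.
  - exists (a + 2 * d)%Z, (b + (2 * c + 1) + 2 * d)%Z.
    rewrite !plus_IZR, !mult_IZR, !plus_IZR, !mult_IZR. ring [Hphi2].
Qed.

Lemma refl_conj (n m x : vec) : mink n n = 1 ->
  refl_vec (refl_vec n m) (refl_vec n x) = refl_vec n (refl_vec m x).
Proof.
  intros Hn. unfold refl_vec at 1. rewrite refl_mink by exact Hn.
  unfold refl_vec at 4. rewrite refl_add, refl_scale. reflexivity.
Qed.

Lemma refl_root (m x : vec) : mink m m = 1 -> refl_vec (refl_vec m m) x = refl_vec m x.
Proof.
  intros Hm. replace (refl_vec m m) with (vscale (-1) m) by (unfold refl_vec; rewrite Hm; vec_ring).
  unfold refl_vec; autorewrite with mink. vec_ring.
Qed.

Section Tiling.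
Variable T : (H2 -> Prop) -> Prop.
Hypothesis HT : pentagon_tiling T.

Definition height (B Q : nat -> vec) : R := - mink (csum B) (csum Q).

Lemma height_pos (B Q : nat -> vec) : frame B -> frame Q -> 0 < height B Q.
Proof. intros F G. unfold height. pose proof (csum_pairing B Q F G). lra. Qed.

Lemma height_step (B Q : nat -> vec) (i : nat) : frame Q ->
  height B (refl_frame (Q i) Q) = height B Q + 2 * s5 * mink (csum B) (Q i).
Proof. intros G. unfold height. rewrite csum_step by exact G. ring. Qed.

(* Moving the center of [B] slightly towards the center of [Q] keeps it inside [B];
   if it lies only slightly outside the sides of [Q], the two cells overlap. *)
Lemma separated_side (B Q : nat -> vec) (H : R) : tile T B -> tile T Q -> height B Q <= H ->
  cell Q <> cell B -> exists i, mink (csum B) (Q i) <= - (s5 * s5 * s5 / H).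
Proof.
  intros HB HQ HH Hne. pose proof (height_pos B Q (proj1 HB) (proj1 HQ)) as Hp.
  destruct s5_spec as [Hs2 Hs].
  apply NNPP; intros Hn. apply Hne.
  assert (Hn' : forall i, - (s5 * s5 * s5 / H) < mink (csum B) (Q i)).
  { intros i. destruct (Rlt_le_dec (- (s5 * s5 * s5 / H)) (mink (csum B) (Q i))) as [|L]; trivial.
    exfalso; apply Hn; exists i; exact L. }
  symmetry. apply (overlap_vec T HT B Q (vadd (csum B) (vscale (s5 * s5 / H) (csum Q)))); trivial.
  - intros j. autorewrite with mink. rewrite (csum_normal B (proj1 HB)). fold s5.
    assert (L : - mink (csum Q) (B j) < height B Q / (2 * s5)).
    { pose proof (height_pos (refl_frame (B j) B) Q (frame_refl _ _ (fr_unit B (proj1 HB) j) (proj1 HB)) (proj1 HQ)) as P.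
      unfold height in P. rewrite mink_sym, csum_step in P by apply HB.
      apply (Rmult_lt_reg_r (2 * s5)); [lra|]. unfold Rdiv. rewrite Rmult_assoc, Rinv_l by lra.
      unfold height. rewrite (mink_sym (csum B)). lra. }
    assert (L2 : height B Q / (2 * s5) <= H / (2 * s5))
      by (apply Rmult_le_compat_r; [left; apply Rinv_0_lt_compat; lra|exact HH]).
    assert (E : s5 * s5 / H * (H / (2 * s5)) = s5 / 2) by (field; lra).
    assert (0 < s5 * s5 / H) by (apply Rdiv_lt_0_compat; nra). nra.
  - intros i. autorewrite with mink. rewrite (csum_normal Q (proj1 HQ)). fold s5.
    specialize (Hn' i). assert (s5 * s5 / H * s5 = s5 * s5 * s5 / H) by (field; lra). lra.
Qed.

(** Reflecting in a side given by [separated_side] lowers the height. The height never exceeds its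
    initial value [H], so each step gains at least the same [d], and positivity of heights ends the
    descent. *)
Lemma descend (B Q : nat -> vec) : tile T B -> tile T Q -> exists M, reach Q M /\ tile T M /\ cell M = cell B.
Proof.
  intros HB HQ. destruct s5_spec as [Hs2 Hs].
  set (H := height B Q). assert (HH : 0 < H) by (apply height_pos; [apply HB|apply HQ]).
  set (d := 2 * s5 * (s5 * s5 * s5 / H)).
  assert (Hd : 0 < d) by (unfold d; assert (0 < s5 * s5 * s5 / H) by (apply Rdiv_lt_0_compat; nra); nra).
  assert (Step : forall k Q, tile T Q -> height B Q <= H -> height B Q <= INR k * d ->
     exists M, reach Q M /\ tile T M /\ cell M = cell B).
  { induction k as [|k IH]; intros M HM L1 L2.
    - pose proof (height_pos B M (proj1 HB) (proj1 HM)). simpl in L2. lra.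
    - destruct (classic (cell M = cell B)) as [E|E].
      { exists M. split; [apply reach_here|split; assumption]. }
      destruct (separated_side B M H HB HM L1 E) as (i & Hi).
      rewrite S_INR in L2.
      assert (P : height B (refl_frame (M i) M) <= height B M - d)
        by (rewrite height_step by apply HM; unfold d; nra).
      destruct (IH (refl_frame (M i) M)) as (M' & R & HM' & E'); [apply tile_refl; trivial|lra|lra|].
      exists M'. split; [apply reach_trans_step with i, R|split; assumption]. }
  destruct (INR_unbounded (H / d)) as (k & Hk).
  apply (Step k); trivial; [apply Rle_refl|].
  fold H. replace H with (H / d * d) by (field; lra). apply Rmult_le_compat_r; lra.
Qed.

(** At the end of the descent the center is paired with a side of its own tile, which gives [s5]
    times 1; [odd_back] leads back to [Q]. *)
Lemma tile_odd (B Q : nat -> vec) (j : nat) : tile T B -> tile T Q -> odd_element (mink (csum B) (Q j)).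
Proof.
  intros HB HQ. destruct (descend B Q HB HQ) as (M & R & HM & E). revert j.
  apply (reach_back (fun M => forall j, odd_element (mink (csum B) (M j))) Q M); trivial.
  - apply HQ.
  - intros M' i F. apply odd_back, F.
  - intros j. rewrite (cell_csum B M (proj1 HB) (proj1 HM) (eq_sym E)), (csum_normal M (proj1 HM)).
    exists 0%Z, 0%Z. unfold s5. simpl. ring.
Qed.

Lemma cell_refl_frame (N M : nat -> vec) (n : vec) : frame N -> frame M -> mink n n = 1 ->
  cell N = cell M -> cell (refl_frame n N) = cell (refl_frame n M).
Proof.
  intros F G Hn E. apply set_ext; intros x; unfold cell, refl_frame; split; intros H i.
  - destruct (cell_normals N M F G E i) as (j & ->). apply H.
  - destruct (cell_normals M N G F (eq_sym E) i) as (j & ->). apply H.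
Qed.

(** For [Q] equal to [N] this is [tile_refl]. Back along the descent: reflecting the image of a tile
    in the image of its side [k] gives the image of its neighbour across [k], by conjugation of
    reflections. *)
Lemma tiling_symmetric (N Q : nat -> vec) (i : nat) : tile T N -> tile T Q -> tile T (refl_frame (N i) Q).
Proof.
  intros HN HQ. assert (Hn : mink (N i) (N i) = 1) by apply (fr_unit N (proj1 HN)).
  destruct (descend N Q HN HQ) as (M & R & HM & E).
  assert (P : T (cell (refl_frame (N i) Q))).
  { apply (reach_back (fun M => T (cell (refl_frame (N i) M))) Q M); trivial.
    - apply HQ.
    - intros M' k F H.
      set (L := refl_frame (N i) (refl_frame (M' k) M')) in *.
      assert (HL : tile T L) by (split; [apply frame_refl, frame_refl, F; trivial; apply (fr_unit M' F)|exact H]).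
      destruct (tile_refl T HT L k HL) as [_ H'].
      replace (cell (refl_frame (N i) M')) with (cell (refl_frame (L k) L)); trivial.
      f_equal. apply FunctionalExtensionality.functional_extensionality; intros j.
      unfold L, refl_frame. rewrite refl_conj by exact Hn. f_equal. rewrite refl_root by apply (fr_unit M' F).
      apply refl_refl, (fr_unit M' F).
    - rewrite (cell_refl_frame M N) by (trivial; first [apply HM|apply HN]). apply tile_refl; trivial. }
  split; [apply frame_refl; [exact Hn|apply HQ]|exact P].
Qed.

(* A line of the tiling passes through no tile: reflecting [B] in it gives a tile
   overlapping [B] unless it passes through the center, which is excluded by parity. *)
Lemma wall_bound (B N : nat -> vec) (i : nat) : tile T B -> tile T N -> s5 <= Rabs (mink (csum B) (N i)).
Proof.
  intros HB HN. destruct (Rle_lt_dec s5 (Rabs (mink (csum B) (N i)))) as [|L]; trivial. exfalso.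
  set (u := mink (csum B) (N i)) in *. set (n := N i) in *.
  assert (Hn : mink n n = 1) by apply (fr_unit N (proj1 HN)).
  destruct s5_spec as [Hs2 Hs].
  assert (Hu : u <> 0) by (apply odd_element_neq0, tile_odd; trivial).
  assert (Lu : u * u < s5 * s5) by (unfold Rabs in L; destruct Rcase_abs in L; nra).
  (* The foot of the perpendicular from the center to the line. A line closer than the inradius has
     its foot inside the inscribed circle; the Gram inequality proves this for each side. *)
  set (x := vsub (csum B) (vscale u n)).
  assert (Hx : mink x n = 0) by (unfold x, vsub; autorewrite with mink; rewrite Hn; unfold u; ring).
  assert (Pos : forall j, 0 < mink x (B j)).
  { intros j. unfold x, vsub; autorewrite with mink. rewrite (csum_normal B (proj1 HB)). fold s5.
    set (m := mink n (B j)).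
    destruct (Rlt_le_dec (u * m) s5) as [|Lm]; [lra|]. exfalso.
    pose proof (gram3_nonpos (csum B) n (B j)) as G.
    rewrite (csum_csum B (proj1 HB)), (csum_normal B (proj1 HB)), Hn, (fr_unit B (proj1 HB)) in G.
    fold s5 in G. fold u m in G.
    assert (M1 : s5 * s5 <= (u * m) * (u * m)) by nra.
    assert (M2 : 1 < m * m) by (destruct (Rlt_le_dec 1 (m * m)); trivial; nra).
    nra. }
  assert (E : cell B = cell (refl_frame n B)).
  { apply (overlap_vec T HT _ _ x); trivial.
    - apply tiling_symmetric; trivial.
    - intros j. unfold refl_frame. rewrite <- refl_swap, refl_fix by exact Hx. apply Pos. }
  apply cell_csum in E; [|apply HB|apply frame_refl; [exact Hn|apply HB]].
  rewrite csum_refl in E. apply (f_equal (fun y => mink y n)) in E.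
  rewrite refl_mink_l in E. fold u in E. rewrite Hn in E. lra.
Qed.

(** Both centers are at least the inradius away from the line, and they are exactly twice the
    inradius apart. In formulas, the two bounds and the Gram inequality force a = s5 and b = 1; then
    [n - m] is null and orthogonal to a timelike vector. *)
Lemma wall_unique (N L : nat -> vec) (i k : nat) : tile T N -> tile T L ->
  0 < mink (csum N) (L k) -> mink (csum (refl_frame (N i) N)) (L k) < 0 -> L k = N i.
Proof.
  intros HN HL H1 H2. destruct s5_spec as [Hs2 Hs].
  pose proof (wall_bound N L k HN HL) as W1.
  pose proof (wall_bound _ L k (tile_refl T HT N i HN) HL) as W2.
  rewrite Rabs_right in W1 by lra. rewrite Rabs_left in W2 by lra.
  rewrite csum_refl, refl_mink_l, (csum_normal N (proj1 HN)) in W2. fold s5 in W2.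
  assert (Hm := fr_unit N (proj1 HN) i). assert (Hn := fr_unit L (proj1 HL) k).
  pose proof (gram3_nonpos (csum N) (L k) (N i)) as G.
  rewrite (csum_csum N (proj1 HN)), (csum_normal N (proj1 HN)), Hn, Hm in G. fold s5 in G.
  assert (C := csum_timelike N (proj1 HN)). assert (CN := csum_normal N (proj1 HN) i). fold s5 in CN.
  set (n := L k) in *. set (m := N i) in *. rewrite (mink_sym m n) in W2.
  set (a := mink (csum N) n) in *. set (b := mink n m) in *.
  assert (B1 : a + s5 <= 2 * s5 * b) by lra.
  assert (B2 : 1 <= b) by nra.
  assert (Q1 : a * (a + s5) <= a * (2 * s5 * b)) by (apply Rmult_le_compat_l; lra).
  assert (Q2 : 0 <= s5 * (b * b - 1)) by nra.
  assert (Ea : a = s5) by nra.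
  assert (Eb : b = 1) by nra.
  assert (Z : vsub n m = vzero).
  { apply (timelike_orthogonal (csum N)); trivial; unfold vsub; autorewrite with mink.
    - fold a. rewrite CN. lra.
    - rewrite (mink_sym m n). fold b. rewrite Hn, Hm, Eb. lra. }
  apply vec_ext; [apply (f_equal vx) in Z|apply (f_equal vy) in Z|apply (f_equal vt) in Z]; simpl in Z; lra.
Qed.

End Tiling.

(** * Local structure of the dual complex *)

Lemma frame_dot (N : nat -> vec) (i j : nat) : frame N ->
  N i = N j \/ (mink (N i) (N j) = 0 /\ forall p, mink p p = -1 -> 0 < vt p -> mink p (N i) = 0 -> mink p (N j) = 0 ->
     exists k, p = vert N k) \/ mink (N i) (N j) = - phi.
Proof.
  intros F. destruct (shift_cases N F i j) as (d & Hd & ->).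
  destruct d as [|[|[|[|[|d]]]]]; try lia.
  - left; reflexivity.
  - right; left. split; [apply (fr_orth N F)|]. intros p H1 H2 H3 H4. exists i. apply vert_unique; trivial.
  - right; right. apply (fr_ultra N F).
  - right; right. apply (fr_d3 N F).
  - right; left. split; [apply (fr_d4 N F)|]. intros p H1 H2 H3 H4. exists (4 + i)%nat. apply vert_unique; trivial.
    replace (1 + (4 + i))%nat with (5 + i)%nat by lia. rewrite (fr_periodic N F). exact H3.
Qed.

(** The sum of these normals is timelike, hence not orthogonal to a point: lines of non-adjacent
    sides do not meet. *)
Lemma ultra_sum_pos (p : H2) (n m : vec) : mink n n = 1 -> mink m m = 1 -> mink n m = - phi ->
  mink p n = 0 -> mink p m = 0 -> False.
Proof.
  intros Hn Hm Hnm H1 H2. phi_facts.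
  assert (Q : mink (vadd n m) (vadd n m) < 0) by (autorewrite with mink; rewrite (mink_sym m n), Hn, Hm, Hnm; lra).
  assert (E : vadd n m = vzero).
  { apply (timelike_orthogonal p); [apply H2_timelike| |lra]. autorewrite with mink. lra. }
  rewrite E in Q. autorewrite with mink in Q. lra.
Qed.

(** Another side meets side [j] in at most one corner, which cannot be both [p] and [q]; so the
    direction of [p + q] lies in the relative interior of the side. *)
Lemma side_interior (M : nat -> vec) (j : nat) (p q : H2) : frame M -> p <> q ->
  cell M p -> cell M q -> mink p (M j) = 0 -> mink q (M j) = 0 ->
  forall k, M k = M j \/ 0 < mink (vadd p q) (M k).
Proof.
  intros F Hne Hp Hq Pj Qj k.
  destruct (Rlt_le_dec 0 (mink (vadd p q) (M k))) as [|L]; [right; trivial|left].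
  autorewrite with mink in L. pose proof (Hp k). pose proof (Hq k).
  assert (Pk : mink p (M k) = 0) by lra. assert (Qk : mink q (M k) = 0) by lra.
  destruct (shift_cases M F j k) as (d & Hd & E). rewrite E in *.
  destruct d as [|[|[|[|[|d]]]]]; try lia; [reflexivity|..]; exfalso.
  - apply Hne, H2_ext. transitivity (vert M j); [|symmetry];
    apply vert_unique; trivial; first [apply coords_sheet|apply coords_upper].
  - apply (ultra_sum_pos p (M j) (M (2 + j)%nat)); trivial; first [apply (fr_unit M F)|apply (fr_ultra M F)].
  - apply (ultra_sum_pos p (M j) (M (3 + j)%nat)); trivial; first [apply (fr_unit M F)|apply (fr_d3 M F)].
  - apply Hne, H2_ext. assert (E5 : M (1 + (4 + j))%nat = M j)
      by (replace (1 + (4 + j))%nat with (5 + j)%nat by lia; apply (fr_periodic M F)).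
    transitivity (vert M (4 + j)); [|symmetry];
    apply vert_unique; trivial; first [apply coords_sheet|apply coords_upper|rewrite E5; trivial].
Qed.

Lemma normal_of_line (p q : H2) (n m : vec) : p <> q -> mink n n = 1 -> mink m m = 1 ->
  mink p n = 0 -> mink q n = 0 -> mink p m = 0 -> mink q m = 0 -> n = m \/ n = vscale (-1) m.
Proof.
  intros Hne Hn Hm Pn Qn Pm Qm.
  assert (D : det3 p q m <> 0).
  { intros E. pose proof (det3_gram p q m p q m) as G. rewrite E in G.
    rewrite (mink_sym q p), (mink_sym m p), (mink_sym m q), Pm, Qm, Hm, !coords_sheet in G.
    apply Hne, H2_pairing_eq. pose proof (H2_pairing p q). nra. }
  assert (E : n = vscale (mink n m) m).
  { apply (nondegenerate p q m); trivial; autorewrite with mink;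
    rewrite ?(mink_sym n p), ?(mink_sym n q), ?(mink_sym m p), ?(mink_sym m q), ?Pn, ?Qn, ?Pm, ?Qm, ?Hm; ring. }
  assert (Q : mink n m * mink n m = 1) by (rewrite E in Hn; autorewrite with mink in Hn; rewrite Hm in Hn; lra).
  destruct (Rle_lt_dec 0 (mink n m)) as [L|L].
  - left. rewrite E. rewrite (square_one _ L Q). apply vscale_1.
  - right. rewrite E. f_equal. assert (- mink n m = 1) by (apply square_one; lra). lra.
Qed.

Lemma nodup4 {A : Type} (a b c d : A) :
  NoDup [a; b; c; d] <-> a <> b /\ a <> c /\ a <> d /\ b <> c /\ b <> d /\ c <> d.
Proof.
  split.
  - intros ND. inversion_clear ND as [|? ? N1 ND2]. inversion_clear ND2 as [|? ? N2 ND3].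
    inversion_clear ND3 as [|? ? N3 _]. simpl in N1, N2, N3. repeat split; intros ->; tauto.
  - intros (E1&E2&E3&E4&E5&E6). repeat constructor; simpl; intros H;
    repeat destruct H as [H|H]; trivial; symmetry in H; contradiction.
Qed.

Section Tiling.
Variable T : (H2 -> Prop) -> Prop.
Hypothesis HT : pentagon_tiling T.

(** A small step from [x] along [n] enters both tiles. *)
Lemma side_overlap (N M : nat -> vec) (x n : vec) : tile T N -> tile T M -> mink n n = 1 -> mink x n = 0 ->
  (forall k, N k = n \/ 0 < mink x (N k)) -> (forall k, M k = n \/ 0 < mink x (M k)) -> cell N = cell M.
Proof.
  intros HN HM Hn Hx PN PM.
  destruct (small_factor (map (fun k => mink n (N k) / mink x (N k)) (seq 0 5) ++
      map (fun k => mink n (M k) / mink x (M k)) (seq 0 5))) as (e & He & Hl).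
  assert (Key : forall (L : nat -> vec) (k : nat), (L k = n \/ 0 < mink x (L k)) -> - 1 < e * (mink n (L k) / mink x (L k)) ->
     0 < mink (vadd x (vscale e n)) (L k)).
  { intros L k [E|P] Hc; autorewrite with mink.
    - rewrite E, Hn, Hx. lra.
    - assert (E : mink n (L k) / mink x (L k) * mink x (L k) = mink n (L k)) by (field; lra). nra. }
  apply (overlap_vec T HT N M (vadd x (vscale e n))); trivial.
  - apply (frame_all N (fun m => 0 < mink (vadd x (vscale e n)) m) (proj1 HN)); apply Key; trivial;
    apply Hl; apply in_app_iff; left; simpl; tauto.
  - apply (frame_all M (fun m => 0 < mink (vadd x (vscale e n)) m) (proj1 HM)); apply Key; trivial;
    apply Hl; apply in_app_iff; right; simpl; tauto.
Qed.

Definition at_tile (N : nat -> vec) (x : dual_vertex T) : Prop := tile T N /\ is_ctr N (proj1_sig x).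

Lemma at_tile_exists (x : dual_vertex T) : exists N, at_tile N x.
Proof.
  destruct x as (c & P & HP & Hc). destruct (tile_of T HT P HP) as (N & HN & ->).
  exists N. split; [exact HN|]. apply is_center_cell; [apply HN|exact Hc].
Qed.

Lemma tile_vertex (N : nat -> vec) : tile T N -> exists x, at_tile N x.
Proof.
  intros HN. destruct (ctr_exists N (proj1 HN)) as (c & Hc).
  exists (exist _ c (ex_intro _ (cell N) (conj (proj2 HN) (proj2 (is_center_cell N c (proj1 HN)) Hc)))).
  split; assumption.
Qed.

Lemma csum_cell (N M : nat -> vec) : tile T N -> tile T M -> csum N = csum M -> cell N = cell M.
Proof.
  intros HN HM E. phi_facts. apply (overlap_vec T HT N M (csum N)); trivial; intros i.
  - rewrite csum_normal; [lra|apply HN].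
  - rewrite E, csum_normal; [lra|apply HM].
Qed.

Lemma is_ctr_csum (N M : nat -> vec) (c : H2) : is_ctr N c -> is_ctr M c -> csum N = csum M.
Proof.
  unfold is_ctr. intros -> E. destruct ctr_scale_spec. apply vscale_inj in E; [exact E|lra].
Qed.

Lemma at_tile_eq (N M : nat -> vec) (x y : dual_vertex T) : at_tile N x -> at_tile M y ->
  csum N = csum M -> x = y.
Proof.
  intros [_ Hx] [_ Hy] E. unfold is_ctr in *. rewrite E, <- Hy in Hx. apply H2_ext in Hx.
  destruct x as [x px], y as [y py]; simpl in *. subst y. f_equal. apply proof_irrelevance.
Qed.

Lemma at_tile_csum (N M : nat -> vec) (x : dual_vertex T) : at_tile N x -> at_tile M x -> csum N = csum M.
Proof. intros [_ Hx] [_ Hy]. apply (is_ctr_csum _ _ _ Hx Hy). Qed.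

Lemma at_tile_change (N M : nat -> vec) (x : dual_vertex T) : at_tile N x -> tile T M -> csum N = csum M -> at_tile M x.
Proof. intros [_ Hx] HM E. split; [exact HM|]. unfold is_ctr. rewrite <- E. exact Hx. Qed.

Lemma at_tile_shift (N : nat -> vec) (k : nat) (x : dual_vertex T) : at_tile N x -> at_tile (shift k N) x.
Proof.
  intros H. apply (at_tile_change N); [exact H|apply tile_shift, H|]. symmetry; apply csum_shift, H.
Qed.

Lemma at_tile_cell (N : nat -> vec) (x : dual_vertex T) (P : H2 -> Prop) :
  at_tile N x -> T P -> is_center P (proj1_sig x) -> P = cell N.
Proof.
  intros [HN Hx] HP Hc. destruct (tile_of T HT P HP) as (M & HM & ->).
  apply is_center_cell in Hc; [|apply HM]. apply csum_cell; trivial. apply (is_ctr_csum _ _ _ Hc Hx).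
Qed.

Lemma vertices_differ (N : nat -> vec) (F : frame N) (i : nat) : vertH N F (4 + i) <> vertH N F i.
Proof.
  intros E. pose proof (proj2 (proj2 (proj2 (vert_next N i F)))) as V.
  change (vert N (4 + i)) with (coords (vertH N F (4 + i))) in V. rewrite E in V. cbn [coords vertH] in V.
  rewrite vert_sheet in V by exact F. phi_facts. lra.
Qed.

Lemma side_refl (N : nat -> vec) (i : nat) : frame N -> side (refl_frame (N i) N) i = side N i.
Proof.
  intros F. apply set_ext; intros x. unfold side, cell, refl_frame.
  assert (E : refl_vec (N i) (N i) = vscale (-1) (N i)) by (unfold refl_vec; rewrite (fr_unit N F); vec_ring).
  rewrite E, mink_scale_r. split; intros [H Z]; (split; [|lra]); intros j; specialize (H j).
  - rewrite <- refl_swap, refl_fix in H by lra. exact H.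
  - rewrite <- refl_swap, refl_fix by lra. exact H.
Qed.

(** Normals of two tiles along a common side agree up to sign. Equal normals would make the tiles
    overlap; with opposite ones the second tile overlaps the mirror image of the first, itself a
    tile. *)
Lemma adjacent_iff (N : nat -> vec) (x y : dual_vertex T) : at_tile N x ->
  (dual_adjacent T x y <-> exists i, at_tile (refl_frame (N i) N) y).
Proof.
  intros Hx. assert (HN := proj1 Hx). assert (F := proj1 HN). split.
  - intros (P & P' & TP & TP' & Hne & Cx & Cy & s & Hs & Hs').
    assert (P = cell N) by (apply (at_tile_cell N x); trivial). subst P.
    destruct (at_tile_exists y) as (M & Hy). assert (G := proj1 (proj1 Hy)).
    assert (P' = cell M) by (apply (at_tile_cell M y); trivial). subst P'.
    apply is_side_cell in Hs as (i & ->); [|exact F]. apply is_side_cell in Hs' as (j & E); [|exact G].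
    set (p := vertH N F (4 + i)). set (q := vertH N F i).
    assert (Hpq : p <> q) by apply vertices_differ.
    assert (Sp : side N i p).
    { split; [apply vert_in_cell|]. pose proof (proj1 (proj2 (vert_normal N (4 + i) F))) as V.
      replace (1 + (4 + i))%nat with (5 + i)%nat in V by lia. rewrite (fr_periodic N F) in V. exact V. }
    assert (Sq : side N i q) by (split; [apply vert_in_cell|apply (proj1 (vert_normal N i F))]).
    assert (Sp' : side M j p) by (rewrite <- E; exact Sp). assert (Sq' : side M j q) by (rewrite <- E; exact Sq).
    exists i.
    assert (HR : tile T (refl_frame (N i) N)) by (apply tile_refl; trivial).
    assert (Sp2 : side (refl_frame (N i) N) i p) by (rewrite side_refl; trivial).
    assert (Sq2 : side (refl_frame (N i) N) i q) by (rewrite side_refl; trivial).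
    assert (Ei : refl_frame (N i) N i = vscale (-1) (N i))
      by (unfold refl_frame, refl_vec; rewrite (fr_unit N F); vec_ring).
    assert (Zero : mink (vadd p q) (M j) = 0)
      by (autorewrite with mink; rewrite (proj2 Sp'), (proj2 Sq'); ring).
    destruct (normal_of_line p q (M j) (N i)) as [Hm|Hm]; trivial;
      try apply (fr_unit N F); try apply (fr_unit M G); try apply Sp'; try apply Sq'; try apply Sp; try apply Sq.
    + exfalso. apply Hne. apply (side_overlap N M (vadd p q) (M j)); trivial.
      * apply Hy.
      * apply (fr_unit M G).
      * intros k. rewrite Hm. apply (side_interior N i p q); trivial; first [apply Sp|apply Sq].
      * apply (side_interior M j p q); trivial; first [apply Sp'|apply Sq'].
    + apply (at_tile_change M); trivial. apply cell_csum; trivial; [apply HR|].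
      apply (side_overlap M _ (vadd p q) (M j)); trivial.
      * apply Hy.
      * apply (fr_unit M G).
      * apply (side_interior M j p q); trivial; first [apply Sp'|apply Sq'].
      * intros k. rewrite Hm, <- Ei. apply (side_interior _ i p q); trivial; first [apply HR|apply Sp2|apply Sq2].
  - intros (i & Hy). exists (cell N), (cell (refl_frame (N i) N)).
    assert (HR := proj1 Hy). split; [apply HN|split; [apply HR|split]].
    { intros E. apply cell_csum in E; [|exact F|apply HR]. apply (f_equal (fun u => mink u (N i))) in E.
      rewrite csum_refl, refl_mink_l, (csum_normal N F), (fr_unit N F) in E. phi_facts. lra. }
    split; [apply is_center_cell; [exact F|apply Hx]|].
    split; [apply is_center_cell; [apply HR|apply Hy]|].
    exists (side N i). split; [apply is_side_cell; [exact F|exists i; reflexivity]|].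
    apply is_side_cell; [apply HR|]. exists i. symmetry; apply side_refl, F.
Qed.

Lemma adjacent_sym (x y : dual_vertex T) : dual_adjacent T x y -> dual_adjacent T y x.
Proof.
  intros (P & P' & TP & TP' & Hne & Cx & Cy & s & Hs & Hs').
  exists P', P. repeat (split; [solve [trivial|intros E; apply Hne; symmetry; exact E]|]). exists s. split; trivial.
Qed.

Lemma csum_refl_eq (N : nat -> vec) (i : nat) : frame N ->
  csum (refl_frame (N i) N) = vadd (csum N) (vscale (- 2 * s5) (N i)).
Proof. intros F. rewrite csum_refl. unfold refl_vec. rewrite (csum_normal N F). reflexivity. Qed.

(** Neighbouring center vectors differ by 2 [s5] times a unit normal. For opposite corners of a
    square the same quantity is 40, so diagonals are not edges. *)
Lemma adjacent_norm (N M : nat -> vec) (x y : dual_vertex T) : at_tile N x -> at_tile M y ->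
  dual_adjacent T x y -> mink (vsub (csum N) (csum M)) (vsub (csum N) (csum M)) = 20.
Proof.
  intros Hx Hy A. apply (adjacent_iff N x y Hx) in A as (i & A).
  rewrite (at_tile_csum _ _ _ Hy A), csum_refl_eq by apply Hx.
  unfold vsub; autorewrite with mink. rewrite (mink_sym (N i)), (fr_unit N (proj1 (proj1 Hx))).
  destruct s5_spec. nra.
Qed.

Lemma adjacent_irrefl (x : dual_vertex T) : ~ dual_adjacent T x x.
Proof.
  intros A. destruct (at_tile_exists x) as (N & Hx). pose proof (adjacent_norm N N x x Hx Hx A) as E.
  unfold vsub in E; autorewrite with mink in E. lra.
Qed.

Lemma orth_commute (n m x : vec) : mink n m = 0 -> refl_vec n (refl_vec m x) = refl_vec m (refl_vec n x).
Proof.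
  intros H. unfold refl_vec; autorewrite with mink. rewrite (mink_sym m n), H. vec_ring.
Qed.

(** The four tiles at corner 0 in cyclic order; the reflections in the orthogonal sides 0 and 1
    commute and generate a group of order four. *)
Definition around (N : nat -> vec) (k : nat) : nat -> vec :=
  match k with
  | O => N
  | S O => refl_frame (N 0%nat) N
  | S (S O) => refl_frame (N 0%nat) (refl_frame (N 1%nat) N)
  | _ => refl_frame (N 1%nat) N
  end.

Lemma around_tile (N : nat -> vec) (k : nat) : tile T N -> tile T (around N k).
Proof.
  intros HN. destruct k as [|[|[|k]]]; simpl; trivial; try (apply tile_refl; trivial).
  assert (H : tile T (refl_frame (N 1%nat) N)) by (apply tile_refl; trivial).
  apply (tile_refl T HT _ 0) in H. unfold refl_frame at 2 in H.
  rewrite refl_fix in H; trivial. apply (fr_orth N (proj1 HN) 0).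
Qed.

Lemma around_csum (N : nat -> vec) : frame N ->
  csum (around N 1) = vadd (csum N) (vscale (- 2 * s5) (N 0%nat)) /\
  csum (around N 2) = vadd (csum N) (vscale (- 2 * s5) (vadd (N 0%nat) (N 1%nat))) /\
  csum (around N 3) = vadd (csum N) (vscale (- 2 * s5) (N 1%nat)).
Proof.
  intros F. simpl. split; [apply csum_refl_eq, F|split; [|apply csum_refl_eq, F]].
  rewrite csum_refl, csum_refl_eq by exact F. unfold refl_vec. autorewrite with mink.
  rewrite (csum_normal N F), (mink_sym (N 1%nat)), (fr_orth N F 0 : mink (N 0%nat) (N 1%nat) = 0).
  fold s5. vec_ring.
Qed.

Lemma around_vert (N : nat -> vec) (k : nat) : frame N -> vert (around N k) 0 = vert N 0.
Proof.
  intros F. destruct (vert_normal N 0 F) as (V0&V1&_). cbn [Nat.add] in V1.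
  destruct k as [|[|[|k]]]; simpl; rewrite ?vert_refl; trivial; rewrite ?(refl_fix _ _ V1), ?(refl_fix _ _ V0); trivial.
Qed.

Lemma around_distinct (N : nat -> vec) (i j : nat) : tile T N -> (i < j < 4)%nat ->
  cell (around N i) <> cell (around N j).
Proof.
  intros HN Hij E. assert (F := proj1 HN).
  apply cell_csum in E; [|apply around_tile, HN|apply around_tile, HN].
  destruct (around_csum N F) as (C1&C2&C3). destruct s5_spec as [_ Hs].
  destruct (fr_products N F) as (A00&A01&A02&A03&A04&A11&_).
  assert (A10 := A01). rewrite mink_sym in A10.
  assert (Q0 := f_equal (fun u => mink u (N 0%nat)) E). assert (Q1 := f_equal (fun u => mink u (N 1%nat)) E).
  cbv beta in Q0, Q1. clear E.
  destruct i as [|[|[|i]]]; destruct j as [|[|[|[|j]]]]; try lia;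
  rewrite ?C1, ?C2, ?C3 in Q0; rewrite ?C1, ?C2, ?C3 in Q1; cbn [around] in Q0, Q1;
  autorewrite with mink in Q0; autorewrite with mink in Q1;
  rewrite ?A00, ?A01, ?A10, ?A11 in Q0; rewrite ?A00, ?A01, ?A10, ?A11 in Q1; lra.
Qed.

Section Square.
Variables (N : nat -> vec) (f : dual_face T) (a b c d : dual_vertex T).
Hypothesis Hf : coords (proj1_sig f) = vert N 0.
Hypothesis Ha : at_tile (around N 0) a.
Hypothesis Hb : at_tile (around N 1) b.
Hypothesis Hc : at_tile (around N 2) c.
Hypothesis Hd : at_tile (around N 3) d.

Let HN : tile T N := proj1 Ha.

Lemma square_nodup : NoDup [a; b; c; d].
Proof.
  assert (D : forall i j x, at_tile (around N i) x -> at_tile (around N j) x -> (i < j < 4)%nat -> False).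
  { intros i j x Hi Hj L. apply (around_distinct N i j HN L). apply csum_cell; [apply Hi|apply Hj|].
    apply (at_tile_csum _ _ x); trivial. }
  repeat constructor; simpl; intros H; repeat destruct H as [H|H]; trivial; subst.
  - apply (D 0%nat 1%nat a); trivial; lia.
  - apply (D 0%nat 2%nat a); trivial; lia.
  - apply (D 0%nat 3%nat a); trivial; lia.
  - apply (D 1%nat 2%nat b); trivial; lia.
  - apply (D 1%nat 3%nat b); trivial; lia.
  - apply (D 2%nat 3%nat c); trivial; lia.
Qed.

Lemma vertex_around (k : nat) : is_vertex (cell (around N k)) (proj1_sig f).
Proof.
  apply is_vertex_cell; [apply around_tile, HN|]. exists 0%nat. rewrite Hf. symmetry; apply around_vert, HN.
Qed.

Lemma square_centers (x : dual_vertex T) : In x [a; b; c; d] <-> center_around T f x.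
Proof.
  split.
  - assert (K : forall k y, at_tile (around N k) y -> center_around T f y).
    { intros k y Hy. exists (cell (around N k)). split; [apply Hy|]. split; [apply vertex_around|].
      apply is_center_cell; apply Hy. }
    intros [<- | [<- | [<- | [<- | []]]]]; [apply (K 0%nat)|apply (K 1%nat)|apply (K 2%nat)|apply (K 3%nat)]; assumption.
  - intros (P & TP & Vp & Cx).
    destruct (four_at_vertex T HT P (proj1_sig f) TP Vp) as (l & Dl & Ll & Hl).
    set (l' := map (fun k => cell (around N k)) [0%nat; 1%nat; 2%nat; 3%nat]).
    (* Four distinct tiles at this corner exhaust the exactly four allowed by [four_at_vertex]. *)
    assert (I : incl l l').
    { apply NoDup_length_incl.
      - unfold l'. pose proof (around_distinct N) as D.
        repeat constructor; simpl; intros H; repeat destruct H as [H|H]; trivial; symmetry in H; revert H;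
        first [apply (D 0%nat 1%nat HN); lia|apply (D 0%nat 2%nat HN); lia|apply (D 0%nat 3%nat HN); lia
          |apply (D 1%nat 2%nat HN); lia|apply (D 1%nat 3%nat HN); lia|apply (D 2%nat 3%nat HN); lia].
      - rewrite Ll. apply Nat.le_refl.
      - intros Q HQ. apply in_map_iff in HQ as (k & <- & _). apply Hl.
        split; [apply around_tile, HN|apply vertex_around]. }
    assert (IP : In P l') by (apply I, Hl; split; trivial).
    assert (K : forall k y, at_tile (around N k) y -> cell (around N k) = P -> y = x).
    { intros k y Hy <-. apply (at_tile_eq (around N k) (around N k)); trivial.
      split; [apply Hy|]. apply is_center_cell; [apply Hy|exact Cx]. }
    destruct IP as [E|[E|[E|[E|[]]]]]; simpl; [left; apply (K 0%nat)|right; left; apply (K 1%nat)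
      |right; right; left; apply (K 2%nat)|right; right; right; left; apply (K 3%nat)]; trivial.
Qed.

Lemma square_sides : dual_adjacent T a b /\ dual_adjacent T b c /\ dual_adjacent T c d /\ dual_adjacent T d a.
Proof.
  assert (F := proj1 HN). pose proof (fr_orth N F 0) as O. cbn [Nat.add] in O.
  assert (O' := O). rewrite mink_sym in O'.
  repeat split.
  - apply (adjacent_iff N a b Ha). exists 0%nat. exact Hb.
  - apply (adjacent_iff _ b c Hb). exists 1%nat. cbn [around] in *.
    unfold refl_frame at 2. rewrite (refl_fix _ _ O').
    replace (refl_frame (N 1%nat) (refl_frame (N 0%nat) N)) with (refl_frame (N 0%nat) (refl_frame (N 1%nat) N)); trivial.
    apply FunctionalExtensionality.functional_extensionality; intros j. apply orth_commute, O.
  - apply adjacent_sym, (adjacent_iff _ d c Hd). exists 0%nat. cbn [around] in *.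
    unfold refl_frame at 2. rewrite (refl_fix _ _ O). exact Hc.
  - apply adjacent_sym, (adjacent_iff N a d Ha). exists 1%nat. exact Hd.
Qed.

Lemma square_diagonals : ~ dual_adjacent T a c /\ ~ dual_adjacent T b d.
Proof.
  assert (F := proj1 HN). destruct (around_csum N F) as (C1&C2&C3).
  destruct (fr_products N F) as (A00&A01&A02&A03&A04&A11&_).
  assert (A10 := A01). rewrite mink_sym in A10. destruct s5_spec as [Hs _].
  split; intros A.
  - pose proof (adjacent_norm _ _ _ _ Ha Hc A) as Q. rewrite C2 in Q. cbn [around] in Q. unfold vsub in Q.
    autorewrite with mink in Q. rewrite (mink_sym (N 0%nat) (csum N)), (mink_sym (N 1%nat) (csum N)), A00, A01, A10, A11 in Q. nra.
  - pose proof (adjacent_norm _ _ _ _ Hb Hd A) as Q. rewrite C1, C3 in Q. unfold vsub in Q.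
    autorewrite with mink in Q. rewrite (mink_sym (N 0%nat) (csum N)), (mink_sym (N 1%nat) (csum N)), A00, A01, A10, A11 in Q. nra.
Qed.

Lemma square_boundary : dual_boundary T f a b c d.
Proof. split; [exact square_nodup|split; [exact square_centers|exact square_sides]]. Qed.

(** As neither diagonal is an edge, a closed walk through the four corners must go around the
    square, which leaves the eight dihedral readings. *)
Lemma square_orbit (a' b' c' d' : dual_vertex T) :
  dual_boundary T f a' b' c' d' <-> In (a', b', c', d') (dihedral_orbit a b c d).
Proof.
  pose proof square_nodup as ND. pose proof square_centers as SC.
  destruct square_sides as (S1&S2&S3&S4). destruct square_diagonals as (D1&D2).
  assert (D1' : ~ dual_adjacent T c a) by (intros H; apply D1, adjacent_sym, H).
  assert (D2' : ~ dual_adjacent T d b) by (intros H; apply D2, adjacent_sym, H).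
  pose proof adjacent_irrefl as Irr.
  split.
  - intros (ND' & SC' & A1 & A2 & A3 & A4).
    assert (In4 : forall x, In x [a'; b'; c'; d'] -> x = a \/ x = b \/ x = c \/ x = d).
    { intros x Hx. apply SC', SC in Hx. simpl in Hx. intuition. }
    pose proof (In4 a' ltac:(simpl; tauto)) as Ia. pose proof (In4 b' ltac:(simpl; tauto)) as Ib.
    pose proof (In4 c' ltac:(simpl; tauto)) as Ic. pose proof (In4 d' ltac:(simpl; tauto)) as Id.
    clear In4 SC SC'.
    apply nodup4 in ND' as (E1&E2&E3&E4&E5&E6).
    clear ND Ha Hb Hc Hd HN S1 S2 S3 S4.
    destruct Ia as [-> | [-> | [-> | ->]]]; destruct Ib as [-> | [-> | [-> | ->]]];
      try (exfalso; solve [eapply Irr; eassumption|contradiction|congruence]);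
    destruct Ic as [-> | [-> | [-> | ->]]]; try (exfalso; solve [eapply Irr; eassumption|contradiction|congruence]);
    destruct Id as [-> | [-> | [-> | ->]]]; try (exfalso; solve [eapply Irr; eassumption|contradiction|congruence]); clear; simpl; tauto.
  - intros H.
    assert (S1' := adjacent_sym _ _ S1). assert (S2' := adjacent_sym _ _ S2).
    assert (S3' := adjacent_sym _ _ S3). assert (S4' := adjacent_sym _ _ S4).
    apply nodup4 in ND as (E1&E2&E3&E4&E5&E6).
    clear Irr D1 D2 D1' D2' Ha Hb Hc Hd HN.
    simpl in H. repeat (destruct H as [H|H]; [injection H as <- <- <- <-; (split;
     [apply nodup4; repeat split; auto|split; [intros x; rewrite <- SC; clear; simpl; tauto|auto]])|]). destruct H.
Qed.

End Square.

Lemma face_square (f : dual_face T) (N : nat -> vec) : tile T N -> coords (proj1_sig f) = vert N 0 ->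
  exists a b c d, at_tile (around N 0) a /\ at_tile (around N 1) b /\ at_tile (around N 2) c /\ at_tile (around N 3) d.
Proof.
  intros HN Hf.
  destruct (tile_vertex _ (around_tile N 0 HN)) as (a & Ha). destruct (tile_vertex _ (around_tile N 1 HN)) as (b & Hb).
  destruct (tile_vertex _ (around_tile N 2 HN)) as (c & Hc). destruct (tile_vertex _ (around_tile N 3 HN)) as (d & Hd).
  exists a, b, c, d. repeat split; assumption || apply Ha || apply Hb || apply Hc || apply Hd.
Qed.

Lemma face_tile (f : dual_face T) : exists N, tile T N /\ coords (proj1_sig f) = vert N 0.
Proof.
  destruct f as (p & P & TP & Vp). destruct (tile_of T HT P TP) as (N & HN & ->).
  destruct (proj1 (is_vertex_cell N p (proj1 HN)) Vp) as (i & Hi). exists (shift i N).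
  split; [apply tile_shift, HN|]. rewrite vert_shift. exact Hi.
Qed.

Lemma vertex_face (N : nat -> vec) (i : nat) : tile T N -> exists f : dual_face T, coords (proj1_sig f) = vert N i.
Proof.
  intros HN. assert (V : is_vertex (cell N) (vertH N (proj1 HN) i))
    by (apply is_vertex_cell; [apply HN|exists i; reflexivity]).
  exists (exist (fun p : H2 => exists P, T P /\ is_vertex P p) (vertH N (proj1 HN) i)
    (ex_intro _ (cell N) (conj (proj2 HN) V))). reflexivity.
Qed.

Lemma face_eq (f g : dual_face T) : coords (proj1_sig f) = coords (proj1_sig g) -> f = g.
Proof.
  intros E. apply H2_ext in E. destruct f as [x px], g as [y py]; simpl in *. subst y. f_equal. apply proof_irrelevance.
Qed.

Lemma dual_is_square_complex : is_square_complex (dual_tiling T).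
Proof.
  split; [exact adjacent_sym|split; [exact adjacent_irrefl|]].
  intros f. destruct (face_tile f) as (N & HN & Hf).
  destruct (face_square f N HN Hf) as (a & b & c & d & Ha & Hb & Hc & Hd).
  exists a, b, c, d. split; [apply (square_nodup N); assumption|].
  destruct (square_sides N a b c d) as (S1&S2&S3&S4); trivial.
  do 4 (split; [assumption|]). apply (square_orbit N); assumption.
Qed.

Lemma center_around_vert (f : dual_face T) (x : dual_vertex T) (N : nat -> vec) : at_tile N x ->
  center_around T f x -> exists i, coords (proj1_sig f) = vert N i.
Proof.
  intros Hx (P & TP & Vp & Cx). assert (P = cell N) by (apply (at_tile_cell N x); trivial). subst P.
  apply is_vertex_cell in Vp; [exact Vp|apply Hx].
Qed.

Lemma corner_iff (f : dual_face T) (x : dual_vertex T) (N : nat -> vec) : at_tile N x ->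
  (@corner (dual_tiling T) f x <-> exists i, (i < 5)%nat /\ coords (proj1_sig f) = vert N i).
Proof.
  intros Hx. assert (F := proj1 (proj1 Hx)). split.
  - intros (b & c & d & B). destruct B as (_ & C & _).
    destruct (center_around_vert f x N Hx) as (i & Hi); [apply C; left; reflexivity|].
    destruct (vert_cases N F 0 i) as (j & Hj & E). exists j. split; [exact Hj|].
    rewrite Hi, E. f_equal. lia.
  - intros (i & _ & Hi). assert (HN := tile_shift T N i (proj1 Hx)).
    rewrite <- (Nat.add_0_l i), <- vert_shift in Hi.
    destruct (face_square f _ HN Hi) as (a & b & c & d & Ha & Hb & Hc & Hd).
    assert (a = x) by (apply (at_tile_eq (shift i N) N); trivial; apply csum_shift, F). subst a.
    exists b, c, d. apply (square_boundary (shift i N)); trivial.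
Qed.

Lemma five_corners (x : dual_vertex T) : has_card (fun f : dual_face T => @corner (dual_tiling T) f x) 5.
Proof.
  destruct (at_tile_exists x) as (N & Hx). assert (F := proj1 (proj1 Hx)).
  destruct (vertex_face N 0 (proj1 Hx)) as (f0 & E0). destruct (vertex_face N 1 (proj1 Hx)) as (f1 & E1).
  destruct (vertex_face N 2 (proj1 Hx)) as (f2 & E2). destruct (vertex_face N 3 (proj1 Hx)) as (f3 & E3).
  destruct (vertex_face N 4 (proj1 Hx)) as (f4 & E4).
  exists [f0; f1; f2; f3; f4]. split; [|split; [reflexivity|]].
  - phi_facts.
    assert (D : forall i d (f g : dual_face T), (1 <= d <= 4)%nat -> coords (proj1_sig f) = vert N i ->
      coords (proj1_sig g) = vert N (d + i) -> f <> g).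
    { intros i d f g Hd Hf Hg ->. rewrite Hf in Hg.
      pose proof (vert_sheet N i F) as S. rewrite Hg in S at 2. destruct (vert_next N i F) as (V1&V2&V3&V4).
      destruct d as [|[|[|[|[|d]]]]]; try lia; cbn [Nat.add] in *; lra. }
    repeat constructor; simpl; intros H; repeat destruct H as [H|H]; trivial; symmetry in H; revert H;
    first [eapply (D 0%nat 1%nat); [lia|eassumption|assumption]|eapply (D 0%nat 2%nat); [lia|eassumption|assumption]
     |eapply (D 0%nat 3%nat); [lia|eassumption|assumption]|eapply (D 0%nat 4%nat); [lia|eassumption|assumption]
     |eapply (D 1%nat 1%nat); [lia|eassumption|assumption]|eapply (D 1%nat 2%nat); [lia|eassumption|assumption]
     |eapply (D 1%nat 3%nat); [lia|eassumption|assumption]|eapply (D 2%nat 1%nat); [lia|eassumption|assumption]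
     |eapply (D 2%nat 2%nat); [lia|eassumption|assumption]|eapply (D 3%nat 1%nat); [lia|eassumption|assumption]].
  - intros f. rewrite (corner_iff f x N Hx). simpl. split.
    + intros [<- | [<- | [<- | [<- | [<- | []]]]]]; [exists 0%nat|exists 1%nat|exists 2%nat|exists 3%nat|exists 4%nat];
      (split; [lia|assumption]).
    + intros (i & Hi & E).
      destruct i as [|[|[|[|[|i]]]]]; try lia;
      [left|right; left|right; right; left|right; right; right; left|right; right; right; right; left];
      apply face_eq; congruence.
Qed.

(** The corner lies in the tile and in its mirror images, hence on the two sides crossed. These are
    distinct and meet, so they are orthogonal. *)
Lemma arc_normals (f : dual_face T) (v u w : dual_vertex T) (N : nat -> vec) : at_tile N v ->
  @link_arc (dual_tiling T) f v u w -> exists i j,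
  at_tile (refl_frame (N i) N) u /\ at_tile (refl_frame (N j) N) w /\ mink (N i) (N j) = 0 /\
  mink (proj1_sig f) (N i) = 0 /\ mink (proj1_sig f) (N j) = 0.
Proof.
  intros Hv (x & ND & C & A1 & A2 & _). assert (F := proj1 (proj1 Hv)).
  apply adjacent_sym in A1. apply (adjacent_iff N v _ Hv) in A1 as (i & Hu).
  apply (adjacent_iff N v _ Hv) in A2 as (j & Hw).
  exists i, j. do 2 (split; [assumption|]).
  destruct (center_around_vert f v N Hv) as (k & Hk); [apply C; simpl; tauto|].
  assert (K : forall i y, at_tile (refl_frame (N i) N) y -> center_around T f y -> mink (proj1_sig f) (N i) = 0).
  { intros l y Hy Cy. destruct (center_around_vert f y _ Hy Cy) as (m & Hm).
    pose proof (vert_normal_nonneg _ m l (proj1 (proj1 Hy))) as P. rewrite <- Hm in P.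
    unfold refl_frame in P. rewrite <- refl_swap, refl_mink_l, (fr_unit N F) in P.
    pose proof (vert_normal_nonneg N k l F) as Q. rewrite <- Hk in Q. lra. }
  assert (Ku : mink (proj1_sig f) (N i) = 0) by (apply (K i u Hu), C; simpl; tauto).
  assert (Kw : mink (proj1_sig f) (N j) = 0) by (apply (K j w Hw), C; simpl; tauto).
  repeat split; trivial.
  destruct (frame_dot N i j F) as [E|[[E _]|E]]; trivial; exfalso.
  - rewrite <- E in Hw. pose proof (at_tile_eq _ _ _ _ Hu Hw eq_refl). subst w.
    inversion_clear ND as [|? ? N1 ND2]. apply N1. simpl; tauto.
  - apply (ultra_sum_pos (proj1_sig f) (N i) (N j)); trivial; apply (fr_unit N F).
Qed.

Lemma neighbour_normal (N : nat -> vec) (u : dual_vertex T) (i j : nat) : frame N ->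
  at_tile (refl_frame (N i) N) u -> at_tile (refl_frame (N j) N) u -> N i = N j.
Proof.
  intros F Hi Hj. pose proof (at_tile_csum _ _ _ Hi Hj) as E. rewrite !csum_refl_eq in E by exact F.
  destruct s5_spec. apply (f_equal (fun y => vsub y (csum N))) in E.
  apply (vscale_inj (- 2 * s5)); [lra|].
  replace (vscale (- 2 * s5) (N i)) with (vsub (vadd (csum N) (vscale (- 2 * s5) (N i))) (csum N)) by (unfold vsub; vec_ring).
  rewrite E. unfold vsub; vec_ring.
Qed.

(** Two orthogonal sides share only one corner, which excludes double arcs. A triangle would give
    three mutually orthogonal unit spacelike vectors, impossible in signature (2, 1). *)
Lemma dual_flag_links : flag_links (dual_tiling T).
Proof.
  split; [|split].
  - intros v u f (x & ND & _). inversion_clear ND as [|? ? N1 _]. apply N1. simpl; tauto.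
  - intros v u w f g Hf Hg. destruct (at_tile_exists v) as (N & Hv). assert (F := proj1 (proj1 Hv)).
    destruct (arc_normals f v u w N Hv Hf) as (i & j & Ui & Wj & O & P1 & P2).
    destruct (arc_normals g v u w N Hv Hg) as (i' & j' & Ui' & Wj' & O' & P1' & P2').
    rewrite <- (neighbour_normal N u i i' F Ui Ui') in P1'. rewrite <- (neighbour_normal N w j j' F Wj Wj') in P2'.
    apply face_eq. destruct (shift_cases N F i j) as (d & Hd & Ej). rewrite Ej in *.
    destruct d as [|[|[|[|[|d]]]]]; try lia.
    + simpl in O. rewrite (fr_unit N F) in O. lra.
    + transitivity (vert N i); [|symmetry]; apply vert_unique; trivial; first [apply coords_sheet|apply coords_upper].
    + rewrite (fr_ultra N F) in O. phi_facts. lra.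
    + rewrite (fr_d3 N F) in O. phi_facts. lra.
    + assert (E5 : N (1 + (4 + i))%nat = N i)
        by (replace (1 + (4 + i))%nat with (5 + i)%nat by lia; apply (fr_periodic N F)).
      transitivity (vert N (4 + i)); [|symmetry]; apply vert_unique; trivial;
      first [apply coords_sheet|apply coords_upper|rewrite E5; trivial].
  - intros v u w x f g h (Hf & Hg & Hh). destruct (at_tile_exists v) as (N & Hv). assert (F := proj1 (proj1 Hv)).
    destruct (arc_normals f v u w N Hv Hf) as (i & j & Ui & Wj & O & _).
    destruct (arc_normals g v w x N Hv Hg) as (j' & k & Wj' & Xk & O' & _).
    destruct (arc_normals h v x u N Hv Hh) as (k' & i' & Xk' & Ui' & O'' & _).
    rewrite (neighbour_normal N w j' j F) in O' by trivial.
    rewrite (neighbour_normal N x k' k F), (neighbour_normal N u i' i F) in O'' by trivial.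
    pose proof (gram3_nonpos (N i) (N j) (N k)) as G. rewrite (mink_sym (N k)) in O''.
    rewrite !(fr_unit N F), O, O', O'' in G. lra.
Qed.

End Tiling.

(** * Simple connectivity *)

Fixpoint chain {A : Type} (r : A -> A -> Prop) (p : list A) : Prop :=
  match p with
  | a :: ((b :: _) as q) => r a b /\ chain r q
  | _ => True
  end.

Lemma chain_app {A : Type} (r : A -> A -> Prop) (l1 l2 : list A) (a : A) :
  chain r (l1 ++ a :: l2) <-> chain r (l1 ++ [a]) /\ chain r (a :: l2).
Proof.
  induction l1 as [|b l1 IH]; [simpl; tauto|].
  destruct l1 as [|c l1]; [simpl; tauto|].
  change (r b c /\ chain r ((c :: l1) ++ a :: l2) <-> (r b c /\ chain r ((c :: l1) ++ [a])) /\ chain r (a :: l2)).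
  rewrite IH. tauto.
Qed.

Lemma last_app_cons {A : Type} (l1 l2 : list A) (a d : A) : last (l1 ++ a :: l2) d = last (a :: l2) d.
Proof.
  induction l1 as [|b l1 IH]; [reflexivity|]. rewrite <- IH. simpl.
  destruct (l1 ++ a :: l2) eqn:E; [destruct l1; discriminate|reflexivity].
Qed.

Lemma last_default {A : Type} (l : list A) : forall z d d', last (z :: l) d = last (z :: l) d'.
Proof. induction l as [|b l IH]; intros z d d'; [reflexivity|apply (IH b)]. Qed.

Lemma hd_error_app_cons {A : Type} (l1 l2 l3 : list A) (a : A) :
  hd_error (l1 ++ a :: l2) = hd_error (l1 ++ a :: l3).
Proof. destruct l1; reflexivity. Qed.

Lemma edge_path_chain {X : square_complex} (x y : vertex X) (l : list (vertex X)) :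
  edge_path x l y <-> chain adjacent (x :: l) /\ last (x :: l) x = y.
Proof.
  revert x; induction l as [|z l IH]; intros x; [simpl; tauto|].
  simpl edge_path. rewrite IH.
  assert (E : last (x :: z :: l) x = last (z :: l) z).
  { apply (last_default l z). }
  rewrite E. change (chain adjacent (x :: z :: l)) with (adjacent x z /\ chain adjacent (z :: l)). tauto.
Qed.

Fixpoint total {A : Type} (h : A -> R) (p : list A) : R :=
  match p with [] => 0 | a :: q => h a + total h q end.

Lemma total_app {A : Type} (h : A -> R) (p q : list A) : total h (p ++ q) = total h p + total h q.
Proof. induction p as [|a p IH]; simpl; [ring|rewrite IH; ring]. Qed.

(** The vector -(n + m) is timelike, and its pairing with the center shows that it is future; a
    point beyond both lines would pair positively with it. *)
Lemma ultra_disjoint (N : nat -> vec) (x : vec) (n m : vec) : frame N -> mink n n = 1 -> mink m m = 1 ->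
  mink n m = - phi -> 0 < mink (csum N) n -> 0 < mink (csum N) m -> mink x x < 0 -> 0 < vt x ->
  mink x n < 0 -> mink x m < 0 -> False.
Proof.
  intros F Hn Hm Hnm Cn Cm Hx Ux Xn Xm. phi_facts.
  set (e := vscale (-1) (vadd n m)).
  assert (He : mink e e < 0) by (unfold e; autorewrite with mink; rewrite (mink_sym m n), Hn, Hm, Hnm; lra).
  assert (Ue : 0 < vt e).
  { apply (future_of_pairing (csum N)); [apply csum_timelike, F|apply (fr_future N F)|lra|].
    unfold e; autorewrite with mink. lra. }
  pose proof (future_pairing x e Hx Ux (Rlt_le _ _ He) Ue) as P.
  unfold e in P; autorewrite with mink in P. lra.
Qed.

Section Tiling.
Variable T : (H2 -> Prop) -> Prop.
Hypothesis HT : pentagon_tiling T.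

(** The hyperbolic cosine of the distance. As a Morse function it is handier than the distance,
    since a reflection changes it by an explicit linear term. *)
Definition hv (x y : dual_vertex T) : R := - mink (proj1_sig x) (proj1_sig y).

Lemma hv_ge1 (x y : dual_vertex T) : 1 <= hv x y.
Proof. unfold hv. pose proof (H2_pairing (proj1_sig x) (proj1_sig y)). lra. Qed.

Lemma hv_self (x : dual_vertex T) : hv x x = 1.
Proof. unfold hv. rewrite coords_sheet. ring. Qed.

Lemma hv_height (x y : dual_vertex T) (B N : nat -> vec) : at_tile T B x -> at_tile T N y ->
  hv x y = ctr_scale * ctr_scale * height B N.
Proof.
  intros [_ Hx] [_ Hy]. unfold hv, height, is_ctr in *. rewrite Hx, Hy. autorewrite with mink. ring.
Qed.

(** Least change of [hv] along an edge: heights change by at least 2 s5^2 = 10, and the centers are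
    the sums of normals scaled by [ctr_scale]. *)
Definition gap : R := ctr_scale * ctr_scale * 10.

Lemma gap_pos : 0 < gap.
Proof. destruct ctr_scale_spec. unfold gap. nra. Qed.

Lemma hv_refl (x y z : dual_vertex T) (B N : nat -> vec) (i : nat) : at_tile T B x -> at_tile T N y ->
  at_tile T (refl_frame (N i) N) z ->
  hv x z = hv x y + ctr_scale * ctr_scale * (2 * s5 * mink (csum B) (N i)).
Proof.
  intros Hx Hy Hz. rewrite (hv_height x z B _ Hx Hz), (hv_height x y B N Hx Hy), height_step by apply Hy. ring.
Qed.

Lemma hv_refl_cases (x y z : dual_vertex T) (B N : nat -> vec) (i : nat) : at_tile T B x -> at_tile T N y ->
  at_tile T (refl_frame (N i) N) z ->
  (mink (csum B) (N i) <= - s5 /\ hv x z <= hv x y - gap) \/ (s5 <= mink (csum B) (N i) /\ hv x y + gap <= hv x z).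
Proof.
  intros Hx Hy Hz. rewrite (hv_refl x y z B N i Hx Hy Hz).
  pose proof (wall_bound T HT B N i (proj1 Hx) (proj1 Hy)) as W. destruct s5_spec as [Hs2 Hs].
  destruct ctr_scale_spec as [Hc _]. set (m := mink (csum B) (N i)) in *.
  assert (0 < ctr_scale * ctr_scale) by nra.
  unfold gap. unfold Rabs in W. destruct (Rcase_abs m) in W; [left|right]; (split; [lra|]).
  - assert (2 * s5 * m <= - 10) by nra. nra.
  - assert (10 <= 2 * s5 * m) by nra. nra.
Qed.

Lemma hv_adjacent (x y z : dual_vertex T) : dual_adjacent T y z ->
  hv x z <= hv x y - gap \/ hv x y + gap <= hv x z.
Proof.
  intros A. destruct (at_tile_exists T HT x) as (B & Hx). destruct (at_tile_exists T HT y) as (N & Hy).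
  apply (adjacent_iff T HT N y z Hy) in A as (i & Hz).
  destruct (hv_refl_cases x y z B N i Hx Hy Hz) as [[_ H]|[_ H]]; [left|right]; exact H.
Qed.

Lemma hv_descent (x y : dual_vertex T) : x <> y -> exists z, dual_adjacent T y z /\ hv x z <= hv x y - gap.
Proof.
  intros Hne. destruct (at_tile_exists T HT x) as (B & Hx). destruct (at_tile_exists T HT y) as (N & Hy).
  destruct (separated_side T HT B N (height B N) (proj1 Hx) (proj1 Hy) (Rle_refl _)) as (i & Hi).
  { intros E. apply Hne. apply (at_tile_eq T B N); trivial.
    symmetry. apply cell_csum; trivial; first [apply Hx|apply Hy]. }
  destruct (tile_vertex T _ (tile_refl T HT N i (proj1 Hy))) as (z & Hz).
  exists z. split; [apply (adjacent_iff T HT N y z Hy); exists i; exact Hz|].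
  destruct (hv_refl_cases x y z B N i Hx Hy Hz) as [[_ H]|[H _]]; [exact H|exfalso].
  pose proof (height_pos B N (proj1 (proj1 Hx)) (proj1 (proj1 Hy))). destruct s5_spec as [Hs2 Hs].
  assert (0 < s5 * s5 * s5 / height B N) by (apply Rdiv_lt_0_compat; nra). lra.
Qed.

Lemma dual_connected : connected (dual_tiling T).
Proof.
  intros y x.
  assert (H : forall k y, hv x y <= INR k * gap -> exists l, @edge_path (dual_tiling T) y l x).
  { induction k as [|k IH]; intros z Hz.
    - simpl in Hz. pose proof (hv_ge1 x z). lra.
    - destruct (classic (x = z)) as [<-|Hne]; [exists []; reflexivity|].
      destruct (hv_descent x z Hne) as (w & A & Hw). rewrite S_INR in Hz.
      destruct (IH w) as (l & Hl); [lra|]. exists (w :: l). split; trivial. }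
  pose proof gap_pos as G. destruct (INR_unbounded (hv x y / gap)) as (k & Hk).
  apply (H k). replace (hv x y) with (hv x y / gap * gap) by (field; lra).
  apply Rmult_le_compat_r; lra.
Qed.

Lemma peak_square (x u y w : dual_vertex T) : dual_adjacent T y u -> dual_adjacent T y w ->
  hv x u < hv x y -> hv x w < hv x y ->
  u = w \/ exists f z, dual_boundary T f u y w z /\ hv x z <= hv x y - gap.
Proof.
  intros Au Aw Lu Lw. destruct (at_tile_exists T HT x) as (B & Hx). destruct (at_tile_exists T HT y) as (N & Hy).
  apply (adjacent_iff T HT N y u Hy) in Au as (i & Hu). apply (adjacent_iff T HT N y w Hy) in Aw as (j & Hw).
  pose proof gap_pos as G. assert (F := proj1 (proj1 Hy)). destruct s5_spec as [_ Hs].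
  destruct (hv_refl_cases x y u B N i Hx Hy Hu) as [[Mi _]|[_ Q]]; [|lra].
  destruct (hv_refl_cases x y w B N j Hx Hy Hw) as [[Mj _]|[_ Q]]; [|lra].
  (* The boundary is provided in both directions because the descending sides may follow each other
     in either cyclic order. *)
  assert (Key : forall M u w, at_tile T M y -> at_tile T (around M 1) u -> at_tile T (around M 3) w ->
     mink (csum B) (M 0%nat) <= - s5 -> mink (csum B) (M 1%nat) <= - s5 ->
     exists f z, dual_boundary T f u y w z /\ dual_boundary T f w y u z /\ hv x z <= hv x y - gap).
  { clear - HT Hx Hs. intros M u w Hy Hu Hw M0 M1.
    destruct (vertex_face T M 0 (proj1 Hy)) as (f & Hf).
    destruct (tile_vertex T _ (around_tile T HT M 2 (proj1 Hy))) as (z & Hz).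
    exists f, z.
    split; [|split].
    - apply (square_orbit T HT M f y u z w Hf Hy Hu Hz Hw). simpl; tauto.
    - apply (square_orbit T HT M f y u z w Hf Hy Hu Hz Hw). simpl; tauto.
    - rewrite (hv_height x z B _ Hx Hz), (hv_height x y B M Hx Hy). unfold height.
      destruct (around_csum M (proj1 (proj1 Hy))) as (_&C2&_). rewrite C2. autorewrite with mink.
      destruct ctr_scale_spec as [Hc _]. assert (0 < ctr_scale * ctr_scale) by nra. unfold gap.
      destruct s5_spec as [Hs2 _]. set (K := ctr_scale * ctr_scale) in *. set (C := mink (csum B) (csum M)).
      assert (0 <= K * (- 2 * s5 * (mink (csum B) (M 0%nat) + mink (csum B) (M 1%nat)) - 10)) by (apply Rmult_le_pos; nra).
      nra. }
  destruct (shift_cases N F i j) as (d & Hd & Ej). rewrite Ej in *.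
  destruct d as [|[|[|[|[|d]]]]]; try lia.
  - left. apply (at_tile_eq T _ _ _ _ Hu Hw). reflexivity.
  - right. destruct (Key (shift i N) u w) as (f & z & B1 & _ & L); trivial.
    + apply at_tile_shift, Hy.
    + apply (at_tile_change T _ _ u Hu); [apply (around_tile T HT _ 1), tile_shift, Hy|].
      cbn [around]. rewrite !csum_refl, csum_shift by exact F. reflexivity.
    + apply (at_tile_change T _ _ w Hw); [apply (around_tile T HT _ 3), tile_shift, Hy|].
      cbn [around]. rewrite !csum_refl, csum_shift by exact F. reflexivity.
    + exists f, z. split; trivial.
  - exfalso. apply (ultra_disjoint N (csum B) (N i) (N (2 + i)%nat)); trivial;
      rewrite ?(fr_unit N F), ?(csum_normal N F); trivial; fold s5; try lra;
      first [apply (fr_ultra N F)|apply csum_timelike, Hx|apply (fr_future B), Hx].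
  - exfalso. apply (ultra_disjoint N (csum B) (N i) (N (3 + i)%nat)); trivial;
      rewrite ?(fr_unit N F), ?(csum_normal N F); trivial; fold s5; try lra;
      first [apply (fr_d3 N F)|apply csum_timelike, Hx|apply (fr_future B), Hx].
  - right.
    assert (E1 : shift (4 + i) N 1%nat = N i)
      by (unfold shift; replace (1 + (4 + i))%nat with (5 + i)%nat by lia; apply (fr_periodic N F)).
    destruct (Key (shift (4 + i) N) w u) as (f & z & _ & B2 & L); trivial.
    + apply at_tile_shift, Hy.
    + apply (at_tile_change T _ _ w Hw); [apply (around_tile T HT _ 1), tile_shift, Hy|].
      cbn [around]. rewrite !csum_refl, csum_shift by exact F. reflexivity.
    + apply (at_tile_change T _ _ u Hu); [apply (around_tile T HT _ 3), tile_shift, Hy|].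
      cbn [around]. rewrite E1, !csum_refl, csum_shift by exact F. reflexivity.
    + rewrite E1. exact Mi.
    + exists f, z. split; trivial.
Qed.

Lemma first_peak (x : dual_vertex T) (l : list (dual_vertex T)) : forall u v,
  chain (dual_adjacent T) (u :: v :: l) -> last (u :: v :: l) x = x -> hv x u < hv x v ->
  exists l1 a b c l2, u :: v :: l = l1 ++ a :: b :: c :: l2 /\ dual_adjacent T a b /\ dual_adjacent T b c /\
    hv x a < hv x b /\ hv x c < hv x b.
Proof.
  induction l as [|w l IH]; intros u v Hc Hl Hh.
  - simpl in Hl. subst v. rewrite hv_self in Hh. pose proof (hv_ge1 x u). lra.
  - destruct Hc as (A1 & A2 & Hc). pose proof gap_pos as G.
    destruct (hv_adjacent x v w A2) as [L|L].
    + exists [], u, v, w, l. repeat split; trivial. lra.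
    + destruct (IH v w) as (l1 & a & b & c & l2 & E & Q); [split; trivial|exact Hl|lra|].
      exists (u :: l1), a, b, c, l2. split; [rewrite E; reflexivity|exact Q].
Qed.

(** The sum of [hv] over the loop measures progress: removing a backtrack or pushing a peak across
    its square lowers it by at least [gap]. *)
Lemma contract (x : dual_vertex T) (p : list (dual_vertex T)) :
  chain (dual_adjacent T) p -> hd_error p = Some x -> last p x = x ->
  clos_refl_sym_trans _ (@elementary_homotopy (dual_tiling T)) p [x].
Proof.
  assert (H : forall k p, total (hv x) p <= INR k * gap -> chain (dual_adjacent T) p -> hd_error p = Some x ->
    last p x = x -> clos_refl_sym_trans _ (@elementary_homotopy (dual_tiling T)) p [x]).
  { assert (Pos : forall p, 0 <= total (hv x) p).
    { induction p0 as [|a p0 IH]; simpl; [lra|]. pose proof (hv_ge1 x a). lra. }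
    pose proof gap_pos as G.
    induction k as [|k IH]; intros q Hq Hc Hh Hl.
    { exfalso. destruct q as [|a q]; [discriminate|]. simpl in Hq. pose proof (hv_ge1 x a). pose proof (Pos q). lra. }
    rewrite S_INR in Hq.
    destruct q as [|a [|v l]]; [discriminate| |].
    { injection Hh as ->. apply rst_refl. }
    injection Hh as ->.
    destruct (first_peak x l x v) as (l1 & a & b & c & l2 & E & Aab & Abc & Lab & Lcb); trivial.
    (* The loop starts upwards, because [hv x] has its minimum 1 at [x] itself. *)
    { destruct Hc as [A _]. destruct (hv_adjacent x x v A) as [L|L]; [|lra].
      rewrite hv_self in L. pose proof (hv_ge1 x v). lra. }
    rewrite E in *.
    assert (Hh : hd_error (l1 ++ a :: b :: c :: l2) = Some x) by (rewrite <- E; reflexivity).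
    assert (Hl2 : last (c :: l2) x = x).
    { transitivity (last (l1 ++ a :: b :: c :: l2) x); [symmetry|exact Hl].
      change (l1 ++ a :: b :: c :: l2) with (l1 ++ [a; b] ++ c :: l2).
      rewrite app_assoc, last_app_cons. reflexivity. }
    apply chain_app in Hc as [Hc1 (_ & _ & Hc2)].
    rewrite total_app in Hq. simpl in Hq.
    assert (Gb : hv x a + gap <= hv x b) by (destruct (hv_adjacent x a b Aab); lra).
    destruct (peak_square x a b c) as [<-|(f & z & Bd & Lz)]; trivial.
    - apply adjacent_sym, Aab.
    - apply rst_trans with (l1 ++ a :: l2).
      + apply rst_step. apply (@backtrack (dual_tiling T) l1 l2 a b Aab).
      + apply IH.
        * rewrite total_app; simpl. pose proof (hv_ge1 x a). lra.
        * apply chain_app. split; trivial.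
        * rewrite <- Hh. apply hd_error_app_cons.
        * rewrite last_app_cons. exact Hl2.
    - apply rst_trans with (l1 ++ a :: z :: c :: l2).
      + apply rst_step. apply (@across_square (dual_tiling T) l1 l2 f a b c z Bd).
      + destruct Bd as (_ & _ & _ & _ & Acz & Aza).
        apply IH.
        * rewrite total_app; simpl. lra.
        * apply chain_app. split; trivial. split; [apply adjacent_sym, Aza|]. split; [apply adjacent_sym, Acz|exact Hc2].
        * rewrite <- Hh. apply hd_error_app_cons.
        * change (l1 ++ a :: z :: c :: l2) with (l1 ++ [a; z] ++ c :: l2). rewrite app_assoc, last_app_cons. exact Hl2. }
  pose proof gap_pos as G. destruct (INR_unbounded (total (hv x) p / gap)) as (k & Hk).
  apply (H k). replace (total (hv x) p) with (total (hv x) p / gap * gap) by (field; lra).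
  apply Rmult_le_compat_r; lra.
Qed.

Lemma dual_simply_connected : simply_connected (dual_tiling T).
Proof.
  split; [exact dual_connected|]. intros x l Hl. apply edge_path_chain in Hl as [Hc Hl].
  apply contract; trivial.
Qed.

Lemma dual_CAT0 : CAT0_square_complex (dual_tiling T).
Proof.
  split; [apply dual_is_square_complex, HT|split; [apply dual_flag_links, HT|exact dual_simply_connected]].
Qed.

End Tiling.

(** * Upper bound and zigzags *)

Lemma least_nat (P : nat -> Prop) : (exists n, P n) -> exists n, P n /\ forall m, P m -> (n <= m)%nat.
Proof.
  intros (n & Hn). revert Hn. induction n as [n IH] using lt_wf_ind. intros Hn.
  destruct (classic (exists m, (m < n)%nat /\ P m)) as [(m & L & Hm)|H]; [exact (IH m L Hm)|].
  exists n. split; [exact Hn|]. intros m Hm. destruct (Nat.le_gt_cases n m) as [|L]; trivial.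
  exfalso; apply H; exists m; split; trivial.
Qed.

Lemma combinatorial_distance_spec (X : square_complex) (x y : vertex X) : connected X ->
  (exists l, edge_path x l y /\ length l = combinatorial_distance x y) /\
  (forall l, edge_path x l y -> (combinatorial_distance x y <= length l)%nat).
Proof.
  intros HX. unfold combinatorial_distance.
  apply (epsilon_spec (inhabits 0%nat) (fun n => (exists l, edge_path x l y /\ length l = n) /\
    (forall l, edge_path x l y -> (n <= length l)%nat))).
  destruct (least_nat (fun n => exists l, edge_path x l y /\ length l = n)) as (n & Hn & Hm).
  - destruct (HX x y) as (l & Hl). exists (length l), l. split; trivial.
  - exists n. split; [exact Hn|]. intros l Hl. apply Hm. exists l. split; trivial.
Qed.

Lemma exp_INR (a : R) (n : nat) : exp (a * INR n) = exp a ^ n.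
Proof.
  induction n as [|n IH]; [simpl; rewrite Rmult_0_r; apply exp_0|].
  rewrite S_INR, Rmult_plus_distr_l, Rmult_1_r, exp_plus, IH. simpl. ring.
Qed.

(** With K = (phi - 1) / 2, these two numbers are K + 1 and 2 K^2 + 2 K + 1: the hyperbolic cosines
    of the distances between midpoints of adjacent and of non-adjacent sides. *)
Definition cosh_slow : R := (phi + 1) / 2.
Definition cosh_fast : R := (phi + 2) / 2.

Definition mid_scale : R := / sqrt (5 * s5 + 5).

Lemma mid_scale_spec : 0 < mid_scale /\ mid_scale * mid_scale * (5 * s5 + 5) = 1.
Proof.
  destruct s5_spec. assert (0 < sqrt (5 * s5 + 5)) by (apply sqrt_lt_R0; lra).
  assert (Q : sqrt (5 * s5 + 5) * sqrt (5 * s5 + 5) = 5 * s5 + 5) by (apply sqrt_sqrt; lra).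
  unfold mid_scale; split; [apply Rinv_0_lt_compat; trivial|].
  rewrite <- Q at 3. field. lra.
Qed.

(** The orthogonal projection of the center to the line of side [i], before normalization. *)
Definition mid_vec (N : nat -> vec) (i : nat) : vec := vadd (csum N) (vscale (- s5) (N i)).

Lemma mid_vec_mink (N : nat -> vec) (i j : nat) : frame N ->
  mink (mid_vec N i) (mid_vec N j) = - (5 * s5 + 10) + 5 * mink (N i) (N j).
Proof.
  intros F. unfold mid_vec; autorewrite with mink.
  rewrite (csum_csum N F), (mink_sym (N i) (csum N)), !(csum_normal N F). fold s5. destruct s5_spec as [Hs _]. ring [Hs].
Qed.

Lemma mid_vec_csum (N : nat -> vec) (i : nat) : frame N -> mink (csum N) (mid_vec N i) = - (5 * s5 + 5).
Proof.
  intros F. unfold mid_vec; autorewrite with mink. rewrite (csum_csum N F), (csum_normal N F). fold s5.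
  destruct s5_spec as [Hs _]. ring [Hs].
Qed.

Definition is_mid (N : nat -> vec) (i : nat) (m : H2) : Prop := coords m = vscale mid_scale (mid_vec N i).

Lemma mid_exists (N : nat -> vec) (i : nat) : frame N -> exists m, is_mid N i m.
Proof.
  intros F. destruct mid_scale_spec as [Hp Hs].
  assert (E : mink (vscale mid_scale (mid_vec N i)) (vscale mid_scale (mid_vec N i)) = -1).
  { autorewrite with mink. rewrite (mid_vec_mink N i i F), (fr_unit N F). lra. }
  assert (U : 0 < vt (vscale mid_scale (mid_vec N i))).
  { apply (future_of_pairing (csum N)); [apply csum_timelike, F|apply (fr_future N F)|lra|].
    autorewrite with mink. rewrite (mid_vec_csum N i F). destruct s5_spec. nra. }
  exists (MkH2 _ E U). reflexivity.
Qed.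

Lemma is_mid_refl (N : nat -> vec) (i : nat) (m : H2) : frame N -> is_mid N i m -> is_mid (refl_frame (N i) N) i m.
Proof.
  unfold is_mid. intros F ->. f_equal. unfold mid_vec. rewrite csum_refl_eq by exact F.
  unfold refl_frame, refl_vec. rewrite (fr_unit N F). vec_ring.
Qed.

Lemma is_mid_shift (N : nat -> vec) (i k : nat) (m : H2) : frame N -> is_mid N (i + k) m -> is_mid (shift k N) i m.
Proof. unfold is_mid, mid_vec. intros F ->. rewrite csum_shift by exact F. reflexivity. Qed.

Lemma is_mid_change (N M : nat -> vec) (i j : nat) (m : H2) : csum N = csum M -> N i = M j ->
  is_mid N i m -> is_mid M j m.
Proof. unfold is_mid, mid_vec. intros -> ->; trivial. Qed.

Definition half_edge : R := arccosh (mid_scale * ctr_scale * (5 * s5 + 5)).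

Lemma dH_ctr_mid (N : nat -> vec) (i : nat) (c m : H2) : frame N -> is_ctr N c -> is_mid N i m ->
  dH c m = half_edge.
Proof.
  unfold is_ctr, is_mid, dH, half_edge. intros F -> ->. autorewrite with mink.
  rewrite (mid_vec_csum N i F). f_equal. ring.
Qed.

Lemma mid_ratio (x : R) : mid_scale * mid_scale * (5 * s5 + 10 - 5 * x) = (s5 + 2 - x) / (s5 + 1).
Proof.
  destruct mid_scale_spec as [_ H]. destruct s5_spec.
  apply (Rmult_eq_reg_r (s5 + 1)); [|lra].
  replace ((s5 + 2 - x) / (s5 + 1) * (s5 + 1)) with (s5 + 2 - x) by (field; lra).
  transitivity (mid_scale * mid_scale * (5 * s5 + 5) * (s5 + 2 - x)); [ring|rewrite H; ring].
Qed.

Lemma dH_mid_mid (N : nat -> vec) (i j : nat) (m m' : H2) : frame N -> is_mid N i m -> is_mid N j m' ->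
  dH m m' = arccosh ((s5 + 2 - mink (N i) (N j)) / (s5 + 1)).
Proof.
  unfold is_mid, dH. intros F -> ->. autorewrite with mink. rewrite (mid_vec_mink N i j F), <- mid_ratio.
  f_equal. ring.
Qed.

Lemma dH_mid_adjacent (N : nat -> vec) (i j : nat) (m m' : H2) : frame N -> is_mid N i m -> is_mid N j m' ->
  mink (N i) (N j) = 0 -> dH m m' = arccosh cosh_slow.
Proof.
  intros F Hm Hm' E. rewrite (dH_mid_mid N i j m m' F Hm Hm'), E. f_equal. unfold cosh_slow, s5. phi_facts.
  apply (Rmult_eq_reg_r (2 * (2 * phi - 1 + 1))); [|lra]. field_simplify; [nra|lra].
Qed.

Lemma dH_mid_le (N : nat -> vec) (i j : nat) (m m' : H2) : frame N -> is_mid N i m -> is_mid N j m' ->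
  dH m m' <= arccosh cosh_fast.
Proof.
  intros F Hm Hm'. rewrite (dH_mid_mid N i j m m' F Hm Hm'). phi_facts. destruct s5_spec as [Hs2 Hs].
  assert (C : mink (N i) (N j) = 1 \/ mink (N i) (N j) = 0 \/ mink (N i) (N j) = - phi).
  { destruct (frame_dot N i j F) as [E|[[E _]|E]]; [left; rewrite <- E; apply (fr_unit N F)|tauto|tauto]. }
  assert (Ip : 0 < / (s5 + 1)) by (apply Rinv_0_lt_compat; lra).
  assert (E : cosh_fast = (s5 + 2 - - phi) / (s5 + 1)).
  { unfold cosh_fast, s5. apply (Rmult_eq_reg_r (2 * (2 * phi - 1 + 1))); [|lra]. field_simplify; [nra|lra]. }
  rewrite E. apply arccosh_le.
  - apply (Rmult_le_reg_r (s5 + 1)); [lra|]. unfold Rdiv. rewrite Rmult_assoc, Rinv_l by lra.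
    destruct C as [-> | [-> | ->]]; lra.
  - apply Rmult_le_compat_r; [lra|]. destruct C as [-> | [-> | ->]]; lra.
Qed.

(** The bound is the circumradius: the center pairs equally with all corners, and the coefficients
    of [y] with respect to the corners add up to at most 1. *)
Lemma dH_to_center (N : nat -> vec) (c y : H2) : frame N -> is_ctr N c -> cell N y ->
  dH c y <= arccosh (ctr_scale * (sqrt phi * (2 + phi))).
Proof.
  intros F Hc Hy. destruct (cone_of_normals N y F Hy) as (a & Ha & E).
  pose proof (cone_bound (vertH N F) a y Ha E) as B. rewrite coords_sheet in B.
  unfold dH. apply arccosh_le; [pose proof (H2_pairing c y); lra|].
  rewrite Hc, E. unfold vsum. autorewrite with mink.
  rewrite !(mink_sym (csum N)), !(vert_csum N) by exact F.
  destruct ctr_scale_spec as [Hs _]. destruct sqrt_phi as [Hq _]. phi_facts.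
  set (D := sqrt phi * (2 + phi)). assert (0 < D) by (unfold D; nra).
  assert (S : coef_sum a <= 1) by nra. unfold coef_sum in S.
  assert (ctr_scale * D * (a 0%nat + (a 1%nat + (a 2%nat + (a 3%nat + a 4%nat)))) <= ctr_scale * D * 1)
    by (apply Rmult_le_compat_l; nra).
  lra.
Qed.

(** Each step leaves through side 0 and relabels so that the next exit is [s] sides from the entry.
    Reflection reverses the orientation, so turns alternate: [s = 1] is the zigzag through adjacent
    sides, [s = 2] that through non-adjacent ones. *)
Fixpoint walk (s : nat) (N : nat -> vec) (k : nat) : nat -> vec :=
  match k with
  | O => N
  | S j => shift s (refl_frame (walk s N j 0%nat) (walk s N j))
  end.

Lemma walk_frame (s : nat) (N : nat -> vec) (k : nat) : frame N -> frame (walk s N k).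
Proof.
  intros F. induction k as [|k IH]; trivial. apply frame_shift, frame_refl; [apply (fr_unit _ IH)|exact IH].
Qed.

Lemma walk_csum (s : nat) (N : nat -> vec) (k : nat) : frame N ->
  csum (walk s N (S k)) = vadd (csum (walk s N k)) (vscale (- 2 * s5) (walk s N k 0%nat)).
Proof.
  intros F. pose proof (walk_frame s N k F) as G. simpl. rewrite csum_shift.
  - apply csum_refl_eq, G.
  - apply frame_refl; [apply (fr_unit _ G)|exact G].
Qed.

Lemma walk_pair (s : nat) (N : nat -> vec) (k j : nat) (x : vec) :
  mink x (walk s N (S k) j) = mink x (walk s N k (j + s)%nat)
    - 2 * mink (walk s N k 0%nat) (walk s N k (j + s)%nat) * mink x (walk s N k 0%nat).
Proof.
  simpl. unfold shift, refl_frame. rewrite <- refl_swap, refl_mink_l. ring.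
Qed.

(* Invariant of the pairings of a fixed vector with the frames of the slow walk:
   [u0], [u1] and [u2 + 2 phi u0] are its pairings with three successive walls. *)
Definition growing (u0 u1 u2 : R) : Prop := 0 < u0 /\ u0 <= u1 /\ u1 <= u2 + 2 * phi * u0.

Lemma slow_pair (N : nat -> vec) (k : nat) (x : vec) : frame N ->
  mink x (walk 1 N (S k) 0%nat) = mink x (walk 1 N k 1%nat) /\
  mink x (walk 1 N (S k) 1%nat) = mink x (walk 1 N k 2%nat) + 2 * phi * mink x (walk 1 N k 0%nat) /\
  mink x (walk 1 N (S k) 2%nat) = phi * (mink x (walk 1 N k 2%nat) - mink x (walk 1 N k 1%nat))
    + mink x (walk 1 N k 0%nat) + 2 * phi * mink x (walk 1 N k 0%nat).
Proof.
  intros F. pose proof (walk_frame 1 N k F) as G. rewrite !walk_pair. cbn [Nat.add].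
  destruct (fr_products _ G) as (_&A01&A02&A03&_). rewrite A01, A02, A03.
  pose proof (pair_rec _ x G 0) as X3. cbn [Nat.add] in X3. rewrite X3. repeat split; ring.
Qed.

Lemma growing_step (N : nat -> vec) (k : nat) (x : vec) : frame N ->
  growing (mink x (walk 1 N k 0%nat)) (mink x (walk 1 N k 1%nat)) (mink x (walk 1 N k 2%nat)) ->
  growing (mink x (walk 1 N (S k) 0%nat)) (mink x (walk 1 N (S k) 1%nat)) (mink x (walk 1 N (S k) 2%nat)).
Proof.
  intros F (H0 & H1 & H2). destruct (slow_pair N k x F) as (E0 & E1 & E2). rewrite E0, E1, E2. phi_facts.
  set (a := mink x (walk 1 N k 0%nat)) in *. set (b := mink x (walk 1 N k 1%nat)) in *.
  set (c := mink x (walk 1 N k 2%nat)) in *. unfold growing. repeat split; try lra.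
  assert (E : phi * (c - b) + a + 2 * phi * a + 2 * phi * b = phi * (c + 2 * phi * a) + (phi * b - a)).
  { replace (phi * (c + 2 * phi * a)) with (phi * c + 2 * (phi * phi) * a) by ring. rewrite Hphi2. ring. }
  rewrite E. assert (0 <= (phi - 1) * (c + 2 * phi * a)) by (apply Rmult_le_pos; lra).
  assert (0 <= (phi - 1) * b) by (apply Rmult_le_pos; lra). lra.
Qed.

Lemma slow_wall_start (N : nat -> vec) (k : nat) : frame N -> 0 < mink (csum N) (walk 1 N k 0%nat).
Proof.
  intros F. phi_facts.
  assert (G : growing (mink (csum N) (walk 1 N k 0%nat)) (mink (csum N) (walk 1 N k 1%nat)) (mink (csum N) (walk 1 N k 2%nat))).
  { induction k as [|k IH]; [|apply growing_step; trivial].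
    simpl. rewrite !(csum_normal N F). unfold growing. repeat split; nra. }
  apply G.
Qed.

(** This makes each later step move the center further beyond wall [k], so no wall of the slow walk
    is crossed back. *)
Lemma slow_wall_pair (N : nat -> vec) (k j : nat) : frame N -> 0 <= mink (walk 1 N k 0%nat) (walk 1 N (j + k) 0%nat).
Proof.
  intros F. pose proof (walk_frame 1 N k F) as G. set (u := walk 1 N k 0%nat). phi_facts.
  destruct (fr_products _ G) as (A00&A01&A02&A03&_).
  destruct (slow_pair N k u F) as (E0 & E1 & E2). 
  fold u in A00, A01, A02, E0, E1, E2. rewrite A01 in E0. rewrite A00, A02 in E1. rewrite A00, A01, A02 in E2.
  destruct (slow_pair N (S k) u F) as (D0 & D1 & D2). rewrite E1 in D0. rewrite E0, E2 in D1. rewrite E0, E1, E2 in D2.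
  destruct j as [|[|j]]; simpl (_ + _)%nat.
  - fold u. rewrite A00. lra.
  - rewrite E0. lra.
  - assert (Gr : growing (mink u (walk 1 N (S (S (j + k))) 0%nat)) (mink u (walk 1 N (S (S (j + k))) 1%nat)) (mink u (walk 1 N (S (S (j + k))) 2%nat))).
    { induction j as [|j IH]; [|apply growing_step; trivial].
      simpl (0 + k)%nat. rewrite D0, D1, D2. unfold growing. repeat split; nra. }
    apply Rlt_le, Gr.
Qed.

Lemma slow_wall_end (N : nat -> vec) (k j : nat) : frame N ->
  mink (csum (walk 1 N (S (j + k)))) (walk 1 N k 0%nat) < 0.
Proof.
  intros F. pose proof (walk_frame 1 N k F) as G. destruct s5_spec as [Hs2 Hs].
  assert (H : mink (csum (walk 1 N (S (j + k)))) (walk 1 N k 0%nat) <= - s5).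
  { induction j as [|j IH].
    - simpl (0 + k)%nat. rewrite walk_csum by exact F. autorewrite with mink.
      rewrite (csum_normal _ G), (fr_unit _ G). fold s5. lra.
    - rewrite walk_csum by exact F. autorewrite with mink.
      change (S j + k)%nat with (S (j + k)) in *.
      pose proof (slow_wall_pair N k (S j) F) as P. rewrite mink_sym in P.
      change (S j + k)%nat with (S (j + k)) in P. nra. }
  lra.
Qed.

Fixpoint tally (P : nat -> Prop) (n : nat) : nat :=
  match n with
  | O => 0
  | S k => (tally P k + if excluded_middle_informative (P k) then 1 else 0)%nat
  end.

Lemma tally_le (P Q : nat -> Prop) (n : nat) :
  (forall k, (k < n)%nat -> Q k -> P k) -> (tally Q n <= tally P n)%nat.
Proof.
  induction n as [|n IH]; intros H; simpl; [lia|].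
  assert (tally Q n <= tally P n)%nat by (apply IH; intros; apply H; trivial; lia).
  destruct (excluded_middle_informative (P n)) as [|HP], (excluded_middle_informative (Q n)) as [HQ|]; try lia.
  exfalso; apply HP, H; [lia|exact HQ].
Qed.

Lemma tally_one (P Q : nat -> Prop) (n : nat) :
  (forall k l, (k < l < n)%nat -> Q k -> ~ P k -> Q l -> ~ P l -> False) -> (tally Q n <= S (tally P n))%nat.
Proof.
  induction n as [|n IH]; intros H; simpl; [lia|].
  destruct (excluded_middle_informative (P n)) as [HP|HP], (excluded_middle_informative (Q n)) as [HQ|HQ];
    try (assert (tally Q n <= S (tally P n))%nat by (apply IH; intros k l L; apply H; lia); lia).
  assert (tally Q n <= tally P n)%nat; [|lia].
  apply tally_le. intros k L Qk. apply NNPP; intros Pk. apply (H k n); trivial; lia.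
Qed.

Lemma tally_all (P : nat -> Prop) (n : nat) : (forall k, (k < n)%nat -> P k) -> tally P n = n.
Proof.
  induction n as [|n IH]; intros H; simpl; trivial.
  destruct (excluded_middle_informative (P n)) as [|HP]; [rewrite IH; [lia|intros; apply H; lia]|].
  exfalso; apply HP, H; lia.
Qed.

Lemma tally_none (P : nat -> Prop) (n : nat) : (forall k, (k < n)%nat -> ~ P k) -> tally P n = 0%nat.
Proof.
  induction n as [|n IH]; intros H; simpl; trivial.
  destruct (excluded_middle_informative (P n)) as [HP|]; [exfalso; apply (H n); trivial; lia|].
  rewrite IH; [lia|intros; apply H; lia].
Qed.

Section Tiling.
Variable T : (H2 -> Prop) -> Prop.
Hypothesis HT : pentagon_tiling T.

Lemma upper_from_mid (l : list (dual_vertex T)) : forall (y z : dual_vertex T) (N : nat -> vec) (i : nat) (m : H2),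
  at_tile T N y -> is_mid N i m -> @edge_path (dual_tiling T) y l z ->
  dH m (proj1_sig z) <= half_edge + arccosh cosh_fast * INR (length l).
Proof.
  induction l as [|w l IH]; intros y z N i m Hy Hm Hl.
  - simpl in Hl. subst z. rewrite dH_sym, (dH_ctr_mid N i _ m (proj1 (proj1 Hy)) (proj2 Hy) Hm). simpl. lra.
  - destruct Hl as [A Hl]. apply (adjacent_iff T HT N y w Hy) in A as (j & Hw).
    assert (F := proj1 (proj1 Hy)).
    destruct (mid_exists N j F) as (m' & Hm').
    pose proof (dH_triangle m m' (proj1_sig z)). pose proof (dH_mid_le N i j m m' F Hm Hm').
    pose proof (IH w z _ j m' Hw (is_mid_refl N j m' F Hm') Hl).
    change (length (w :: l)) with (S (length l)). rewrite S_INR. lra.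
Qed.

Lemma arccosh_fast_pos : 0 < arccosh cosh_fast /\ 0 < arccosh cosh_slow.
Proof.
  phi_facts. split; (unfold arccosh; rewrite <- ln_1; apply ln_increasing; [lra|];
  match goal with |- 1 < ?x + sqrt ?y => pose proof (sqrt_pos y); unfold cosh_fast, cosh_slow in *; lra end).
Qed.

Lemma tile_inhabited : exists N, tile T N.
Proof.
  destruct (tiles_cover T HT (MkH2 (Vec 0 0 1) ltac:(unfold mink; simpl; ring) ltac:(simpl; lra))) as (P & HP & _).
  destruct (tile_of T HT P HP) as (N & HN & _). exists N; exact HN.
Qed.

Lemma half_edge_nonneg : 0 <= half_edge.
Proof.
  destruct tile_inhabited as (N & HN). destruct (ctr_exists N (proj1 HN)) as (c & Hc).
  destruct (mid_exists N 0 (proj1 HN)) as (m & Hm).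
  rewrite <- (dH_ctr_mid N 0 c m (proj1 HN) Hc Hm). apply dH_nonneg.
Qed.

Lemma upper_bound (x y : dual_vertex T) :
  dH (proj1_sig x) (proj1_sig y) <= arccosh cosh_fast * @dX (dual_tiling T) x y + 2 * half_edge.
Proof.
  destruct (combinatorial_distance_spec (dual_tiling T) x y (dual_connected T HT)) as [(l & Hl & E) _].
  unfold dX. rewrite <- E. destruct (at_tile_exists T HT x) as (N & Hx). assert (F := proj1 (proj1 Hx)).
  destruct (mid_exists N 0 F) as (m & Hm).
  pose proof (dH_triangle (proj1_sig x) m (proj1_sig y)).
  pose proof (dH_ctr_mid N 0 _ m F (proj2 Hx) Hm).
  pose proof (upper_from_mid l x y N 0 m Hx Hm Hl). change (@length (vertex (dual_tiling T)) l) with (@length (dual_vertex T) l). lra.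
Qed.

Lemma coarsely_surjective : exists C, forall y, exists x, dH (identity_map T x) y <= C.
Proof.
  exists (arccosh (ctr_scale * (sqrt phi * (2 + phi)))). intros y.
  destruct (tiles_cover T HT y) as (P & HP & Hy). destruct (tile_of T HT P HP) as (N & HN & ->).
  destruct (tile_vertex T N HN) as (x & Hx). exists x.
  apply (dH_to_center N); trivial; apply Hx.
Qed.

Lemma walk_tile (s : nat) (N : nat -> vec) (k : nat) : tile T N -> tile T (walk s N k).
Proof. intros HN. induction k as [|k IH]; trivial. apply tile_shift, tile_refl; trivial. Qed.

Lemma walk_path (s : nat) (N : nat -> vec) (n : nat) (x : dual_vertex T) : at_tile T N x ->
  exists y l, at_tile T (walk s N n) y /\ @edge_path (dual_tiling T) x l y /\ length l = n.
Proof.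
  revert N x. induction n as [|n IH]; intros N x Hx; [exists x, []; repeat split; trivial; apply Hx|].
  (* [walk] grows at its end but [edge_path] at its start; this moves the first step to the
     front. *)
  assert (E : forall k, walk s N (S k) = walk s (walk s N 1) k).
  { induction k as [|k IHk]; trivial. change (walk s N (S (S k))) with (shift s (refl_frame (walk s N (S k) 0%nat) (walk s N (S k)))).
    rewrite IHk. reflexivity. }
  destruct (tile_vertex T _ (walk_tile s N 1 (proj1 Hx))) as (z & Hz).
  destruct (IH _ z Hz) as (y & l & Hy & Hl & L). exists y, (z :: l).
  split; [rewrite E; exact Hy|split; [|exact (f_equal S L)]].
  split; [|exact Hl]. apply (adjacent_iff T HT N x z Hx). exists 0%nat.
  apply (at_tile_change T _ _ z Hz); [apply tile_refl; trivial; apply Hx|].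
  simpl. apply csum_shift, frame_refl; [apply (fr_unit N (proj1 (proj1 Hx)))|apply Hx].
Qed.

(* Every edge crosses exactly one line of the tiling, so a path is at least as long
   as the number of lines separating its endpoints. *)
Lemma walls_lower (walls : nat -> nat -> vec) (n : nat) (x y : dual_vertex T) (l : list (dual_vertex T)) :
  (forall k, tile T (walls k)) ->
  (forall j k, (j < k < n)%nat -> walls j 0%nat <> walls k 0%nat) ->
  (forall k, (k < n)%nat -> 0 < mink (proj1_sig x) (walls k 0%nat)) ->
  (forall k, (k < n)%nat -> mink (proj1_sig y) (walls k 0%nat) < 0) ->
  @edge_path (dual_tiling T) x l y -> (n <= length l)%nat.
Proof.
  intros HW Hd Hx Hy Hl.
  set (P := fun (z : dual_vertex T) k => mink (proj1_sig z) (walls k 0%nat) < 0).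
  assert (H : forall (l : list (dual_vertex T)) (x : dual_vertex T), @edge_path (dual_tiling T) x l y -> (tally (P y) n <= tally (P x) n + length l)%nat).
  { clear l x Hx Hl. induction l as [|w l IH]; intros x Hl.
    - simpl in Hl. subst x. simpl. lia.
    - destruct Hl as [A Hl]. specialize (IH w Hl). simpl.
      assert (tally (P w) n <= S (tally (P x) n))%nat; [|lia].
      destruct (at_tile_exists T HT x) as (N & Hx). apply (adjacent_iff T HT N x w Hx) in A as (i & Hw).
      destruct ctr_scale_spec as [Hc _].
      assert (K : forall k, P w k -> ~ P x k -> walls k 0%nat = N i).
      { intros k Pw Px. unfold P in Pw, Px. rewrite (proj2 Hw), mink_scale_l in Pw. rewrite (proj2 Hx), mink_scale_l in Px.
        apply (wall_unique T HT N (walls k) i 0 (proj1 Hx) (HW k)); [|nra].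
        pose proof (odd_element_neq0 _ (tile_odd T HT N (walls k) 0 (proj1 Hx) (HW k))) as NZ.
        destruct (Rdichotomy _ _ NZ); [exfalso; apply Px; nra|lra]. }
      apply tally_one. intros j k L Qj Pj Qk Pk. apply (Hd j k L). rewrite (K j), (K k); trivial. }
  specialize (H l x Hl). rewrite (tally_all (P y)) in H by exact Hy.
  rewrite (tally_none (P x)) in H; [lia|]. intros k L Pk. specialize (Hx k L). unfold P in Pk. lra.
Qed.

Lemma slow_pairs (n : nat) : exists x y : dual_vertex T,
  INR n <= @dX (dual_tiling T) x y /\
  dH (proj1_sig x) (proj1_sig y) <= arccosh cosh_slow * INR n + 2 * half_edge.
Proof.
  destruct tile_inhabited as (N & HN). assert (F := proj1 HN).
  destruct (tile_vertex T N HN) as (x & Hx). destruct (walk_path 1 N n x Hx) as (y & l0 & Hy & _).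
  exists x, y. split.
  - destruct (combinatorial_distance_spec (dual_tiling T) x y (dual_connected T HT)) as [(l & Hl & E) _].
    unfold dX. rewrite <- E. apply le_INR. destruct ctr_scale_spec as [Hc _].
    apply (walls_lower (walk 1 N) n x y l); trivial.
    + intros k. apply walk_tile, HN.
    (* If two walls coincided, the center of the tile about to cross the later one would lie on both
       sides of it. *)
    + intros j k L Ejk. pose proof (slow_wall_end N j (k - S j) F) as Q.
      replace (S (k - S j + j)) with k in Q by lia. rewrite Ejk, csum_normal in Q by (apply walk_frame, F).
      phi_facts. lra.
    + intros k L. rewrite (proj2 Hx), mink_scale_l. pose proof (slow_wall_start N k F). nra.
    + intros k L. rewrite (proj2 Hy), mink_scale_l. pose proof (slow_wall_end N k (n - S k) F) as Q.
      replace (S (n - S k + k)) with n in Q by lia. nra.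
  - assert (H : forall k m, is_mid (walk 1 N k) 0 m -> dH (proj1_sig x) m <= half_edge + arccosh cosh_slow * INR k).
    { induction k as [|k IH]; intros m Hm.
      - simpl in Hm. rewrite (dH_ctr_mid N 0 _ m F (proj2 Hx) Hm). simpl. lra.
      - pose proof (walk_frame 1 N k F) as G. destruct (mid_exists _ 0 G) as (m' & Hm').
        pose proof (IH m' Hm') as I. pose proof (dH_triangle (proj1_sig x) m' m).
        assert (E : dH m' m = arccosh cosh_slow).
        (* After the shift by 1, the side just crossed has index 4. *)
        { apply (dH_mid_adjacent (walk 1 N (S k)) 4 0); trivial.
          - apply walk_frame, F.
          - assert (G' : frame (refl_frame (walk 1 N k 0%nat) (walk 1 N k)))
              by (apply frame_refl; [apply (fr_unit _ G)|exact G]).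
            simpl. apply is_mid_shift; [exact G'|].
            apply (is_mid_change (refl_frame (walk 1 N k 0%nat) (walk 1 N k)) _ 0).
            + reflexivity.
            + symmetry; apply (fr_periodic _ G' 0).
            + apply is_mid_refl; trivial.
          - rewrite mink_sym. apply (fr_d4 _ (walk_frame 1 N (S k) F) 0). }
        rewrite S_INR. lra. }
    pose proof (walk_frame 1 N n F) as G. destruct (mid_exists _ 0 G) as (m & Hm).
    pose proof (H n m Hm). pose proof (dH_triangle (proj1_sig x) m (proj1_sig y)).
    rewrite (dH_sym m), (dH_ctr_mid _ 0 _ m G (proj2 Hy) Hm) in H1. lra.
Qed.

(** Here mu = exp (- t) for the fast rate t, and the quadratic equation is exp t + exp (- t) = 2
    cosh t. *)
Lemma fast_root : exists mu, 0 < mu < 1 /\ mu * mu + 1 = (2 + phi) * mu /\ exp (arccosh cosh_fast) * mu = 1.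
Proof.
  phi_facts. assert (H1 : 1 <= cosh_fast) by (unfold cosh_fast; lra).
  exists (/ expd cosh_fast). rewrite (expd_arccosh _ H1). pose proof (expd_ge _ H1) as H2.
  assert (H3 : 1 < expd cosh_fast) by (unfold cosh_fast in *; lra).
  pose proof (expd_inv _ H1) as E. set (e := expd cosh_fast) in *.
  split; [split; [apply Rinv_0_lt_compat; lra|rewrite <- Rinv_1; apply Rinv_lt_contravar; lra]|].
  split; [|apply Rinv_r; lra].
  replace (2 + phi) with (2 * cosh_fast) by (unfold cosh_fast; field). rewrite E. field. lra.
Qed.

Lemma fast_pairs (n : nat) : exists x y : dual_vertex T,
  @dX (dual_tiling T) x y <= INR n /\
  arccosh cosh_fast * INR n <= dH (proj1_sig x) (proj1_sig y).
Proof.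
  destruct tile_inhabited as (N & HN). assert (F := proj1 HN).
  destruct (tile_vertex T N HN) as (x & Hx). destruct (walk_path 2 N n x Hx) as (y & l & Hy & Hl & L).
  exists x, y. split.
  - unfold dX. apply le_INR. rewrite <- L.
    apply (combinatorial_distance_spec (dual_tiling T) x y (dual_connected T HT)), Hl.
  - destruct fast_root as (mu & [M0 M1] & M2 & ME). phi_facts. destruct s5_spec as [Hs2 Hs].
    (* The endpoint at infinity of the axis of the walk. *)
    set (xi := vadd (mid_vec N 0) (vscale (- mu) (mid_vec N 3))).
    destruct (fr_products N F) as (A00&A01&A02&A03&A04&A11&A12&A13&A14&A22&A23&A24&A33&_).
    assert (A31 := A13). assert (A32 := A23). assert (A30 := A03). rewrite mink_sym in A30, A31, A32.
    assert (Null : mink xi xi = 0).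
    { unfold xi. autorewrite with mink. rewrite !(mid_vec_mink N _ _ F), A00, A03, A30, A33.
      transitivity (- (5 * s5 + 5) * (mu * mu + 1) + 2 * mu * (5 * s5 + 10 + 5 * phi)); [ring|].
      rewrite M2. unfold s5. ring [Hphi2]. }
    (* Passing to the next tile multiplies all pairings with [xi] by [mu]; hence the Busemann
       function changes by exactly the fast rate in each step. *)
    assert (X : forall k, mink xi (walk 2 N k 0%nat) = mu ^ k * (s5 * (- mu * (1 + phi))) /\
       mink xi (walk 2 N k 1%nat) = mu ^ k * (s5 * (1 - mu * (1 + phi))) /\
       mink xi (walk 2 N k 2%nat) = mu ^ k * (s5 * (1 + phi - mu))).
    { induction k as [|k (I0 & I1 & I2)].
      - simpl. unfold xi, mid_vec. autorewrite with mink. rewrite !(csum_normal N F), A00, A01, A02, A30, A31, A32.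
        unfold s5. repeat split; ring.
      - pose proof (walk_frame 2 N k F) as G. rewrite !walk_pair. cbn [Nat.add].
        destruct (fr_products _ G) as (_&_&B02&B03&B04&_). rewrite B02, B03, B04.
        pose proof (pair_rec _ xi G 0) as X3. pose proof (pair_rec _ xi G 1) as X4. cbn [Nat.add] in *.
        rewrite X4, X3, I0, I1, I2. simpl pow.
        assert (M2' : mu * mu = (2 + phi) * mu - 1) by lra.
        repeat split.
        + transitivity (mu ^ k * s5 * (1 + phi - mu - 2 * phi * mu * (1 + phi))); [ring|].
          transitivity (mu ^ k * s5 * (- (mu * mu) * (1 + phi))); [rewrite M2'; ring [Hphi2]|ring].
        + transitivity (mu ^ k * s5 * (mu - (mu * mu) * (1 + phi))); [rewrite M2'; ring [Hphi2]|ring].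
        + transitivity (mu ^ k * s5 * (mu * (1 + phi) - mu * mu)); [rewrite M2'; ring [Hphi2]|ring]. }
    assert (S : forall k, mink xi (csum (walk 2 N k)) = - (mu ^ k * ((5 * s5 + 5) * (1 - mu)))).
    { intros k. destruct (X k) as (I0 & I1 & I2). pose proof (walk_frame 2 N k F) as G.
      pose proof (pair_rec _ xi G 0) as X3. pose proof (pair_rec _ xi G 1) as X4. cbn [Nat.add] in *.
      unfold csum. autorewrite with mink. rewrite X4, X3, I0, I1, I2. unfold s5. ring [Hphi2]. }
    assert (P : forall k, 0 < mu ^ k) by (intros k; apply pow_lt, M0).
    destruct ctr_scale_spec as [Hc _].
    pose proof (busemann_lipschitz (proj1_sig x) (proj1_sig y) xi ltac:(lra)) as B.
    rewrite (proj2 Hx), (proj2 Hy), !mink_scale_l, !(mink_sym (csum _)), (S n) in B.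
    change (csum N) with (csum (walk 2 N 0)) in B. rewrite (S 0%nat) in B. simpl (mu ^ 0) in B.
    set (D := (5 * s5 + 5) * (1 - mu)) in *. assert (HD : 0 < D) by (unfold D; apply Rmult_lt_0_compat; lra).
    pose proof (P n) as Pn. assert (0 < ctr_scale * D) by nra.
    specialize (B ltac:(nra)).
    assert (E : exp (arccosh cosh_fast * INR n) * mu ^ n = 1).
    { rewrite exp_INR, <- Rpow_mult_distr, ME. apply pow1. }
    assert (B' : exp (arccosh cosh_fast * INR n) <= exp (dH (proj1_sig x) (proj1_sig y))).
    { apply (Rmult_le_reg_r (mu ^ n * (ctr_scale * D))); [nra|].
      replace (exp (arccosh cosh_fast * INR n) * (mu ^ n * (ctr_scale * D)))
        with (exp (arccosh cosh_fast * INR n) * mu ^ n * (ctr_scale * D)) by ring.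
      rewrite E. lra. }
    destruct (Rle_lt_dec (arccosh cosh_fast * INR n) (dH (proj1_sig x) (proj1_sig y))) as [|L']; trivial.
    apply exp_increasing in L'. lra.
Qed.

End Tiling.

(** * Lower bound *)

(* The geodesic through the midpoints of consecutive adjacent sides meets each side at an
   angle with cosine [q / tanh (s / 2)], where [s] is the side length. *)
Definition q : R := sqrt ((phi - 1) / (phi + 3)).

Lemma q_spec : 0.3658 < q < 0.3659 /\
  (1 - q) * (1 - q) + (1 + q) * (1 + q) = (phi + 1) * ((1 - q) * (1 + q)).
Proof.
  phi_facts.
  assert (Hx : 0 < (phi - 1) / (phi + 3)) by (apply Rdiv_lt_0_compat; lra).
  assert (Hq : q * q = (phi - 1) / (phi + 3)) by (apply sqrt_sqrt; lra).
  assert (H0 : 0 <= q) by apply sqrt_pos.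
  assert (E : q * q * (phi + 3) = phi - 1) by (rewrite Hq; field; lra).
  assert (q * q * 4.618033 <= 0.618034) by nra.
  assert (0.618033 <= q * q * 4.618034) by nra.
  split; [split; nra|]. nra.
Qed.

(** Thus [q] is the hyperbolic tangent of half the slow rate. *)
Lemma exp_slow : exp (arccosh cosh_slow) * (1 - q) = 1 + q.
Proof.
  destruct q_spec as [Hq E]. phi_facts.
  rewrite expd_arccosh by (unfold cosh_slow; lra). unfold expd.
  assert (S : sqrt (cosh_slow ^ 2 - 1) = 2 * q / ((1 - q) * (1 + q))).
  { assert (C : cosh_slow = (1 + q * q) / ((1 - q) * (1 + q))).
    { unfold cosh_slow. apply (Rmult_eq_reg_r (2 * ((1 - q) * (1 + q)))); [|nra].
      transitivity ((phi + 1) * ((1 - q) * (1 + q))); [field|]. rewrite <- E. field. lra. }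
    rewrite C. replace (((1 + q * q) / ((1 - q) * (1 + q))) ^ 2 - 1) with ((2 * q / ((1 - q) * (1 + q))) ^ 2) by (field; lra).
    apply sqrt_pow2. apply Rmult_le_pos; [lra|left; apply Rinv_0_lt_compat; nra]. }
  rewrite S. unfold cosh_slow.
  replace ((phi + 1) / 2) with ((phi + 1) * ((1 - q) * (1 + q)) / (2 * ((1 - q) * (1 + q)))) by (field; lra).
  rewrite <- E. field. lra.
Qed.

(** For a point of side 0, [a] and [b] are its pairings with [N 4] and [N 1]. Slopes 1 and -1 give,
    up to a factor, the exponentials of Busemann functions of the two turning geodesics through the
    midpoint; slope 0 is the symmetric choice between them. *)
Definition pot (k a b : R) : R := (1 - k * q) * a + (1 + k * q) * b.

Lemma exp_slow_le (a b d : R) : 0 < d -> (1 + q) * a <= d * ((1 - q) * b) -> exp (arccosh cosh_slow) * a <= d * b.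
Proof.
  intros Hd H. destruct q_spec as [Hq _]. apply (Rmult_le_reg_r (1 - q)); [lra|].
  replace (exp (arccosh cosh_slow) * a * (1 - q)) with (exp (arccosh cosh_slow) * (1 - q) * a) by ring.
  rewrite exp_slow. lra.
Qed.

Lemma pairing_bilinear (N : nat -> vec) (z : vec) (a0 a1 a2 : R) :
  mink z (vadd (vscale a0 (N 0%nat)) (vadd (vscale a1 (N 1%nat)) (vscale a2 (N 2%nat)))) =
  a0 * mink z (N 0%nat) + a1 * mink z (N 1%nat) + a2 * mink z (N 2%nat).
Proof. autorewrite with mink. ring. Qed.

Lemma combination_norm (N : nat -> vec) (a0 a1 a2 : R) : frame N ->
  let e := vadd (vscale a0 (N 0%nat)) (vadd (vscale a1 (N 1%nat)) (vscale a2 (N 2%nat))) in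
  mink e e = a0 * a0 + a1 * a1 + a2 * a2 - 2 * phi * a0 * a2.
Proof.
  intros F e. unfold e. destruct (fr_products N F) as (A00&A01&A02&_&_&A11&A12&_&_&A22&_).
  autorewrite with mink.
  rewrite (mink_sym (N 1%nat) (N 0%nat)), (mink_sym (N 2%nat) (N 0%nat)), (mink_sym (N 2%nat) (N 1%nat)), A00, A01, A02, A11, A12, A22.
  ring.
Qed.

Lemma pairing_nonzero (N : nat -> vec) (z : H2) : frame N ->
  ~ (mink z (N 0%nat) = 0 /\ mink z (N 1%nat) = 0 /\ mink z (N 2%nat) = 0).
Proof.
  intros F (E0 & E1 & E2). assert (E : coords z = vzero)
    by (apply (frame_ext N); trivial; autorewrite with mink; trivial).
  pose proof (coords_sheet z) as S. rewrite E in S. autorewrite with mink in S. lra.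
Qed.

(* Entering through side 0 and leaving through the adjacent side 1: here the
   Busemann function of the geodesic through the midpoints is the potential itself. *)
Lemma turn_step (N : nat -> vec) (z z' : H2) : frame N ->
  mink z (N 0%nat) = 0 -> 0 <= mink z (N 1%nat) -> 0 <= mink z (N 4%nat) ->
  mink z' (N 1%nat) = 0 -> 0 <= mink z' (N 0%nat) -> 0 <= mink z' (N 2%nat) ->
  exp (arccosh cosh_slow) * pot 1 (mink z (N 4%nat)) (mink z (N 1%nat)) <=
  exp (dH z z') * pot 1 (mink z' (N 0%nat)) (mink z' (N 2%nat)).
Proof.
  intros F Z0 Z1 Z4 W1 W0 W2. destruct q_spec as [Hq HR]. phi_facts.
  pose proof (pair_rec N z F 0) as X3. pose proof (pair_rec N z F 1) as X4. cbn [Nat.add] in *.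
  assert (Z2 : mink z (N 2%nat) = mink z (N 4%nat) + phi * mink z (N 1%nat))
    by (rewrite X4, X3, Z0; ring [Hphi2]).
  pose proof (pairing_nonzero N z' F) as NZ.
  set (u := 1 - q) in *. set (v := 1 + q) in *. assert (Hu : 0 < u) by (unfold u; lra). assert (Hv : 0 < v) by (unfold v; lra).
  (* The coefficients are chosen so that pairing with [e] is -v times the potential on the entry
     side and -u times it on the exit side. The ratio v / u is exactly the slow rate, and [HR] makes
     [e] null. *)
  set (e := vadd (vscale (- (u * u)) (N 0%nat)) (vadd (vscale (v * (phi * u - v)) (N 1%nat)) (vscale (- (u * v)) (N 2%nat)))).
  assert (Null : mink e e = 0).
  { unfold e. rewrite (combination_norm N _ _ _ F).
    transitivity ((u * u + v * v - (phi + 1) * (u * v)) * (u * u + v * v - (phi - 1) * (u * v))); [ring [Hphi2]|rewrite HR; ring]. }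
  assert (A : mink z e = - (v * pot 1 (mink z (N 4%nat)) (mink z (N 1%nat)))).
  { unfold e. rewrite pairing_bilinear, Z0, Z2. unfold pot. replace (1 - 1 * q) with u by (unfold u; ring).
    replace (1 + 1 * q) with v by (unfold v; ring). ring. }
  assert (A' : mink z' e = - (u * pot 1 (mink z' (N 0%nat)) (mink z' (N 2%nat)))).
  { unfold e. rewrite pairing_bilinear, W1. unfold pot. replace (1 - 1 * q) with u by (unfold u; ring).
    replace (1 + 1 * q) with v by (unfold v; ring). ring. }
  assert (P : 0 < pot 1 (mink z' (N 0%nat)) (mink z' (N 2%nat))).
  { unfold pot. replace (1 - 1 * q) with u by (unfold u; ring). replace (1 + 1 * q) with v by (unfold v; ring).
    assert (0 <= u * mink z' (N 0%nat)) by nra. assert (0 <= v * mink z' (N 2%nat)) by nra.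
    destruct (Rle_lt_dec (mink z' (N 0%nat)) 0); [|nra].
    destruct (Rle_lt_dec (mink z' (N 2%nat)) 0); [|nra]. exfalso; apply NZ; repeat split; lra. }
  pose proof (busemann_lipschitz z z' e ltac:(lra) ltac:(rewrite A'; nra)) as B. rewrite A, A' in B.
  apply exp_slow_le; [apply exp_pos|]. fold u v. lra.
Qed.

(** The coefficients by which the Busemann pairing on the entry side exceeds (1 + q) times the
    potential of slope [k], used when the exit slope is 1. *)
Lemma exact_coefficients (k : R) : -1 <= k <= 1 ->
  0 <= (1 + q) * (1 + q) - (1 + q) * (1 - k * q) /\
  0 <= phi * (1 + q) * (1 + q) - phi * (1 - q) * (1 + q) + (1 - q) * (1 - q) - (1 + q) * (1 + k * q).
Proof.
  intros Hk. destruct q_spec as [Hq _]. pose proof phi_bounds as Hphi.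
  assert (0 <= (1 - k) * q /\ 0 <= (1 + k) * q) as [L1 L2] by (split; apply Rmult_le_pos; lra).
  set (s := k * q) in *. replace ((1 - k) * q) with (q - s) in L1 by (unfold s; ring).
  replace ((1 + k) * q) with (q + s) in L2 by (unfold s; ring). clearbody s. clear Hk k.
  assert (0 <= (1 + q) * (q + s)) by (apply Rmult_le_pos; lra).
  assert (0 <= (1 + q) * (q - s)) by (apply Rmult_le_pos; lra).
  split; [lra|].
  assert (0 <= (phi - 1.6) * ((1 + q) * q)) by (repeat apply Rmult_le_pos; lra).
  assert (0 <= (q - 0.36) * (q - 0.36)) by apply Rle_0_sqr. nra.
Qed.

(* In the last two cases any null or timelike vector near the axis of the chord will do; the
   decimal coefficients make the four corner inequalities strict. *)
Lemma opposite_step (N : nat -> vec) (z z' : H2) (k k' : R) : frame N ->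
  mink z (N 0%nat) = 0 -> 0 <= mink z (N 1%nat) -> 0 <= mink z (N 4%nat) ->
  mink z' (N 2%nat) = 0 -> 0 <= mink z' (N 1%nat) -> 0 <= mink z' (N 3%nat) ->
  (k' = 1 /\ -1 <= k <= 1) \/ (k = 1 /\ k' = -1) \/ (0 <= k <= 1 /\ k' = 0) ->
  exp (arccosh cosh_slow) * pot k (mink z (N 4%nat)) (mink z (N 1%nat)) <=
  exp (dH z z') * pot k' (mink z' (N 1%nat)) (mink z' (N 3%nat)).
Proof.
  intros F Z0 Z1 Z4 W2 W1 W3 Hk. destruct q_spec as [Hq HR]. phi_facts.
  pose proof (pair_rec N z F 0) as X3. pose proof (pair_rec N z F 1) as X4. pose proof (pair_rec N z' F 0) as Y3.
  cbn [Nat.add] in *.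
  assert (Z2 : mink z (N 2%nat) = mink z (N 4%nat) + phi * mink z (N 1%nat))
    by (rewrite X4, X3, Z0; ring [Hphi2]).
  assert (W0 : mink z' (N 0%nat) = mink z' (N 3%nat) + phi * mink z' (N 1%nat)) by (rewrite Y3, W2; ring).
  pose proof (pairing_nonzero N z' F) as NZ.
  set (p := mink z (N 1%nat)) in *. set (r := mink z (N 4%nat)) in *.
  set (p' := mink z' (N 1%nat)) in *. set (r' := mink z' (N 3%nat)) in *.
  assert (NZ' : 0 < p' + r').
  { destruct (Rle_lt_dec (p' + r') 0); trivial. exfalso; apply NZ. rewrite W0.
    replace p' with 0 in * by lra. replace r' with 0 in * by lra. repeat split; lra. }
  assert (Gen : forall a0 a1 a2, a0 * a0 + a1 * a1 + a2 * a2 - 2 * phi * a0 * a2 <= 0 ->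
     0 < - (a0 * (r' + phi * p') + a1 * p') ->
     - (a1 * p + a2 * (r + phi * p)) <= exp (dH z z') * - (a0 * (r' + phi * p') + a1 * p')).
  { intros a0 a1 a2 Hn Ha.
    set (e := vadd (vscale a0 (N 0%nat)) (vadd (vscale a1 (N 1%nat)) (vscale a2 (N 2%nat)))).
    assert (A : mink z e = a1 * p + a2 * (r + phi * p)) by (unfold e; rewrite pairing_bilinear, Z0, Z2; fold p; ring).
    assert (A' : mink z' e = a0 * (r' + phi * p') + a1 * p') by (unfold e; rewrite pairing_bilinear, W0, W2; fold p'; ring).
    rewrite <- A, <- A'. apply busemann_lipschitz; [unfold e; rewrite (combination_norm N _ _ _ F); exact Hn|lra]. }
  set (X := exp (dH z z')) in *. assert (HX : 0 < X) by apply exp_pos.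
  (* When the pairing with the chosen vector is not proportional to the potentials,
     cross-multiplication yields an inequality bilinear in entry and exit pairings, to be checked on
     the four products of [r], [p] with [r'], [p']. *)
  assert (Bil : forall A B E E', 0 < B -> A <= X * B -> 0 <= E' -> (1 + q) * E * B <= (1 - q) * (A * E') ->
     exp (arccosh cosh_slow) * E <= X * E').
  { intros A B E E' HB HAB HE' H. apply exp_slow_le; trivial.
    apply (Rmult_le_reg_r B); trivial.
    assert (A * E' <= X * B * E') by (apply Rmult_le_compat_r; trivial).
    assert ((1 - q) * (A * E') <= (1 - q) * (X * B * E')) by (apply Rmult_le_compat_l; lra). lra. }
  assert (M : forall a b x y, 0 <= x -> 0 <= y -> 0 <= a -> 0 <= b -> 0 <= a * x + b * y).
  { intros a b x y ? ? ? ?. apply Rplus_le_le_0_compat; apply Rmult_le_pos; trivial. }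
  destruct Hk as [[-> Hk]|[[-> ->]|[Hk ->]]].
  - (* The Busemann function of the next turning geodesic, exact on the exit side. *)
    set (u := 1 - q) in *. set (v := 1 + q) in *.
    assert (Hu : 0.6341 < u < 0.6342) by (unfold u; lra). assert (Hv : 1.3658 < v < 1.3659) by (unfold v; lra).
    assert (EP : pot 1 p' r' = u * p' + v * r') by (unfold pot, u, v; ring). rewrite EP.
    assert (HP : 0 < u * p' + v * r') by nra.
    assert (B := Gen (- (u * v)) (u * (phi * v - u)) (- (v * v))).
    assert (B1 : - (u * (phi * v - u) * p + - (v * v) * (r + phi * p)) <= X * (u * (u * p' + v * r'))).
    { replace (u * (u * p' + v * r')) with (- (- (u * v) * (r' + phi * p') + u * (phi * v - u) * p')) by ring.
      apply B.
      - right. transitivity ((u * u + v * v - (phi + 1) * (u * v)) * (u * u + v * v - (phi - 1) * (u * v))); [ring [Hphi2]|rewrite HR; ring].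
      - replace (- (- (u * v) * (r' + phi * p') + u * (phi * v - u) * p')) with (u * (u * p' + v * r')) by ring. nra. }
    apply exp_slow_le; trivial. fold u v.
    assert (C : v * pot k r p <= - (u * (phi * v - u) * p + - (v * v) * (r + phi * p))).
    { unfold pot. replace (- (u * (phi * v - u) * p + - (v * v) * (r + phi * p))) with (v * v * r + (phi * v * v - phi * u * v + u * u) * p) by ring.
      destruct (exact_coefficients k Hk) as [L1 L2]. fold u v in L1, L2.
      assert (Q := M (v * v - v * (1 - k * q)) (phi * v * v - phi * u * v + u * u - v * (1 + k * q)) r p Z4 Z1 L1 L2).
      lra. }
    lra.
  - apply (Bil (- (- (2/5) * p + - (14/5) * (r + phi * p))) (- (- (1) * (r' + phi * p') + - (2/5) * p'))).
    + nra.
    + apply Gen; nra.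
    + unfold pot. apply M; lra.
    + unfold pot.
      assert (Q1 := M ((1-q)*(14/5)*(1-q) - (1+q)*(1-q)) ((1-q)*(14/5)*(1+q) - (1+q)*(1-q)*(phi+2/5)) (r*r') (r*p')
        ltac:(nra) ltac:(nra) ltac:(nra) ltac:(nra)).
      assert (Q2 := M ((1-q)*(2/5+14/5*phi)*(1-q) - (1+q)*(1+q)) ((1-q)*(2/5+14/5*phi)*(1+q) - (1+q)*(1+q)*(phi+2/5)) (p*r') (p*p')
        ltac:(nra) ltac:(nra) ltac:(nra) ltac:(nra)).
      lra.
  - apply (Bil (- (3/5 * p + - (27/10) * (r + phi * p))) (- (- (1) * (r' + phi * p') + 3/5 * p'))).
    + nra.
    + apply Gen; nra.
    + unfold pot. apply M; lra.
    + unfold pot. assert (L : 0 <= k * q <= q) by (split; nra). set (s := k * q) in *. clearbody s.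
      assert (Q1 := M ((1-q)*(27/10) - (1+q)*(1-s)) ((1-q)*(27/10) - (1+q)*(1-s)*(phi-3/5)) (r*r') (r*p')
        ltac:(nra) ltac:(nra) ltac:(nra) ltac:(nra)).
      assert (Q2 := M ((1-q)*(27/10*phi-3/5) - (1+q)*(1+s)) ((1-q)*(27/10*phi-3/5) - (1+q)*(1+s)*(phi-3/5)) (p*r') (p*p')
        ltac:(nra) ltac:(nra) ltac:(nra) ltac:(nra)).
      lra.
Qed.

(* A side is crossed between its two neighbouring lines, with normals [n4] and [n1].
   The geodesic from [c] to [e] meets each of them before this crossing, after it, or never;
   [k] is the slope of the potential on the side, read towards the line of [n1]. *)
Definition slope (c e : H2) (n4 n1 : vec) (k : R) : Prop :=
  (k = 1 /\ (mink e n1 < 0 \/ mink c n4 < 0)) \/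
  (k = -1 /\ (mink c n1 < 0 \/ mink e n4 < 0)) \/
  (k = 0 /\ ~ (mink e n1 < 0 \/ mink c n4 < 0) /\ ~ (mink c n1 < 0 \/ mink e n4 < 0)).

Lemma slope_exists (c e : H2) (n4 n1 : vec) : exists k, slope c e n4 n1 k.
Proof.
  unfold slope. destruct (classic (mink e n1 < 0 \/ mink c n4 < 0)) as [H|H]; [exists 1; tauto|].
  destruct (classic (mink c n1 < 0 \/ mink e n4 < 0)) as [H'|H']; [exists (-1); tauto|exists 0; tauto].
Qed.

Lemma slope_range (c e : H2) (n4 n1 : vec) (k : R) : slope c e n4 n1 k -> -1 <= k <= 1.
Proof. intros [[-> _]|[[-> _]|[-> _]]]; lra. Qed.

Lemma slope_swap (c e : H2) (n4 n1 : vec) (k : R) : slope c e n4 n1 k -> slope c e n1 n4 (- k).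
Proof.
  intros [[-> H]|[[-> H]|[-> H]]]; unfold slope; [right; left|left|right; right]; (split; [lra|tauto]).
Qed.

Lemma pot_swap (k a b : R) : pot k a b = pot (- k) b a.
Proof. unfold pot; ring. Qed.

Lemma segment_sign (c e z : H2) (n : vec) : segment c e z -> 0 <= mink z n -> mink c n < 0 -> mink e n < 0 -> False.
Proof.
  intros (a & b & Ha & Hb & E) Hz Hc He. rewrite E in Hz. autorewrite with mink in Hz.
  assert (a = 0) by nra. assert (b = 0) by nra. subst.
  pose proof (coords_sheet z) as S. rewrite E in S. autorewrite with mink in S. lra.
Qed.

Lemma segment_point (p r : H2) (a b : R) : 0 < a -> 0 <= b ->
  exists (z : H2) (k : R), 0 < k /\ coords z = vscale k (vadd (vscale a p) (vscale b r)).
Proof.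
  intros Ha Hb. apply normalize.
  - autorewrite with mink. rewrite (mink_sym r p), !coords_sheet. pose proof (H2_pairing p r).
    assert (0 <= a * b) by nra. nra.
  - simpl. pose proof (coords_upper p). pose proof (coords_upper r). nra.
Qed.

Lemma segment_trans (c e z w : H2) : segment c e z -> segment z e w -> segment c e w.
Proof.
  intros (a & b & Ha & Hb & E) (a' & b' & Ha' & Hb' & E').
  exists (a' * a), (a' * b + b'). split; [nra|split; [nra|]]. rewrite E', E. vec_ring.
Qed.

Lemma least_ratio (t : nat -> R) (P : nat -> Prop) (l : list nat) : (exists k, In k l /\ P k) ->
  exists j, In j l /\ P j /\ forall k, In k l -> P k -> t j <= t k.
Proof.
  induction l as [|a l IH]; intros (k & Hk & Pk); [destruct Hk|].
  destruct (classic (exists k, In k l /\ P k)) as [H|H].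
  - destruct (IH H) as (j & Hj & Pj & L). destruct (classic (P a)) as [Pa|Pa].
    + destruct (Rle_lt_dec (t a) (t j)) as [La|La].
      * exists a. split; [left; trivial|split; trivial]. intros i [<-|Hi] Pi; [lra|]. pose proof (L i Hi Pi). lra.
      * exists j. split; [right; trivial|split; trivial]. intros i [<-|Hi] Pi; [lra|]. apply L; trivial.
    + exists j. split; [right; trivial|split; trivial]. intros i [<-|Hi] Pi; [contradiction|]. apply L; trivial.
  - exists a. destruct Hk as [<-|Hk]; [|exfalso; apply H; exists k; split; trivial].
    split; [left; trivial|split; trivial]. intros i [<-|Hi] Pi; [lra|]. exfalso; apply H; exists i; split; trivial.
Qed.

Lemma frame_index (N : nat -> vec) (i : nat) : frame N -> exists d, In d [0; 1; 2; 3; 4]%nat /\ N i = N d.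
Proof.
  intros F. destruct (shift_cases N F 0 i) as (d & Hd & E). exists d. rewrite Nat.add_0_r in E.
  split; [|exact E]. simpl. lia.
Qed.

(** The segment meets line [k] at the parameter given by the ratio of [mink z (N k)] to
    [- mink e (N k)]; the side with the least ratio is the first one met. *)
Lemma exit_point (N : nat -> vec) (z e : H2) : frame N -> cell N z -> (exists i, mink e (N i) < 0) ->
  exists (j : nat) (w : H2), In j [0; 1; 2; 3; 4]%nat /\ mink e (N j) < 0 /\ mink w (N j) = 0 /\ cell N w /\ segment z e w.
Proof.
  intros F Hz (i & Hi). destruct (frame_index N i F) as (d & Hd & Ed). rewrite Ed in Hi.
  destruct (least_ratio (fun k => mink z (N k) / - mink e (N k)) (fun k => mink e (N k) < 0) [0; 1; 2; 3; 4]%nat) as (j & Hj & Pj & L).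
  { exists d; split; trivial. }
  destruct (segment_point z e (- mink e (N j)) (mink z (N j))) as (w & k & Hk & Ew); [lra|apply Hz|].
  exists j, w. split; [trivial|split; [trivial|split; [|split]]].
  - rewrite Ew. autorewrite with mink. ring.
  - intros m. destruct (frame_index N m F) as (n & Hn & ->).
    rewrite Ew. autorewrite with mink. apply Rmult_le_pos; [lra|].
    pose proof (Hz n) as Zn. pose proof (Hz j) as Zj.
    destruct (Rlt_le_dec (mink e (N n)) 0) as [En|En].
    + pose proof (L n Hn En) as Q. cbv beta in Q.
      apply (Rmult_le_compat_r ((- mink e (N j)) * (- mink e (N n)))) in Q; [|nra].
      replace (mink z (N j) / - mink e (N j) * (- mink e (N j) * - mink e (N n))) with (mink z (N j) * - mink e (N n)) in Q by (field; lra).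
      replace (mink z (N n) / - mink e (N n) * (- mink e (N j) * - mink e (N n))) with (mink z (N n) * - mink e (N j)) in Q by (field; lra).
      lra.
    + assert (0 <= - mink e (N j) * mink z (N n)) by (apply Rmult_le_pos; lra).
      assert (0 <= mink z (N j) * mink e (N n)) by (apply Rmult_le_pos; lra). lra.
  - exists (k * - mink e (N j)), (k * mink z (N j)). pose proof (Hz j).
    split; [nra|split; [nra|]]. rewrite Ew. vec_ring.
Qed.

(** The tile beyond side [j], with the crossed side as side 0. The neighbouring lines are orthogonal
    to that side and keep their normals, so slope and potential read the same from both tiles. *)
Definition next_frame (N : nat -> vec) (j : nat) : nat -> vec := shift j (refl_frame (N j) N).

Lemma next_frame_normals (N : nat -> vec) (j : nat) : frame N ->
  next_frame N j 0%nat = vscale (-1) (N j) /\ next_frame N j 1%nat = N (1 + j)%nat /\ next_frame N j 4%nat = N (4 + j)%nat.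
Proof.
  intros F. unfold next_frame, shift, refl_frame. cbn [Nat.add]. repeat split.
  - unfold refl_vec. rewrite (fr_unit N F). vec_ring.
  - apply refl_fix. rewrite mink_sym. apply (fr_orth N F).
  - apply refl_fix. rewrite mink_sym. apply (fr_d4 N F).
Qed.

Lemma side_norm (N : nat -> vec) (z : H2) : frame N -> cell N z -> mink z (N 0%nat) = 0 ->
  1 <= mink z (N 4%nat) + mink z (N 1%nat) <= 2.
Proof.
  intros F Hz Z0. assert (S : side N 0 z) by (split; trivial).
  rewrite <- (segment_side N (vertH N F 4) (vertH N F 0) 0 F eq_refl eq_refl) in S.
  destruct S as (a & b & Ha & Hb & E). cbn [coords vertH] in E.
  pose proof (coords_sheet z) as Sh. rewrite E in Sh. autorewrite with mink in Sh.
  rewrite (mink_sym (vert N 4) (vert N 0)), !(vert_sheet N _ F) in Sh.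
  destruct (vert_next N 0 F) as (_&_&_&V). cbn [Nat.add] in V. rewrite V in Sh.
  destruct (vert_normal N 0 F) as (_&V1&_&_&V4). destruct (vert_normal N 4 F) as (W4&_&W1&_).
  cbn [Nat.add] in *. rewrite (fr_periodic N F 1 : N 6%nat = N 1%nat) in W1.
  rewrite E. autorewrite with mink. rewrite V1, V4, W1, W4.
  destruct sqrt_phi as [Hs Hq]. phi_facts. assert (Hr : 1.27 < sqrt phi < 1.28) by (split; nra).
  set (s := sqrt phi) in *.
  replace (a * 0 + b * s + (a * s + b * 0)) with (s * (a + b)) by ring.
  assert (H1 : (a + b) * (a + b) <= 1) by nra. assert (H2 : 1 <= phi * ((a + b) * (a + b))) by nra.
  assert (H3 : a + b <= 1) by nra. split; [|nra].
  assert (H4 : 1 <= (s * (a + b)) * (s * (a + b))) by (replace ((s * (a + b)) * (s * (a + b))) with (s * s * ((a + b) * (a + b))) by ring; rewrite Hq; exact H2).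
  nra.
Qed.

Lemma pot_bounds (k a b : R) : -1 <= k <= 1 -> 0 <= a -> 0 <= b -> 1 <= a + b <= 2 -> 1 / 2 <= pot k a b <= 4.
Proof.
  intros Hk Ha Hb Hab. destruct q_spec as [Hq _]. unfold pot.
  assert (-0.4 <= k * q <= 0.4) by (split; nra). set (s := k * q) in *. clearbody s.
  assert (0 <= (0.4 - s) * a) by (apply Rmult_le_pos; lra). assert (0 <= (0.4 - s) * b) by (apply Rmult_le_pos; lra).
  assert (0 <= (0.4 + s) * a) by (apply Rmult_le_pos; lra). assert (0 <= (0.4 + s) * b) by (apply Rmult_le_pos; lra).
  lra.
Qed.

Section Tiling.
Variable T : (H2 -> Prop) -> Prop.
Hypothesis HT : pentagon_tiling T.
Variables x y : dual_vertex T.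

Let c : H2 := proj1_sig x.
Let e : H2 := proj1_sig y.

Lemma center_off_walls (z : dual_vertex T) (N : nat -> vec) (i : nat) : tile T N -> mink (proj1_sig z) (N i) <> 0.
Proof.
  intros HN. destruct (at_tile_exists T HT z) as (B & HB & Hz). rewrite Hz, mink_scale_l.
  destruct ctr_scale_spec as [Hc _].
  apply Rmult_integral_contrapositive_currified; [lra|]. apply odd_element_neq0, (tile_odd T HT); trivial.
Qed.

Lemma not_both_ultra (N : nat -> vec) (p : H2) (i j : nat) : frame N -> mink (N i) (N j) = - phi ->
  mink p (N i) < 0 -> mink p (N j) < 0 -> False.
Proof.
  intros F E Hi Hj. phi_facts.
  apply (ultra_disjoint N p (N i) (N j)); trivial; rewrite ?(csum_normal N F); try lra;
  first [apply (fr_unit N F)|apply H2_timelike|apply coords_upper].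
Qed.

(** The geodesic from [c] to [e] enters the tile of [N] at [z], through side 0. *)
Definition crossing (N : nat -> vec) (z : H2) : Prop :=
  tile T N /\ cell N z /\ mink z (N 0%nat) = 0 /\ segment c e z /\ mink c (N 0%nat) < 0 /\ 0 < mink e (N 0%nat).

Definition step_bound (N : nat -> vec) (z w : H2) (k k' : R) (j : nat) : Prop :=
  exp (arccosh cosh_slow) * pot k (mink z (N 4%nat)) (mink z (N 1%nat)) <=
  exp (dH z w) * pot k' (mink w (N (4 + j)%nat)) (mink w (N (1 + j)%nat)).

(** Known separations restrict the slopes. Leaving through the adjacent side 1 forces both to be 1.
    Leaving through side 2, disjointness of outer half planes rules out [e] beyond [N 4] and [c]
    beyond [N 3], which leaves the three combinations of [opposite_step]. *)
Lemma forward_step (N : nat -> vec) (z w : H2) (k k' : R) (j : nat) : crossing N z ->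
  cell N w -> mink w (N j) = 0 -> mink e (N j) < 0 -> (j = 1 \/ j = 2)%nat ->
  slope c e (N 4%nat) (N 1%nat) k -> slope c e (N (4 + j)%nat) (N (1 + j)%nat) k' -> step_bound N z w k k' j.
Proof.
  intros (HN & Hz & Z0 & Sz & Hc & He) Hw Wj Ej Hj Hk Hk'. assert (F := proj1 HN).
  destruct (fr_products N F) as (_&_&A02&A03&_&_&_&A13&A14&_&_&A24&_).
  pose proof (fun n => segment_sign c e z n Sz) as Sg.
  pose proof (fun p i j => not_both_ultra N p i j F) as U.
  unfold step_bound. destruct Hj as [-> | ->]; cbn [Nat.add] in *.
  - rewrite (fr_periodic N F 0 : N 5%nat = N 0%nat) in *.
    assert (k = 1).
    { destruct Hk as [[-> _]|[[-> [H|H]]|[-> [H _]]]]; trivial; exfalso.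
      - apply (Sg (N 1%nat)); trivial.
      - apply (U e 1%nat 4%nat); trivial.
      - apply H; left; trivial. }
    assert (k' = 1).
    { destruct Hk' as [[-> _]|[[-> [H'|H']]|[-> [H' _]]]]; trivial; exfalso.
      - apply (U c 0%nat 2%nat); trivial.
      - lra.
      - apply H'; right; trivial. }
    subst k k'. apply turn_step; trivial.
  - rewrite (fr_periodic N F 1 : N 6%nat = N 1%nat) in *.
    apply opposite_step; trivial.
    assert (N1 : mink e (N 4%nat) < 0 -> False) by (intros H; apply (U e 2%nat 4%nat); trivial).
    assert (N2 : mink c (N 3%nat) < 0 -> False) by (intros H; apply (U c 0%nat 3%nat); trivial).
    destruct Hk' as [[-> H']|[[-> [H'|H']]|[-> [H' H'']]]].
    + left. split; [reflexivity|]. apply (slope_range _ _ _ _ _ Hk).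
    + contradiction.
    + right; left. split; [|reflexivity].
      destruct Hk as [[-> _]|[[-> [H|H]]|[-> [H _]]]]; trivial; exfalso; [|contradiction|apply H; left; trivial].
      apply (Sg (N 1%nat)); trivial.
    + right; right. split; [|reflexivity].
      destruct Hk as [[-> _]|[[-> [H|H]]|[-> _]]]; [lra|exfalso; apply H'; right; exact H|contradiction|lra].
Qed.

Lemma crossing_rev (N : nat -> vec) (z : H2) : crossing N z -> crossing (rev_frame N) z.
Proof.
  intros (HN & Hz & H). split; [apply tile_rev, HN|split; [apply cell_rev; [apply HN|exact Hz]|exact H]].
Qed.

(** Exits through sides 4 and 3 are the mirror images of exits through 1 and 2: reversing the frame
    swaps the neighbours of each side and negates both slopes. *)
Lemma any_step (N : nat -> vec) (z w : H2) (k k' : R) (j : nat) : crossing N z ->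
  cell N w -> mink w (N j) = 0 -> mink e (N j) < 0 -> In j [0; 1; 2; 3; 4]%nat ->
  slope c e (N 4%nat) (N 1%nat) k -> slope c e (N (4 + j)%nat) (N (1 + j)%nat) k' -> step_bound N z w k k' j.
Proof.
  intros Hc Hw Wj Ej Hj Hk Hk'. assert (F := proj1 (proj1 Hc)).
  assert (Rev : forall i, (i = 1 \/ i = 2)%nat -> N j = rev_frame N i ->
     N (4 + j)%nat = rev_frame N (1 + i) -> N (1 + j)%nat = rev_frame N (4 + i) -> step_bound N z w k k' j).
  { intros i Hi E0 E4 E1. unfold step_bound. rewrite E4, E1.
    rewrite (pot_swap k), (pot_swap k').
    assert (R1 : N 4%nat = rev_frame N 1) by reflexivity.
    assert (R4 : N 1%nat = rev_frame N 4) by (symmetry; apply (fr_mod N F); reflexivity).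
    rewrite E4, E1 in Hk'. rewrite R1, R4 in Hk |- *.
    apply (forward_step (rev_frame N) z w (- k) (- k') i); trivial.
    - apply crossing_rev, Hc.
    - apply cell_rev; trivial.
    - rewrite <- E0; trivial.
    - rewrite <- E0; trivial.
    - apply slope_swap; trivial.
    - apply slope_swap; trivial. }
  assert (Q : forall a b, (a mod 5 = (4 * b) mod 5)%nat -> N a = rev_frame N b)
    by (intros a b H; apply (fr_mod N F), H).
  destruct Hj as [<- | [<- | [<- | [<- | [<- | []]]]]].
  - destruct Hc as (_&_&_&_&_&H). lra.
  - apply forward_step; trivial; tauto.
  - apply forward_step; trivial; tauto.
  - apply (Rev 2%nat); [tauto|apply Q; reflexivity..].
  - apply (Rev 1%nat); [tauto|apply Q; reflexivity..].
Qed.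

Lemma next_crossing (N : nat -> vec) (w : H2) (j : nat) : tile T N -> cell N w -> segment c e w ->
  mink w (N j) = 0 -> mink e (N j) < 0 -> crossing (next_frame N j) w.
Proof.
  intros HN Hw Sw Wj Ej. assert (F := proj1 HN).
  destruct (next_frame_normals N j F) as (E0 & _). unfold crossing. rewrite E0, !mink_scale_r.
  split; [apply tile_shift, tile_refl; trivial|]. split; [|split; [lra|split; [exact Sw|split; [|lra]]]].
  - intros i. unfold next_frame, shift, refl_frame. rewrite <- refl_swap, refl_fix by exact Wj. apply Hw.
  - destruct (Rtotal_order (mink c (N j)) 0) as [L|[L|L]]; [|destruct (center_off_walls x N j HN L)|lra].
    exfalso. apply (segment_sign c e w (N j)); trivial; lra.
Qed.

(** By parity the center [e] is on no line, so if it is beyond no side it is interior to [N]. *)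
Lemma exit_or_end (N : nat -> vec) : tile T N -> (exists i, mink e (N i) < 0) \/ at_tile T N y.
Proof.
  intros HN. destruct (classic (exists i, mink e (N i) < 0)) as [H|H]; [left; exact H|right].
  destruct (at_tile_exists T HT y) as (B & HB). destruct ctr_scale_spec as [Hs _]. phi_facts.
  apply (at_tile_change T B N y HB HN). apply cell_csum; [apply HB|apply HN|].
  apply (overlap_vec T HT B N e); trivial; [apply HB| |].
  - intros i. unfold e. rewrite (proj2 HB), mink_scale_l, (csum_normal B (proj1 (proj1 HB))). nra.
  - intros i. destruct (Rtotal_order (mink e (N i)) 0) as [L|[L|L]]; trivial; exfalso.
    + apply H; exists i; exact L.
    + exact (center_off_walls y N i HN L).
Qed.

(** Distances add along the geodesic, so the step estimates multiply and the intermediate potentials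
    cancel. The path [l] records the tiles traversed; the bound [n] on the height makes the
    induction terminate. *)
Lemma lower_chain (B : nat -> vec) (HB : at_tile T B y) : forall (n : nat) (N : nat -> vec) (z : H2) (k : R) (v : dual_vertex T),
  crossing N z -> slope c e (N 4%nat) (N 1%nat) k -> at_tile T N v -> height B N <= INR n ->
  exists l : list (dual_vertex T), @edge_path (dual_tiling T) v l y /\
    exp (arccosh cosh_slow) ^ length l * pot k (mink z (N 4%nat)) (mink z (N 1%nat)) <= exp (dH z e) * 4.
Proof.
  induction n as [|n IH]; intros N z k v Hc Hk Hv Hn.
  { pose proof (height_pos B N (proj1 (proj1 HB)) (proj1 (proj1 Hv))). simpl in Hn. lra. }
  assert (F := proj1 (proj1 Hc)).
  destruct Hc as (HN & Hz & Z0 & Sz & Hc). assert (Cr : crossing N z) by (repeat split; trivial; apply HN || apply Hc).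
  destruct (exit_or_end N HN) as [Hex|Hy].
  - destruct (exit_point N z e F Hz Hex) as (j & w & Hj & Ej & Wj & Hw & Sw).
    assert (Sw' : segment c e w) by (apply (segment_trans c e z); trivial).
    pose proof (next_crossing N w j HN Hw Sw' Wj Ej) as Cr'.
    destruct (next_frame_normals N j F) as (_ & E1 & E4).
    destruct (slope_exists c e (N (4 + j)%nat) (N (1 + j)%nat)) as (k' & Hk').
    pose proof (any_step N z w k k' j Cr Hw Wj Ej Hj Hk Hk') as St. unfold step_bound in St.
    destruct (tile_vertex T _ (tile_refl T HT N j HN)) as (v' & Hv').
    assert (G : frame (refl_frame (N j) N)) by apply Hv'.
    assert (Hv'' : at_tile T (next_frame N j) v') by (apply at_tile_shift, Hv').
    destruct (IH (next_frame N j) w k' v' Cr') as (l & Hl & L); trivial.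
    { rewrite E1, E4. exact Hk'. }
    { unfold height, next_frame. rewrite csum_shift by exact G. fold (height B (refl_frame (N j) N)).
      rewrite height_step by exact F. rewrite S_INR in Hn.
      (* Each crossing lowers the height by at least 2 s5^2 = 10, more than the 1 consumed by the
         induction. *)
      pose proof (wall_bound T HT B N j (proj1 HB) HN) as W.
      unfold e in Ej. rewrite (proj2 HB), mink_scale_l in Ej. destruct ctr_scale_spec as [Hs _].
      assert (Neg : mink (csum B) (N j) < 0) by nra. rewrite Rabs_left in W by exact Neg.
      destruct s5_spec. nra. }
    exists (v' :: l). split.
    + split; [|exact Hl]. apply (adjacent_iff T HT N v v' Hv). exists j; exact Hv'.
    + rewrite E1, E4 in L. change (length (v' :: l)) with (S (length l)). simpl pow.
      set (ec := exp (arccosh cosh_slow)) in *. set (m := ec ^ length l) in *.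
      assert (Hm : 0 < m) by (apply pow_lt, exp_pos).
      pose proof (dH_segment z w e Sw) as D.
      set (P := pot k (mink z (N 4%nat)) (mink z (N 1%nat))) in *.
      set (P' := pot k' (mink w (N (4 + j)%nat)) (mink w (N (1 + j)%nat))) in *.
      apply Rle_trans with (exp (dH z w) * (exp (dH w e) * 4)).
      * apply Rle_trans with (exp (dH z w) * (m * P')); [|apply Rmult_le_compat_l; [left; apply exp_pos|exact L]].
        replace (ec * m * P) with (m * (ec * P)) by ring.
        replace (exp (dH z w) * (m * P')) with (m * (exp (dH z w) * P')) by ring.
        apply Rmult_le_compat_l; lra.
      * rewrite <- Rmult_assoc, <- exp_plus. apply Rmult_le_compat_r; [lra|].
        destruct D as [D|D]; [left; apply exp_increasing, D|rewrite D; right; reflexivity].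
  - exists []. split; [exact (at_tile_eq T N N v y Hv Hy eq_refl)|]. simpl length. simpl pow.
    pose proof (side_norm N z F Hz Z0) as Sn.
    destruct (pot_bounds k (mink z (N 4%nat)) (mink z (N 1%nat)) (slope_range _ _ _ _ _ Hk) (Hz 4%nat) (Hz 1%nat) Sn) as [_ P].
    pose proof (dH_nonneg z e) as Dn. pose proof (exp_ineq1_le (dH z e)). nra.
Qed.

(** The 8 is the quotient of the bounds 4 and 1/2 of [pot_bounds], at the last and the first side;
    the extra slow rate pays for the edge leaving the tile of [x]. *)
Lemma lower_bound : arccosh cosh_slow * @dX (dual_tiling T) x y <= dH c e + arccosh cosh_slow + ln 8.
Proof.
  destruct (combinatorial_distance_spec (dual_tiling T) x y (dual_connected T HT)) as [_ Hmin].
  destruct arccosh_fast_pos as [_ Hp]. assert (L8 : 0 < ln 8) by (rewrite <- ln_1; apply ln_increasing; lra).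
  destruct (at_tile_exists T HT x) as (N & Hx). destruct (at_tile_exists T HT y) as (B & HB).
  assert (HN := proj1 Hx). assert (F := proj1 HN).
  assert (Sc : segment c e c) by (exists 1, 0; split; [lra|split; [lra|vec_ring]]).
  assert (Cc : cell N c).
  { intros i. unfold c. rewrite (proj2 Hx), mink_scale_l, (csum_normal N F). destruct ctr_scale_spec. phi_facts. nra. }
  pose proof (dH_nonneg c e) as Dn.
  destruct (exit_or_end N HN) as [Hex|Hy].
  - destruct (exit_point N c e F Cc Hex) as (j & w & Hj & Ej & Wj & Hw & Sw).
    pose proof (next_crossing N w j HN Hw Sw Wj Ej) as Cr.
    destruct (slope_exists c e (next_frame N j 4%nat) (next_frame N j 1%nat)) as (k & Hk).
    destruct (tile_vertex T _ (tile_refl T HT N j HN)) as (v & Hv).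
    destruct (INR_unbounded (height B (next_frame N j))) as (n & Hn).
    destruct (lower_chain B HB n (next_frame N j) w k v Cr Hk) as (l & Hl & L); [apply at_tile_shift, Hv|lra|].
    assert (P : @edge_path (dual_tiling T) x (v :: l) y)
      by (split; [apply (adjacent_iff T HT N x v Hx); exists j; exact Hv|exact Hl]).
    apply Hmin, le_INR in P. unfold dX.
    change (length (v :: l)) with (S (length l)) in P. rewrite S_INR in P.
    destruct Cr as (HM & Hw' & W0 & _).
    pose proof (side_norm _ w (proj1 HM) Hw' W0) as Sn.
    destruct (pot_bounds k _ _ (slope_range _ _ _ _ _ Hk) (Hw' 4%nat) (Hw' 1%nat) Sn) as [Pt _].
    set (p := pot k (mink w (next_frame N j 4%nat)) (mink w (next_frame N j 1%nat))) in *.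
    set (m := length l) in *. rewrite <- exp_INR in L.
    assert (L' : exp (arccosh cosh_slow * INR m) <= exp (dH w e + ln 8)).
    { rewrite exp_plus, exp_ln by lra. pose proof (exp_pos (arccosh cosh_slow * INR m)). nra. }
    assert (L2 : arccosh cosh_slow * INR m <= dH w e + ln 8).
    { destruct (Rle_lt_dec (arccosh cosh_slow * INR m) (dH w e + ln 8)) as [|Q]; trivial.
      apply exp_increasing in Q. lra. }
    pose proof (dH_segment c w e Sw). pose proof (dH_nonneg c w). unfold m in L2. clearbody p.
    assert (arccosh cosh_slow * INR (combinatorial_distance (X := dual_tiling T) x y) <= arccosh cosh_slow * (INR (length l) + 1))
      by (apply Rmult_le_compat_l; [lra|exact P]).
    lra.
  - assert (x = y) by (apply (at_tile_eq T N N); trivial).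
    assert (P : @edge_path (dual_tiling T) x [] y) by exact H.
    apply Hmin, le_INR in P. simpl in P. unfold dX.
    rewrite (Rle_antisym _ _ P (pos_INR _)). lra.
Qed.

End Tiling.

(** * The constant *)

(** For t = 2 pi / 5, cos (3 t) = cos (2 t); this cubic in cos t has the root 1 and the quadratic
    factor solved by (phi - 1) / 2. *)
Lemma cos_2PI_5 : cos (2 * PI / 5) = (phi - 1) / 2.
Proof.
  set (t := 2 * PI / 5). pose proof PI_RGT_0 as HP.
  assert (H0 : 0 < cos t) by (apply cos_gt_0; unfold t; lra).
  assert (H1 : cos t < 1) by (rewrite <- cos_0; apply cos_decreasing_1; unfold t; lra).
  assert (C2 : cos (2 * t) = 2 * cos t * cos t - 1) by apply cos_2a_cos.
  assert (C3 : cos (3 * t) = cos (2 * t)).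
  { replace (3 * t) with (- (2 * t) + 2 * PI) by (unfold t; field).
    rewrite cos_plus, cos_2PI, sin_2PI, cos_neg. ring. }
  replace (3 * t) with (2 * t + t) in C3 by ring.
  rewrite cos_plus, C2, sin_2a in C3.
  assert (S : sin t * sin t = 1 - cos t * cos t) by (pose proof (sin2_cos2 t) as Q; unfold Rsqr in Q; lra).
  replace (2 * sin t * cos t * sin t) with (2 * (sin t * sin t) * cos t) in C3 by ring. rewrite S in C3.
  set (k := cos t) in *.
  assert (Z : (k - 1) * (4 * (k * k) + 2 * k - 1) = 0) by lra.
  apply Rmult_integral in Z as [Z|Z]; [lra|].
  phi_facts. assert (W : (2 * k + 1 - phi) * (2 * k + 1 + phi - 1) = 0) by nra.
  apply Rmult_integral in W as [W|W]; lra.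
Qed.

Lemma ln_le_minus_one (r : R) : 0 < r -> ln r <= r - 1.
Proof.
  intros H. pose proof (exp_ineq1_le (ln r)) as E. rewrite exp_ln in E by exact H. lra.
Qed.

Lemma ln_ge_one_minus_inv (r : R) : 0 < r -> 1 - / r <= ln r.
Proof.
  intros H. pose proof (ln_le_minus_one (/ r) (Rinv_0_lt_compat _ H)) as E. rewrite ln_Rinv in E by exact H. lra.
Qed.

Lemma ln_le_mono (r s : R) : 0 < r -> r <= s -> ln r <= ln s.
Proof. intros H [L|<-]; [left; apply ln_increasing; trivial|right; reflexivity]. Qed.

Lemma phi_sharp : 1.6180339887 < phi < 1.6180339888.
Proof. phi_facts. split; nra. Qed.

Lemma expd_fast_bounds : 3.3165124 < expd cosh_fast < 3.3165125.
Proof.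
  pose proof phi_sharp as Hphi. unfold expd.
  assert (Hc : 1.80901699435 <= cosh_fast <= 1.8090169944) by (unfold cosh_fast; lra).
  set (c := cosh_fast) in *. clearbody c.
  assert (Hs : sqrt (c ^ 2 - 1) * sqrt (c ^ 2 - 1) = c ^ 2 - 1) by (apply sqrt_sqrt; nra).
  pose proof (sqrt_pos (c ^ 2 - 1)). set (s := sqrt (c ^ 2 - 1)) in *. clearbody s. split; nra.
Qed.

Lemma expd_slow_bounds : 2.1537213 < expd cosh_slow < 2.1537214.
Proof.
  pose proof phi_sharp as Hphi. unfold expd.
  assert (Hc : 1.30901699435 <= cosh_slow <= 1.3090169944) by (unfold cosh_slow; lra).
  set (c := cosh_slow) in *. clearbody c.
  assert (Hs : sqrt (c ^ 2 - 1) * sqrt (c ^ 2 - 1) = c ^ 2 - 1) by (apply sqrt_sqrt; nra).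
  pose proof (sqrt_pos (c ^ 2 - 1)). set (s := sqrt (c ^ 2 - 1)) in *. clearbody s. split; nra.
Qed.

(* 25/16 approximates the quotient so well that coarse bounds on [ln B] suffice:
   [16 ln A - 25 ln B = ln (A^16 / B^25)] is about 0.0027. *)
Lemma quotient_bounds :
  Rabs (arccosh cosh_fast / arccosh cosh_slow - 15627 / 10000) < 5 / 100000.
Proof.
  unfold arccosh; fold (expd cosh_fast) (expd cosh_slow).
  pose proof expd_fast_bounds as HA. pose proof expd_slow_bounds as HB.
  set (A := expd cosh_fast) in *. set (B := expd cosh_slow) in *. clearbody A B.
  assert (A1 : A ^ 16 <= 3.3165125 ^ 16) by (apply pow_incr; lra).
  assert (A0 : 3.3165124 ^ 16 <= A ^ 16) by (apply pow_incr; lra).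
  assert (B1 : B ^ 25 <= 2.1537214 ^ 25) by (apply pow_incr; lra).
  assert (B0 : 2.1537213 ^ 25 <= B ^ 25) by (apply pow_incr; lra).
  assert (PB : 0 < B ^ 25) by (apply pow_lt; lra).
  assert (U : A ^ 16 <= 1.0027 * B ^ 25) by lra.
  assert (L : 1.00268 * B ^ 25 <= A ^ 16) by lra.
  apply ln_le_mono in U; [|apply pow_lt; lra]. apply ln_le_mono in L; [|lra].
  rewrite ln_mult in U by (try apply pow_lt; lra). rewrite ln_mult in L by (try apply pow_lt; lra).
  rewrite !ln_pow in U by lra. rewrite !ln_pow in L by lra.
  pose proof (ln_le_minus_one 1.0027 ltac:(lra)) as U'. pose proof (ln_ge_one_minus_inv 1.00268 ltac:(lra)) as L'.
  assert (Iv : / 1.00268 <= 0.99733) by lra.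
  assert (b1 : ln B <= 1).
  { pose proof (exp_ineq1_le (1 / 2)) as E.
    assert (E2 : exp 1 = exp (1 / 2) * exp (1 / 2)) by (rewrite <- exp_plus; f_equal; lra).
    rewrite <- (ln_exp 1). apply ln_le_mono; [lra|]. rewrite E2. nra. }
  (* Since e <= 3, it suffices that 3^9 <= 2.15^13. *)
  assert (b0 : 9 <= 13 * ln B).
  { replace 13 with (INR 13) by (simpl; lra). rewrite <- ln_pow by lra. rewrite <- (ln_exp 9).
    apply ln_le_mono; [apply exp_pos|].
    replace 9 with (1 * INR 9) by (simpl; lra). rewrite exp_INR.
    apply Rle_trans with (3 ^ 9); [apply pow_incr; split; [left; apply exp_pos|apply exp_le_3]|].
    apply Rle_trans with (2.15 ^ 13); [lra|apply pow_incr; lra]. }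
  replace (INR 16) with 16 in * by (simpl; lra). replace (INR 25) with 25 in * by (simpl; lra).
  set (a := ln A) in *. set (b := ln B) in *. clearbody a b.
  assert (E : a / b * b = a) by (field; lra).
  apply Rabs_def1; nra.
Qed.

(** Additive constants disappear in the limit; this isolates the two multiplicative constants of a
    quasiisometry. *)
Lemma linear_growth (a b c : R) : (forall n, a * INR n <= b * INR n + c) -> a <= b.
Proof.
  intros H. destruct (Rle_lt_dec a b) as [|L]; trivial. exfalso.
  destruct (INR_unbounded (c / (a - b))) as (n & Hn). specialize (H n).
  apply (Rmult_gt_compat_r (a - b)) in Hn; [|lra].
  replace (c / (a - b) * (a - b)) with c in Hn by (field; lra). lra.
Qed.

Theorem proposition6p1 :
  forall T : (H2 -> Prop) -> Prop, pentagon_tiling T ->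
  let X := dual_tiling T in
  let K := cos (2 * PI / 5) in
  let lambda := arccosh (2 * K ^ 2 + 2 * K + 1) / arccosh (K + 1) in
  CAT0_square_complex X /\
  (forall c : vertex X, has_card (fun f : face X => corner f c) 5) /\
  quasiisometry (@dX X) dH lambda (identity_map T) /\
  Rabs (lambda - 15627 / 10000) < 5 / 100000 /\
  (forall lambda' : R, lambda' < lambda ->
     ~ quasiisometry (@dX X) dH lambda' (identity_map T)).
Proof.
  intros T HT X K lambda.
  assert (El : lambda = arccosh cosh_fast / arccosh cosh_slow).
  { unfold lambda, K. rewrite cos_2PI_5. pose proof phi2 as Hphi2.
    replace (2 * ((phi - 1) / 2) ^ 2 + 2 * ((phi - 1) / 2) + 1) with cosh_fast by (unfold cosh_fast; nra).
    replace ((phi - 1) / 2 + 1) with cosh_slow by (unfold cosh_slow; field). reflexivity. }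
  clearbody lambda. subst lambda. clear K.
  destruct arccosh_fast_pos as [Pf Ps]. pose proof (half_edge_nonneg T HT) as Hh.
  assert (L8 : 0 < ln 8) by (rewrite <- ln_1; apply ln_increasing; lra).
  split; [apply dual_CAT0, HT|]. split; [apply five_corners, HT|].
  split; [|split; [exact quotient_bounds|]].
  - split; [apply coarsely_surjective, HT|].
    exists (/ arccosh cosh_slow), (arccosh cosh_fast), (2 * half_edge + arccosh cosh_slow + ln 8).
    split; [apply Rinv_0_lt_compat, Ps|]. split; [exact Pf|]. split; [lra|].
    split; [unfold Rdiv; ring|]. intros x y. rewrite Rinv_inv. unfold identity_map. split.
    + pose proof (lower_bound T HT x y) as L. fold X in L. lra.
    + pose proof (upper_bound T HT x y) as U. fold X in U. lra.
  - intros lambda' Hlt (_ & l1 & l2 & eps & P1 & P2 & Pe & <- & H).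
    (* The two constants are bounded separately, one by each family of zigzags, and the bounds are
       then multiplied. *)
    assert (H2 : arccosh cosh_fast <= l2).
    { apply (linear_growth _ _ eps). intros n. destruct (fast_pairs T HT n) as (x & y & D1 & D2).
      destruct (H x y) as [_ U]. unfold identity_map in U. fold X in D1.
      apply (Rmult_le_compat_l l2) in D1; lra. }
    assert (H1 : / l1 <= arccosh cosh_slow).
    { apply (linear_growth _ _ (2 * half_edge + eps)). intros n. destruct (slow_pairs T HT n) as (x & y & D1 & D2).
      destruct (H x y) as [L _]. unfold identity_map in L. fold X in D1.
      pose proof (Rinv_0_lt_compat _ P1). apply (Rmult_le_compat_l (/ l1)) in D1; lra. }
    apply (Rlt_not_le _ _ Hlt). unfold Rdiv. rewrite Rmult_comm.
    apply Rmult_le_compat; trivial; [left; apply Rinv_0_lt_compat, Ps|lra|].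
    rewrite <- (Rinv_inv l1). apply Rinv_le_contravar; [apply Rinv_0_lt_compat, P1|exact H1].
Qed.
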